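(* Let $k$ be a field with $\operatorname{char}(k)\ne 2$, let $X: y^2=p_X(x)$ be a curve of genus $1$ and $Y:y^2=p_Y(x)$ a curve of genus $2$ over $k$. There exists an indecomposable maximal isotropic subgroup $G$ of $(\operatorname{Jac}(X)\times\operatorname{Jac}(Y))[2]$ that is defined over $k$ if and only if (i) $p_Y$ admits a quadratic factor $q_Y$ over $k$; and (ii) for the complementary factor $r_Y=p_Y/q_Y$, the cubic resolvents $\varrho(p_X)$ and $\varrho(r_Y)$ have isomorphic splitting fields over $k$. (That is, if and only if there is a quadratic factor $q_Y$ of $p_Y$ over $k$ for which (ii) holds.)
   Context: The polynomials $p_X,p_Y\in k[x]$ are separable, with $p_X$ of degree $4$ and $p_Y$ of degree $6$ in the main case. $V_X=\operatorname{Jac}(X)[2](\bar k)$ and $V_Y=\operatorname{Jac}(Y)[2](\bar k)$ are $\mathbb F_2$-vector spaces of dimension $2$ and $4$ with their Weil pairings, and $V_X\times V_Y$ carries the product pairing. A maximal isotropic subgroup $G\subset V_X\times V_Y$ is indecomposable if it is not a product $G_X\times G_Y$ of maximal isotropic subgroups of $V_X$ and $V_Y$. $G$ is defined over $k$ if and only if it is stable under the absolute Galois group of $k$. For a monic quartic $p=x^4+a_3x^3+a_2x^2+a_1x+a_0\in k[x]$ the cubic resolvent is $$\varrho(p)=x^3-a_2x^2+(a_1a_3+4a_0\cdot(-1))x+(4a_0a_2-a_1^2-a_0a_3^2),$$ i.e. the monic cubic whose roots are $\alpha_1\alpha_2+\alpha_3\alpha_4$, $\alpha_1\alpha_3+\alpha_2\alpha_4$,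 $\alpha_1\alpha_4+\alpha_2\alpha_3$, where $\alpha_1,\dots,\alpha_4$ are the roots of $p$. The cubic resolvent of a general quartic is that of the monic polynomial obtained by dividing by the leading coefficient. Conventions when degrees are odd (a root is then at infinity): if $p_Y$ has degree $5$, a linear factor over $k$ is also allowed as $q_Y$ in (i); if $p_X$ or $r_Y$ has degree $3$, that polynomial itself is used in (ii) in place of its cubic resolvent. *)

(* Defs.v *)
From HB Require Import structures.
From mathcomp Require Import all_boot all_order all_algebra all_field.
From mathcomp Require Import boolp classical_sets.
From mathcomp.multinomials Require Import freeg.

Set Implicit Arguments.
Unset Strict Implicit.
Unset Printing Implicit Defensive.

Import Order.TTheory GRing.Theory Num.Theory.
Local Open Scope ring_scope.
Local Open Scope quotient_scope.

(* A smooth projective curve over an algebraically closed field K is handled  *)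
(* through its function field F: its points are the places of F / K, and the  *)
(* K-points of its Jacobian are the divisor classes of degree 0.              *)
(* F is only assumed to be a unit ring, so that the function field of         *)
(* y^2 = p(x) makes sense for every p; it is a field when p is separable and  *)
(* nonconstant, see funfield_unitE.                                           *)
Section Divisors.

Variables (K : fieldType) (F : comUnitRingType) (c : {rmorphism K -> F}).

(* Normalised discrete valuations of F that are trivial on K. The value at 0, *)
(* which should be infinite, is fixed to 0 so that equal valuations give      *)
(* equal places.                                                              *)
Record place := Place {
  ord :> F -> int;
  ord0 : ord 0 = 0;
  ordM : forall f g, f != 0 -> g != 0 -> ord (f * g) = ord f + ord g;
  ordD : forall f g, f != 0 -> g != 0 -> f + g != 0 ->
    Num.min (ord f) (ord g) <= ord (f + g);
  ord_const : forall a, a != 0 -> ord (c a) = 0;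
  ord_onto : exists2 f, f != 0 & ord f = 1
}.

HB.instance Definition _ := gen_eqMixin place.
HB.instance Definition _ := gen_choiceMixin place.

Definition divisor := {freeg place}.

Definition is_div (f : F) (D : divisor) : Prop :=
  f \is a GRing.unit /\ forall v : place, coeff v D = v f.

Definition principal (D : divisor) : bool := `[< exists f, is_div f D >].

Lemma ord1 (v : place) : v 1 = 0.
Proof. by rewrite -(rmorph1 c) ord_const ?oner_neq0. Qed.

Lemma unitr_neq0 (f : F) : f \is a GRing.unit -> f != 0.
Proof. by apply: contraTneq => ->; rewrite unitr0. Qed.

Lemma ordV (v : place) f : f \is a GRing.unit -> v f^-1 = - v f.
Proof.
move=> uf; apply/eqP; rewrite -addr_eq0 addrC -ordM.
- by rewrite divrr // ord1.
- exact: unitr_neq0.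
- by apply: unitr_neq0; rewrite unitrV.
Qed.

Lemma principal_zmod_closed : zmod_closed principal.
Proof.
split=> [|D E /asboolP[f [uf Df]] /asboolP[g [ug Eg]]]; apply/asboolP.
  by exists 1; split=> [|v]; rewrite ?unitr1 // coeff0 ord1.
exists (f / g); split=> [|v]; first by rewrite unitrM uf unitrV.
rewrite coeffB Df Eg ordM ?ordV //; first exact: unitr_neq0.
by apply: unitr_neq0; rewrite unitrV.
Qed.

HB.instance Definition _ :=
  GRing.isZmodClosed.Build divisor principal principal_zmod_closed.

Definition Pic := Quotient.quot (GRing.ZmodClosed.clone divisor principal _).
HB.instance Definition _ := Choice.on Pic.
HB.instance Definition _ := Quotient.on Pic.
HB.instance Definition _ := GRing.Zmodule.on Pic.

Definition divisor_class (D : divisor) : Pic := \pi_Pic D.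

Definition Jac2 : set Pic :=
  [set a | a *+ 2 = 0 /\ exists2 D, deg D = 0 & a = divisor_class D].

(* The value f(v) in K of a function f that is regular at v. *)
Definition eval (v : place) (f : F) : K :=
  xget 0 [set a | f = c a \/ 0 < v (f - c a)].

Definition eval_div (f : F) (D : divisor) : K :=
  \prod_(v <- dom D) eval v f ^ coeff v D.

Definition disjoint_div (D E : divisor) : Prop :=
  forall v, coeff v D = 0 \/ coeff v E = 0.

(* Weil pairing on Jac[2]: e_2([D], [E]) = f(E) / g(D), where D and E have    *)
(* disjoint supports, div f = 2 D and div g = 2 E.                            *)
Definition weil2 (a b : Pic) : K :=
  xget 0 [set z | exists D E f g,
    [/\ a = divisor_class D, b = divisor_class E & disjoint_div D E] /\
    [/\ is_div f (D *+ 2), is_div g (E *+ 2) & z = eval_div f E / eval_div g D]].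

End Divisors.

(* Action on places, divisors and divisor classes of an automorphism t of F,  *)
(* with inverse t', that is semilinear over an automorphism of K with inverse *)
(* s': the place t v is v o t'.                                               *)
Section Transport.

Variables (K : fieldType) (F : comUnitRingType) (c : {rmorphism K -> F}).
Variables (s' : {rmorphism K -> K}) (t t' : {rmorphism F -> F}).
Hypotheses (tK : cancel t t') (t'K : cancel t' t).
Hypothesis t'c : forall a, t' (c a) = c (s' a).

Let t'_eq0 f : (t' f == 0) = (f == 0).
Proof. by rewrite -[RHS](inj_eq (can_inj t'K)) rmorph0. Qed.

Fact transport_ord0 (v : place c) : v (t' 0) = 0.
Proof. by rewrite rmorph0 ord0. Qed.

Fact transport_ordM (v : place c) f g : f != 0 -> g != 0 ->
  v (t' (f * g)) = v (t' f) + v (t' g).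
Proof. by move=> nf ng; rewrite rmorphM ordM ?t'_eq0. Qed.

Fact transport_ordD (v : place c) f g : f != 0 -> g != 0 -> f + g != 0 ->
  Num.min (v (t' f)) (v (t' g)) <= v (t' (f + g)).
Proof. by move=> nf ng nfg; rewrite rmorphD ordD -?rmorphD ?t'_eq0. Qed.

Fact transport_ord_const (v : place c) a : a != 0 -> v (t' (c a)) = 0.
Proof. by move=> na; rewrite t'c ord_const ?fmorph_eq0. Qed.

Fact transport_ord_onto (v : place c) : exists2 f, f != 0 & v (t' f) = 1.
Proof.
have [f nf vf] := ord_onto v; exists (t f); last by rewrite tK.
by rewrite -t'_eq0 tK.
Qed.

Definition transport_place (v : place c) : place c :=
  @Place K F c (fun f => v (t' f)) (transport_ord0 v) (transport_ordM v)
    (transport_ordD v) (transport_ord_const v) (transport_ord_onto v).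

Definition transport_div (D : divisor c) : divisor c :=
  fglift (fun v => << transport_place v >>) D.

Definition transport_Pic (a : Pic c) : Pic c :=
  divisor_class (transport_div (repr a)).

End Transport.

Section HyperellipticFunctionField.

Variables (K : fieldType) (p : {poly K}).

(* K(x)[y] / (y^2 - p(x)) *)
Definition hyperell_eq : {poly {fraction {poly K}}} :=
  'X^2 - (FracField.tofrac p)%:P.

Definition funfield := {poly %/ hyperell_eq}.
HB.instance Definition _ := GRing.ComUnitRing.on funfield.

Definition const_funfield : K -> funfield :=
  qpolyC hyperell_eq \o @FracField.tofrac {poly K} \o polyC.
HB.instance Definition _ := GRing.RMorphism.on const_funfield.

End HyperellipticFunctionField.

Section FracMap.

Variables (R : idomainType) (s : {rmorphism R -> R}).
Local Notation tofrac := (@FracField.tofrac R).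

Definition frac_map (x : {fraction R}) : {fraction R} :=
  tofrac (s \n_(repr x)) / tofrac (s \d_(repr x)).

Lemma frac_numden (x : {fraction R}) :
  x = tofrac \n_(repr x) / tofrac \d_(repr x).
Proof.
have dn0 := denom_ratioP (repr x).
apply: (canRL (mulfK _)); first by rewrite tofrac_eq0.
rewrite -{1}[x]reprK; move: (repr x) dn0 => r dn0.
rewrite !piE; apply/eqmodP; rewrite /= FracField.equivfE /FracField.mulf.
by rewrite !numden_Ratio ?mulf_neq0 ?oner_eq0 // !mulr1 mulrC.
Qed.

Hypothesis s_inj : injective s.

Let s_eq0 a : (s a == 0) = (a == 0).
Proof. by rewrite -[RHS](inj_eq s_inj) rmorph0. Qed.

Lemma frac_map_div a b : b != 0 ->
  frac_map (tofrac a / tofrac b) = tofrac (s a) / tofrac (s b).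
Proof.
move=> nb; have := frac_numden (tofrac a / tofrac b); rewrite /frac_map.
move: (repr _) => r; have nr := denom_ratioP r.
move/eqP; rewrite eqr_div ?tofrac_eq0 // -!tofracM tofrac_eq.
move/eqP/(congr1 s); rewrite !rmorphM => e.
by apply/eqP; rewrite eqr_div ?tofrac_eq0 ?s_eq0 // -!tofracM e.
Qed.

Lemma frac_map_tofrac a : frac_map (tofrac a) = tofrac (s a).
Proof.
rewrite -[tofrac a]divr1 -tofrac1 frac_map_div ?oner_neq0 //.
by rewrite rmorph1 tofrac1 divr1.
Qed.

Lemma frac_map_zmod_morphism : zmod_morphism frac_map.
Proof.
move=> x y; rewrite (frac_numden x) (frac_numden y).
have nx := denom_ratioP (repr x); have ny := denom_ratioP (repr y).
move: (repr x) (repr y) nx ny => {x y} x y nx ny.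
rewrite -mulNr -tofracN addf_div ?tofrac_eq0 // -!(tofracM, tofracD).
rewrite !frac_map_div ?mulf_neq0 // !(rmorphM, rmorphD, rmorphN) /=.
by rewrite -mulNr addf_div ?tofrac_eq0 ?s_eq0.
Qed.

Lemma frac_map_monoid_morphism : monoid_morphism frac_map.
Proof.
split=> [|x y]; first by rewrite -tofrac1 frac_map_tofrac rmorph1.
rewrite (frac_numden x) (frac_numden y).
have nx := denom_ratioP (repr x); have ny := denom_ratioP (repr y).
move: (repr x) (repr y) nx ny => {x y} x y nx ny.
by rewrite mulf_div -!tofracM !frac_map_div ?mulf_neq0 // !rmorphM mulf_div.
Qed.

End FracMap.

Lemma frac_mapK (R : idomainType) (s t : {rmorphism R -> R}) :
  cancel s t -> cancel t s -> cancel (frac_map s) (frac_map t).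
Proof.
move=> sK tK x; rewrite {2}(frac_numden x) /frac_map.
have nx := denom_ratioP (repr x).
have ns : s \d_(repr x) != 0.
  by rewrite -(inj_eq (can_inj tK)) sK rmorph0.
by rewrite -/(frac_map t _) frac_map_div ?sK //; apply: can_inj tK.
Qed.

Section FunFieldMap.

Variable K : fieldType.

(* The automorphism of K(x) fixing x and acting on K through s. *)
Definition rat_map (s : {rmorphism K -> K}) :
    {fraction {poly K}} -> {fraction {poly K}} :=
  frac_map (map_poly s).

Fact rat_map_zmod_morphism s : zmod_morphism (rat_map s).
Proof. exact: frac_map_zmod_morphism (map_poly_inj _). Qed.

Fact rat_map_monoid_morphism s : monoid_morphism (rat_map s).
Proof. exact: frac_map_monoid_morphism (map_poly_inj _). Qed.

HB.instance Definition _ s := GRing.isZmodMorphism.Build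
  {fraction {poly K}} {fraction {poly K}} (rat_map s) (rat_map_zmod_morphism s).
HB.instance Definition _ s := GRing.isMonoidMorphism.Build
  {fraction {poly K}} {fraction {poly K}} (rat_map s) (rat_map_monoid_morphism s).

Lemma rat_mapK (s t : {rmorphism K -> K}) :
  cancel s t -> cancel t s -> cancel (rat_map s) (rat_map t).
Proof.
move=> sK tK; apply: frac_mapK => q /=.
  by rewrite -map_poly_comp map_poly_id // => a _; apply: sK.
by rewrite -map_poly_comp map_poly_id // => a _; apply: tK.
Qed.

Variable p : {poly K}.
Local Notation h := (hyperell_eq p).

Lemma size_hyperell_eq : size h = 3%N.
Proof. by rewrite size_polyDl size_polyXn // size_polyN size_polyC; case: eqP. Qed.

Lemma mk_monic_hyperell_eq : mk_monic h = h.
Proof.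
rewrite /mk_monic size_hyperell_eq /= monicE lead_coefDl ?lead_coefXn ?eqxx //.
by rewrite size_polyXn size_polyN size_polyC; case: eqP.
Qed.

(* The automorphism of K(x)[y] / (y^2 - p) fixing x and y and acting on K     *)
(* through s.                                                                 *)
Definition funfield_map (s : {rmorphism K -> K}) (f : funfield p) : funfield p :=
  in_qpoly h (map_poly (rat_map s) (f : {poly _})).

Lemma in_qpolyK (f : funfield p) : in_qpoly h (f : {poly _}) = f.
Proof. by apply: val_inj; apply: in_qpoly_small; apply: size_mk_monic. Qed.

Section Fixed.
Variable s : {rmorphism K -> K}.
Hypothesis ps : map_poly s p = p.

Lemma rat_map_tofrac q :
  rat_map s (FracField.tofrac q) = FracField.tofrac (map_poly s q).
Proof. exact: frac_map_tofrac (map_poly_inj _) _. Qed.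

Lemma map_hyperell_eq : map_poly (rat_map s) h = h.
Proof. by rewrite rmorphB /= map_polyXn map_polyC /= rat_map_tofrac ps. Qed.

Lemma funfield_map_in q :
  funfield_map s (in_qpoly h q) = in_qpoly h (map_poly (rat_map s) q).
Proof.
have hM : h \is monic by rewrite -mk_monic_hyperell_eq monic_mk_monic.
apply: val_inj; rewrite /= mk_monic_hyperell_eq.
by rewrite -!Pdiv.IdomainMonic.modpE // map_modp map_hyperell_eq modp_id.
Qed.

Fact funfield_map_zmod_morphism : zmod_morphism (funfield_map s).
Proof.
move=> f g; rewrite -[f]in_qpolyK -[g]in_qpolyK -rmorphB.
by rewrite !funfield_map_in !rmorphB.
Qed.

Fact funfield_map_monoid_morphism : monoid_morphism (funfield_map s).
Proof.
split=> [|f g]; first by rewrite -in_qpoly1 funfield_map_in rmorph1.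
by rewrite -[f]in_qpolyK -[g]in_qpolyK -rmorphM !funfield_map_in !rmorphM.
Qed.

Definition funfield_rmorph : {rmorphism funfield p -> funfield p} :=
  HB.pack (funfield_map s)
    (GRing.isZmodMorphism.Build (funfield p) (funfield p) (funfield_map s)
       funfield_map_zmod_morphism)
    (GRing.isMonoidMorphism.Build (funfield p) (funfield p) (funfield_map s)
       funfield_map_monoid_morphism).

Lemma funfield_map_const a :
  funfield_map s (const_funfield p a) = const_funfield p (s a).
Proof.
have constE b : const_funfield p b = in_qpoly h (FracField.tofrac b%:P)%:P.
  rewrite -[LHS]in_qpolyK; congr in_qpoly.
by rewrite !constE funfield_map_in map_polyC /= rat_map_tofrac map_polyC.
Qed.

End Fixed.

Lemma funfield_mapK (s t : {rmorphism K -> K}) : map_poly t p = p ->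
  cancel s t -> cancel t s -> cancel (funfield_map s) (funfield_map t).
Proof.
move=> pt sK tK f; rewrite [funfield_map s f]/funfield_map funfield_map_in //.
rewrite -map_poly_comp map_poly_id ?in_qpolyK // => a _; exact: rat_mapK.
Qed.

End FunFieldMap.
Section FunFieldIsField.

Variables (K : closedFieldType) (p : {poly K}).
Hypotheses (p_sep : separable_poly p) (p_gt1 : (1 < size p)%N).

Lemma hyperell_eq_noroot x : ~~ root (hyperell_eq p) x.
Proof.
have np := separable_poly_neq0 p_sep.
have [a pa] := closed_rootP p (negbT (gtn_eqF p_gt1)).
have mu1 : mup a p = 1%N.
  have [q pE] := factor_theorem _ _ pa; rewrite pE.
  have qa : ~~ root q a.
    apply/negP => /factor_theorem[r qE].
    have [/(_ ('X - a%:P) ('X - a%:P)) sq _] := separable_polyP p_sep.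
    have := sq; rewrite coprimepp size_XsubC pE qE -mulrA dvdp_mull //.
    by move/(_ isT).
  by rewrite mupMr // -['X - _]expr1 mup_XsubCX eqxx.
rewrite /root !(hornerE, hornerXn) subr_eq0; apply/negP.
rewrite (frac_numden x) expr_div_n.
have := denom_ratioP (repr x); move: (repr x) => r nd.
rewrite -[FracField.tofrac p]divr1 eqr_div ?expf_neq0 ?tofrac_eq0 ?oner_neq0 //.
rewrite mulr1 -!tofracXn -tofracM tofrac_eq => /eqP e.
have nn : \n_r != 0.
  by apply: contra_eq_neq e => ->; rewrite expr0n /= eq_sym mulf_neq0 ?expf_neq0.
have /(congr1 odd) := congr1 (mup a) e.
rewrite !expr2 !mupM ?mulf_neq0 // mu1.
by rewrite addnn add1n /= addnn !odd_double.
Qed.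

(* With p separable and nonconstant, K(x)[y] / (y^2 - p) is a field. *)
Lemma funfield_unitE (f : funfield p) : (f \is a GRing.unit) = (f != 0).
Proof.
have h_irr : irreducible_poly (hyperell_eq p).
  by apply: cubic_irreducible hyperell_eq_noroot; rewrite size_hyperell_eq.
have -> : (f \is a GRing.unit) = coprimep (hyperell_eq p) (f : {poly _}).
  by rewrite -{1}mk_monic_hyperell_eq.
rewrite irreducible_poly_coprime //; congr (~~ _).
apply/idP/eqP => [hf|->]; last exact: dvdp0.
apply: val_inj; apply/eqP; apply: contraLR hf => nf.
rewrite gtNdvdp // -{2}mk_monic_hyperell_eq; exact: size_mk_monic.
Qed.

End FunFieldIsField.

Section Galois.

Variables (k K : fieldType) (iota : {rmorphism k -> K}).

(* Elements of Gal(K / k); K will be an algebraic closure of k, and           *)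
(* restriction identifies its k-automorphisms with those of the separable     *)
(* closure.                                                                   *)
Record galois_aut := GaloisAut {
  gal :> {rmorphism K -> K};
  gal_inv : {rmorphism K -> K};
  galK : cancel gal gal_inv;
  gal_invK : cancel gal_inv gal;
  gal_fix : forall a, gal (iota a) = iota a
}.

Variables (s : galois_aut) (q : {poly k}).
Local Notation p := (map_poly iota q).

Fact gal_poly : map_poly s p = p.
Proof. by rewrite -map_poly_comp; apply: eq_map_poly => a; apply: gal_fix. Qed.

Fact gal_inv_poly : map_poly (gal_inv s) p = p.
Proof.
rewrite -map_poly_comp; apply: eq_map_poly => a /=.
by rewrite -{1}(gal_fix s a) galK.
Qed.

Definition gal_Pic : Pic (const_funfield p) -> Pic (const_funfield p) :=
  transport_Pic (t := funfield_rmorph gal_poly)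
    (t' := funfield_rmorph gal_inv_poly)
    (funfield_mapK gal_inv_poly (galK s) (gal_invK s))
    (funfield_mapK gal_poly (gal_invK s) (galK s))
    (funfield_map_const gal_inv_poly).

End Galois.

Section Isotropic.

Variables (K : fieldType) (A : zmodType) (V : set A) (e : A -> A -> K).

Definition is_subgroup (G : set A) : Prop :=
  G 0 /\ forall a b, G a -> G b -> G (a - b).

Definition isotropic (G : set A) : Prop :=
  forall a b, G a -> G b -> e a b = 1.

Definition isotropic_subgroup (G : set A) : Prop :=
  [/\ is_subgroup G, G `<=` V & isotropic G]%classic.

Definition maximal_isotropic (G : set A) : Prop :=
  isotropic_subgroup G /\
  forall H, isotropic_subgroup H -> (G `<=` H)%classic -> H = G.

End Isotropic.

(* X : y^2 = pX(x) and Y : y^2 = pY(x) over k; K is an algebraic closure.     *)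
Section Gluing.

Variables (k K : fieldType) (iota : {rmorphism k -> K}) (pX pY : {poly k}).

Definition JacPic (q : {poly k}) : zmodType :=
  Pic (const_funfield (map_poly iota q)).

Definition tors2 (q : {poly k}) : set (JacPic q) :=
  @Jac2 _ _ (const_funfield (map_poly iota q)).

Definition weil (q : {poly k}) : JacPic q -> JacPic q -> K :=
  @weil2 _ _ (const_funfield (map_poly iota q)).

Definition prod_weil (a b : JacPic pX * JacPic pY) : K :=
  weil a.1 b.1 * weil a.2 b.2.

Definition maximal_isotropic_prod (G : set (JacPic pX * JacPic pY)) : Prop :=
  maximal_isotropic (@tors2 pX `*` @tors2 pY)%classic prod_weil G.

Definition indecomposable (G : set (JacPic pX * JacPic pY)) : Prop :=
  ~ exists GX GY,
    [/\ maximal_isotropic (@tors2 pX) (@weil pX) GX,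
        maximal_isotropic (@tors2 pY) (@weil pY) GY
      & G = (GX `*` GY)%classic].

Definition defined_over_base (G : set (JacPic pX * JacPic pY)) : Prop :=
  forall (s : galois_aut iota) a, G a -> G (gal_Pic s a.1, gal_Pic s a.2).

End Gluing.

Section Resolvent.

Variable k : fieldType.

Definition cubic_resolvent (p : {poly k}) : {poly k} :=
  let m := (lead_coef p)^-1 *: p in
  let a i := m`_i in
  'X^3 - (a 2) *: 'X^2 + (a 1 * a 3 - 4 * a 0) *: 'X
    + (4 * a 0 * a 2 - a 1 ^+ 2 - a 0 * a 3 ^+ 2)%:P.

(* A cubic is a quartic with a root at infinity: it replaces its resolvent.   *)
Definition resolvent (p : {poly k}) : {poly k} :=
  if size p == 4 then p else cubic_resolvent p.

(* In degree 5 there is a root at infinity, and a linear factor also counts   *)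
(* as a quadratic one.                                                        *)
Definition quadratic_factor (q p : {poly k}) : Prop :=
  q %| p /\ (size q = 3%N \/ (size q = 2%N /\ size p = 6%N)).

Definition is_splitting_field (p : {poly k}) (L : fieldExtType k) : Prop :=
  splittingFieldFor 1 (map_poly (in_alg L) p) {:L}.

Definition isomorphic_splitting_fields (p q : {poly k}) : Prop :=
  exists L M : fieldExtType k,
    [/\ is_splitting_field p L, is_splitting_field q M
      & exists f : {lrmorphism L -> M}, bijective f].

End Resolvent.

(* Main.v *)
From HB Require Import structures.
Require Import Defs.
From mathcomp Require Import all_boot all_order all_algebra all_field.
From mathcomp Require Import boolp classical_sets.
From mathcomp.multinomials Require Import freeg.
From mathcomp Require Import ring zify.

Set Implicit Arguments.
Unset Strict Implicit.
Unset Printing Implicit Defensive.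

Import Order.TTheory GRing.Theory Num.Theory.
Local Open Scope ring_scope.


(** For a separable p, write W(p) for the branch points of y^2 = p(x) on the
    projective line: the roots of p, together with infinity when the degree is
    odd. The 2-torsion of the Jacobian J consists of the classes of the even
    subsets of W(p) modulo complements. It is generated by the differences d i j
    = [w_i - w_j] of Weierstrass points, and the Weil pairing of d i j and d k l
    is (-1)^#({i, j} & {k, l}). The Galois group acts through its action on
    W(p). This description ([weierstrass], [curve_torsion]) is derived here from
    the function field: the places are classified ([placeP]), divisor classes of
    order 2 are represented by combinations of Weierstrass points by Hilbert 90
    for the hyperelliptic involution ([Jac2_rep]), and the pairing is well
    defined and bilinear by Weil reciprocity ([weil_reciprocity]), which follows
    from the Steinberg relation for tame symbols.

    The rest is linear algebra over F_2. Let V_X and V_Y, of dimensions 2 and 4,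
    be the two 2-torsion groups. A maximal isotropic subgroup G of their product
    is its own orthogonal. If G is indecomposable, it meets V_X trivially, it
    meets V_Y in a group {0, v}, and it projects onto V_X and onto the
    orthogonal of v ([glue_kerA], [glue_kerB], [glue_projA], [glue_projB]).
    Hence G is the inverse image of the graph of an isometry from V_X to the
    Klein four-group v^perp / v. Conversely, every such isometry gives an
    indecomposable G ([glue_maximal], [glue_indecomposable]). Moreover v is d i
    j for one pair {i, j} of W(p_Y), and the three nonzero elements of v^perp /
    v are the three ways to split the other four points into two pairs. In the
    same way the nonzero elements of V_X are the three splittings of W(p_X).

    A Galois stable pair {i, j} is the same as a quadratic factor q_Y, or a
    linear factor whose partner is infinity ([stable_pair_factor],
    [branch_factor]). The splittings of four points correspond, equivariantly,
    to the roots of the cubic resolvent ([resolvent_rootsP],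
    [splitting_action]). So a Galois stable G exists exactly when the Galois
    sets of roots of the two resolvents are isomorphic for a suitable q_Y. Two
    Galois sets with three elements are isomorphic when the actions have the
    same kernel ([isomorphic_F3_actions]), and by Galois correspondence the
    kernels agree exactly when the splitting fields are isomorphic
    ([isomorphic_splittingP]). *)


(** * Valuations from local rings *)

Section LocalRing.

Variables (K F : fieldType) (c : {rmorphism K -> F}).
(* The relation reg f r plays the role of: f is regular at a given smooth
   point, with value r there; t is a uniformiser. reg_divt says that t
   generates the maximal ideal up to units, and reg_bound that a nonzero
   regular function is not divisible by all the powers of t. *)
Variables (reg : F -> K -> Prop) (t : F).

Hypothesis reg_fun : forall f r s, reg f r -> reg f s -> r = s.
Hypothesis regD : forall f g r s, reg f r -> reg g s -> reg (f + g) (r + s).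
Hypothesis regM : forall f g r s, reg f r -> reg g s -> reg (f * g) (r * s).
Hypothesis regC : forall a, reg (c a) a.
Hypothesis reg_frac : forall f, exists g h r s,
  [/\ g != 0, reg g r, reg h s & f * g = h].
Hypothesis t_neq0 : t != 0.
Hypothesis reg_t : reg t 0.
Hypothesis reg_divt : forall f, reg f 0 -> exists u w r s,
  [/\ reg u r, r != 0, reg w s & f * u = t * w].
Hypothesis reg_bound : forall f r, f != 0 -> reg f r -> exists d : nat,
  forall n u w r s, reg u r -> r != 0 -> reg w s -> f * u = t ^+ n * w ->
  (n <= d)%N.

(** Multiplying f by u avoids dividing by regular functions with nonzero
    value, so that reg need not be closed under inverses. *)
Definition is_ord (f : F) (n : int) := exists u w r s,
  [/\ reg u r, reg w s, r != 0, s != 0 & f * u = t ^ n * w].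

Lemma reg_neq0 f r : reg f r -> r != 0 -> f != 0.
Proof.
move=> fr; apply: contraNneq => f0; apply/eqP/(reg_fun fr).
by rewrite f0 -(rmorph0 c).
Qed.

Lemma regX f r n : reg f r -> reg (f ^+ n) (r ^+ n).
Proof.
move=> fr; elim: n => [|n IHn]; last by rewrite !exprS; apply: regM.
by rewrite !expr0 -(rmorph1 c).
Qed.

Lemma is_ord_unit f r : reg f r -> r != 0 -> is_ord f 0.
Proof.
move=> fr r0; exists 1, f, 1, r; rewrite mulr1 expr0z mul1r.
by split; rewrite ?oner_neq0 // -(rmorph1 c).
Qed.

Lemma is_ordM f g m n : is_ord f m -> is_ord g n -> is_ord (f * g) (m + n).
Proof.
move=> [u [w [r [s [ur ws r0 s0 e]]]]] [u' [w' [r' [s' [ur' ws' r0' s0' e']]]]].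
exists (u * u'), (w * w'), (r * r'), (s * s').
split; rewrite ?mulf_neq0 //; try exact: regM.
by rewrite mulrACA e e' expfzDr // mulrACA.
Qed.

Lemma is_ord_neq0 f n : is_ord f n -> f != 0.
Proof.
move=> [u [w [r [s [ur ws r0 s0 e]]]]]; apply/eqP => f0.
move/esym/eqP: e; rewrite f0 mul0r mulf_eq0 expfz_eq0 (negPf t_neq0) andbF.
by rewrite (negPf (reg_neq0 ws s0)).
Qed.

Lemma is_ordV f n : is_ord f n -> is_ord f^-1 (- n).
Proof.
move=> fn; have f0 := is_ord_neq0 fn.
have [u [w [r [s [ur ws r0 s0 e]]]]] := fn.
exists w, u, s, r; split=> //.
by rewrite -invr_expz; apply: (canRL (mulKf _)); rewrite ?expfz_neq0 //
   mulrCA -e mulKf.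
Qed.

(** A unit cannot be a positive power of t times a regular function, because
    t has value 0. *)
Lemma is_ord_uniq f m n : is_ord f m -> is_ord f n -> m = n.
Proof.
wlog le_mn : m n / m <= n.
  by move=> H fm fn; case: (lerP m n) => [|/ltW] /H -> //.
move=> [u [w [r [s [ur ws r0 s0 e]]]]] [u' [w' [r' [s' [ur' ws' r0' s0' e']]]]].
have {}e : w * u' = t ^ (n - m) * (w' * u).
  have tm : t ^ m != 0 by rewrite expfz_neq0.
  apply: (mulfI tm); rewrite mulrA -e mulrA -expfzDr // addrC subrK mulrA -e'.
  by ring.
case: (n - m) (subr_ge0 m n) e (subrK m n) => [[|k]|k].
- by rewrite add0r.
- move=> _; rewrite -exprnP exprS => e _.
  suff /eqP : s * r' = 0 by rewrite mulf_eq0 (negPf s0) (negPf r0').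
  apply: (reg_fun (regM ws ur')); rewrite e.
  rewrite -(mul0r (0 ^+ k * (s' * r))) -mulrA.
  by do !apply: regM => //; apply: regX.
- by rewrite le_mn.
Qed.

(** Powers of t are split off by reg_divt as long as the cofactor vanishes;
    reg_bound makes this stop. *)
Lemma is_ord_reg f r : f != 0 -> reg f r -> exists n, is_ord f n.
Proof.
move=> f0 fr; have [d dP] := reg_bound f0 fr.
suff H e m : (d <= m + e)%N ->
    (exists u w r s, [/\ reg u r, r != 0, reg w s & f * u = t ^+ m * w]) ->
    exists n, is_ord f n.
  apply: (H d 0%N) => //; exists 1, f, 1, r; rewrite mulr1 mul1r.
  by split; rewrite ?oner_neq0 // -(rmorph1 c).
elim: e m => [|e IHe] m.
  rewrite addn0 => le_dm [u [w [r' [s [ur r0 ws e]]]]].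
  have [s0|s0] := eqVneq s 0; last by exists m, u, w, r', s.
  rewrite s0 in ws; have [u' [w' [r1 [s1 [ur1 r10 ws1 e1]]]]] := reg_divt ws.
  have := dP m.+1 (u * u') w' _ _ (regM ur ur1) _ ws1.
  rewrite mulf_neq0 // mulrA e -mulrA e1 exprSr -mulrA => /(_ isT erefl).
  by rewrite ltnNge le_dm.
rewrite addnS -addSn => le_dm [u [w [r' [s [ur r0 ws E]]]]].
have [s0|s0] := eqVneq s 0; last by exists m, u, w, r', s.
rewrite s0 in ws; have [u' [w' [r1 [s1 [ur1 r10 ws1 e1]]]]] := reg_divt ws.
apply: (IHe m.+1) => //.
exists (u * u'), w', (r' * r1), s1; split; rewrite ?mulf_neq0 //.
  exact: regM.
by rewrite mulrA E -mulrA e1 exprSr -mulrA.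
Qed.

Lemma is_ord_ex f : f != 0 -> exists n, is_ord f n.
Proof.
move=> f0; have [g [h [r [s [g0 gr hs e]]]]] := reg_frac f.
have h0 : h != 0 by rewrite -e mulf_neq0.
have [m gm] := is_ord_reg g0 gr; have [n hn] := is_ord_reg h0 hs.
exists (n - m); rewrite -(mulfK g0 f) e; apply: is_ordM => //.
exact: is_ordV.
Qed.

Lemma is_ord_reg_ge0 f r n : reg f r -> is_ord f n -> 0 <= n.
Proof.
case: n => // n fr [u [w [r' [s [ur ws r0 s0 e]]]]].
have {}e : t ^+ n.+1 * f * u = w.
  by rewrite -mulrA e NegzE -invr_expz -exprnP mulVKf // expf_neq0.
case/eqP: s0; apply: (reg_fun ws); rewrite -e exprS.
rewrite -[0](mul0r (0 ^+ n * r * r')) -!mulrA.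
by do !apply: regM => //; apply: regX.
Qed.

Lemma is_ord_reg_gt0 f n : reg f 0 -> is_ord f n -> 0 < n.
Proof.
move=> f0 fn; rewrite lt_neqAle (is_ord_reg_ge0 f0 fn) andbT eq_sym.
apply/eqP => n0; case: fn => [u [w [r' [s [ur ws r0 s0]]]]].
rewrite n0 expr0z mul1r => e; case/eqP: s0; apply: (reg_fun ws).
by rewrite -e -(mul0r r'); apply: regM.
Qed.

Lemma is_ordD f g m n l :
  is_ord f m -> is_ord g n -> is_ord (f + g) l -> Num.min m n <= l.
Proof.
wlog le_mn : f g m n / m <= n.
  move=> H fm gn fgl; case: (lerP m n) => [le_mn|/ltW le_nm].
    by have := H f g m n le_mn fm gn fgl; rewrite min_l.
  by have := H g f n m le_nm gn fm; rewrite addrC min_l // => /(_ fgl).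
rewrite min_l // => fm gn fgl.
have [u [w [r [s [ur ws r0 s0 e]]]]] := fm.
have [u' [w' [r' [s' [ur' ws' r0' s0' e']]]]] := gn.
have tm : t ^ m != 0 by rewrite expfz_neq0.
pose h := w * u' + t ^ (n - m) * (w' * u).
have fgE : f + g = t ^ m * (h * (u * u')^-1).
  apply: (mulIf (mulf_neq0 (reg_neq0 ur r0) (reg_neq0 ur' r0'))).
  rewrite -!mulrA mulVf ?mulr1 ?mulf_neq0 ?(reg_neq0 ur r0) ?(reg_neq0 ur' r0')//.
  rewrite /h mulrDr [_ * (t ^ _ * _)]mulrA -expfzDr //.
  rewrite [m + _]addrC subrK !mulrA -e -e'; ring.
have [q hq] : exists q, reg h q.
  case: (n - m) (subr_ge0 m n) @h {fgE} => [k|k]; last by rewrite le_mn.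
  move=> _ /=; exists (s * r' + 0 ^+ k * (s' * r)).
  by rewrite -exprnP; apply: regD; do ?apply: regM => //; apply: regX.
have h0 : h != 0.
  by apply: contraTneq (is_ord_neq0 fgl) => h0; rewrite fgE h0 mul0r mulr0 eqxx.
have [k hk] := is_ord_reg h0 hq.
have tmo : is_ord (t ^ m) m.
  by exists 1, 1, 1, 1; rewrite -(rmorph1 c); split; rewrite ?oner_neq0.
have uo := is_ord_unit (regM ur ur') (mulf_neq0 r0 r0').
have := is_ordM tmo (is_ordM hk (is_ordV uo)); rewrite -fgE oppr0 addr0.
move/(is_ord_uniq fgl) ->; rewrite lerDl; exact: is_ord_reg_ge0 hq hk.
Qed.

Definition local_ord (f : F) : int :=
  if f == 0 then 0 else xget 0 [set n | is_ord f n]%classic.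

Lemma local_ordP f : f != 0 -> is_ord f (local_ord f).
Proof.
move=> f0; rewrite /local_ord (negPf f0).
by have [n fn] := is_ord_ex f0; apply: (@xgetPex _ 0 [set n | is_ord f n]%classic); exists n.
Qed.

Lemma local_ordE f n : is_ord f n -> local_ord f = n.
Proof. by move=> fn; apply: is_ord_uniq (fn); apply/local_ordP/(is_ord_neq0 fn). Qed.

Fact local_ord0 : local_ord 0 = 0.
Proof. by rewrite /local_ord eqxx. Qed.

Fact local_ordM f g : f != 0 -> g != 0 ->
  local_ord (f * g) = local_ord f + local_ord g.
Proof. by move=> f0 g0; apply: local_ordE; apply: is_ordM; apply: local_ordP. Qed.

Fact local_ordD f g : f != 0 -> g != 0 -> f + g != 0 ->
  Num.min (local_ord f) (local_ord g) <= local_ord (f + g).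
Proof. by move=> *; apply: (@is_ordD f g); apply: local_ordP. Qed.

Fact local_ord_const a : a != 0 -> local_ord (c a) = 0.
Proof. by move=> a0; apply: local_ordE; apply: is_ord_unit a0. Qed.

Lemma is_ord_t : is_ord t 1.
Proof.
by exists 1, 1, 1, 1; rewrite expr1z -(rmorph1 c); split; rewrite ?oner_neq0.
Qed.

Fact local_ord_onto : exists2 f, f != 0 & local_ord f = 1.
Proof. by exists t => //; apply/local_ordE/is_ord_t. Qed.

Definition local_place : place c :=
  Place local_ord0 local_ordM local_ordD local_ord_const local_ord_onto.

Lemma local_place_t : local_place t = 1.
Proof. exact/local_ordE/is_ord_t. Qed.

Lemma local_place_unit f r : reg f r -> r != 0 -> local_place f = 0.
Proof. by move=> fr r0; apply/local_ordE/(is_ord_unit fr). Qed.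

Lemma local_place_gt0 f : f != 0 -> reg f 0 -> 0 < local_place f.
Proof. by move=> f0 fr; apply: (is_ord_reg_gt0 fr); apply: local_ordP. Qed.

Lemma local_place_residue f : f != 0 -> 0 <= local_place f ->
  exists a, f = c a \/ 0 < local_place (f - c a).
Proof.
move=> f0 fge0; have := local_ordP f0.
move: fge0; rewrite le_eqVlt => /orP[/eqP fv0|fv0 _]; last first.
  by exists 0; right; rewrite rmorph0 subr0.
rewrite -[local_ord f]fv0 => -[u [w [r [s [ur ws r0 s0]]]]].
rewrite expr0z mul1r => e; exists (s / r).
have [->|nfa] := eqVneq f (c (s / r)); [by left|right].
have u0 := reg_neq0 ur r0.
have -> : f - c (s / r) = (w - c (s / r) * u) / u.
  by rewrite -e -mulrBl mulfK.
have n0 : w - c (s / r) * u != 0.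
  by rewrite -e -mulrBl mulf_neq0 // subr_eq0.
rewrite ordM ?invr_neq0 // ordV ?unitfE // (local_place_unit ur r0) subr0.
apply: local_place_gt0 => //.
have -> : 0 = s + (- (s / r)) * r by rewrite mulNr divfK // subrr.
by apply: regD => //; rewrite -mulNr -rmorphN; apply: regM.
Qed.

(** A valuation v that is trivial on the functions with nonzero value is v t
    times the one constructed here, and v t = 1 because v takes the value 1. *)
Lemma local_place_uniq (v : place c) :
  (forall f r, reg f r -> r != 0 -> v f = 0) -> 0 < v t -> v = local_place.
Proof.
move=> v_unit vt.
have vE f n : is_ord f n -> v f = v t * n.
  move=> fn; have f0 := is_ord_neq0 fn.
  have [u [w [r [s [ur ws r0 s0 e]]]]] := fn.
  have vX k : v (t ^+ k) = v t * k%:Z.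
    elim: k => [|k IHk]; first by rewrite expr0 Defs.ord1 mulr0.
    rewrite exprS ordM ?expf_neq0 // IHk; lia.
  have vXz : v (t ^ n) = v t * n.
    case: n {fn e} => k; first exact: vX.
    rewrite NegzE -invr_expz ordV ?unitfE ?expfz_neq0 // -exprnP vX.
    by rewrite mulrN.
  have := congr1 v e; rewrite !ordM ?expfz_neq0 ?(reg_neq0 ur r0) ?(reg_neq0 ws s0) //.
  by rewrite (v_unit _ _ ur) // (v_unit _ _ ws) // !addr0 vXz.
have vt1 : v t = 1.
  have [f f0 fv] := ord_onto v; have := vE f _ (local_ordP f0).
  rewrite fv; move: (v t) vt (local_ord f) => a a0 b ab.
  have b0 : 0 < b by rewrite -(pmulr_rgt0 _ a0) -ab.
  by nia.
have E : ord v = local_ord.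
  apply/funext => f; have [->|f0] := eqVneq f 0; first by rewrite Defs.ord0 local_ord0.
  by rewrite (vE _ _ (local_ordP f0)) vt1 mul1r.
rewrite /local_place; case: v E {v_unit vt vE vt1} => o o0 oM oD oc oo /= E.
subst o; congr Place; exact: Prop_irrelevance.
Qed.

End LocalRing.

(** * Valuation rings and points of an affine chart *)

Section Evaluation.

Variables (K F : fieldType) (c : {rmorphism K -> F}) (z : F).

Definition ev (A : {poly K}) : F := (map_poly c A).[z].

Lemma evD A B : ev (A + B) = ev A + ev B.
Proof. by rewrite /ev rmorphD hornerD. Qed.

Lemma evN A : ev (- A) = - ev A.
Proof. by rewrite /ev rmorphN hornerN. Qed.

Lemma evM A B : ev (A * B) = ev A * ev B.
Proof. by rewrite /ev rmorphM hornerM. Qed.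

Lemma evC a : ev a%:P = c a.
Proof. by rewrite /ev map_polyC hornerC. Qed.

Lemma ev0 : ev 0 = 0.
Proof. by rewrite evC rmorph0. Qed.

Lemma ev1 : ev 1 = 1.
Proof. by rewrite evC rmorph1. Qed.

Lemma evX : ev 'X = z.
Proof. by rewrite /ev map_polyX hornerX. Qed.

Lemma evXn A n : ev (A ^+ n) = ev A ^+ n.
Proof. by rewrite /ev rmorphXn horner_exp. Qed.

Lemma evZ a A : ev (a *: A) = c a * ev A.
Proof. by rewrite -mul_polyC evM evC. Qed.

Lemma ev_prod (I : Type) (r : seq I) (f : I -> {poly K}) :
  ev (\prod_(i <- r) f i) = \prod_(i <- r) ev (f i).
Proof.
elim: r => [|i r IHr]; first by rewrite !big_nil ev1.
by rewrite !big_cons evM IHr.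
Qed.

Definition evE := (evD, evN, evM, ev0, ev1, evC, evX, evXn, evZ).

End Evaluation.

Section ValuationRing.

Variables (K F : fieldType) (c : {rmorphism K -> F}) (v : place c).

Definition val_ring (f : F) : Prop := f = 0 \/ 0 <= v f.
Definition val_ideal (f : F) : Prop := f = 0 \/ 0 < v f.

Lemma ord_inv (f : F) : v f^-1 = - v f.
Proof.
have [->|f0] := eqVneq f 0; first by rewrite invr0 Defs.ord0 oppr0.
by rewrite ordV ?unitfE.
Qed.

Lemma ordX (f : F) n : v (f ^+ n) = v f *+ n.
Proof.
have [->|f0] := eqVneq f 0.
  by case: n => [|n]; rewrite ?expr0 ?Defs.ord1 // exprS mul0r Defs.ord0 mul0rn.
elim: n => [|n IHn]; first by rewrite expr0 Defs.ord1.
by rewrite exprS ordM ?expf_neq0 // IHn mulrS.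
Qed.

Lemma ordXz (f : F) n : v (f ^ n) = v f * n.
Proof.
case: n => n; first by rewrite -exprnP ordX -mulr_natr natz.
by rewrite NegzE -invr_expz ord_inv -exprnP ordX -mulr_natr natz mulrN.
Qed.

Lemma ordN (f : F) : v (- f) = v f.
Proof.
have [->|f0] := eqVneq f 0; first by rewrite oppr0.
rewrite -mulN1r ordM // ?oppr_eq0 ?oner_neq0 // -[-1](rmorphN1 c).
by rewrite ord_const ?add0r // oppr_eq0 oner_neq0.
Qed.

Lemma val_ringP (f : F) : f != 0 -> val_ring f -> 0 <= v f.
Proof. by move=> /eqP f0 []. Qed.

Lemma val_idealP (f : F) : f != 0 -> val_ideal f -> 0 < v f.
Proof. by move=> /eqP f0 []. Qed.

Lemma val_idealW (f : F) : val_ideal f -> val_ring f.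
Proof. by case=> [->|/ltW]; [left|right]. Qed.

Lemma val_ringC a : val_ring (c a).
Proof.
have [->|a0] := eqVneq a 0; first by left; rewrite rmorph0.
by right; rewrite ord_const.
Qed.

Lemma val_ring1 : val_ring 1.
Proof. by rewrite -(rmorph1 c); apply: val_ringC. Qed.

Lemma val_idealC a : val_ideal (c a) -> a = 0.
Proof.
have [//|a0] := eqVneq a 0; case=> [/eqP|]; first by rewrite fmorph_eq0 => /eqP.
by rewrite ord_const.
Qed.

Lemma val_ringM f g : val_ring f -> val_ring g -> val_ring (f * g).
Proof.
have [->|f0] := eqVneq f 0; first by left; rewrite mul0r.
have [->|g0] := eqVneq g 0; first by left; rewrite mulr0.
move=> /(val_ringP f0) fv /(val_ringP g0) gv; right.
by rewrite ordM // addr_ge0.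
Qed.

Lemma val_ringD f g : val_ring f -> val_ring g -> val_ring (f + g).
Proof.
have [->|f0] := eqVneq f 0; first by rewrite add0r.
have [->|g0] := eqVneq g 0; first by rewrite addr0.
have [->|fg0] := eqVneq (f + g) 0; first by left.
move=> /(val_ringP f0) fv /(val_ringP g0) gv; right.
by apply: le_trans (ordD v f0 g0 fg0); rewrite le_min fv.
Qed.

Lemma val_ringN f : val_ring f -> val_ring (- f).
Proof. by case=> [->|fv]; [left; rewrite oppr0 | right; rewrite ordN]. Qed.

Lemma val_idealD f g : val_ideal f -> val_ideal g -> val_ideal (f + g).
Proof.
have [->|f0] := eqVneq f 0; first by rewrite add0r.
have [->|g0] := eqVneq g 0; first by rewrite addr0.
have [->|fg0] := eqVneq (f + g) 0; first by left.
move=> /(val_idealP f0) fv /(val_idealP g0) gv; right.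
by apply: lt_le_trans (ordD v f0 g0 fg0); rewrite lt_min fv.
Qed.

Lemma val_idealN f : val_ideal f -> val_ideal (- f).
Proof. by case=> [->|fv]; [left; rewrite oppr0 | right; rewrite ordN]. Qed.

Lemma val_idealB f g : val_ideal f -> val_ideal g -> val_ideal (f - g).
Proof. by move=> ? ?; apply/val_idealD/val_idealN. Qed.

Lemma val_idealMl f g : val_ring f -> val_ideal g -> val_ideal (f * g).
Proof.
have [->|f0] := eqVneq f 0; first by left; rewrite mul0r.
have [->|g0] := eqVneq g 0; first by left; rewrite mulr0.
move=> /(val_ringP f0) fv /(val_idealP g0) gv; right.
by rewrite ordM // ltr_wpDl.
Qed.

Lemma val_idealMr f g : val_ideal f -> val_ring g -> val_ideal (f * g).
Proof. by move=> *; rewrite mulrC; apply: val_idealMl. Qed.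

Lemma val_ideal_prime f g : val_ring f -> val_ring g -> val_ideal (f * g) ->
  val_ideal f \/ val_ideal g.
Proof.
have [->|f0] := eqVneq f 0; first by left; left.
have [->|g0] := eqVneq g 0; first by right; left.
move=> /(val_ringP f0) fv /(val_ringP g0) gv /(val_idealP (mulf_neq0 f0 g0)).
rewrite ordM // => fg; have [f1|f1] := eqVneq (v f) 0.
  by right; right; rewrite f1 add0r in fg.
by left; right; rewrite lt_neqAle eq_sym f1.
Qed.

Lemma ord_unit f a : a != 0 -> val_ideal (f - c a) -> f != 0 /\ v f = 0.
Proof.
move=> a0 fa; have nM : ~ val_ideal f.
  move=> fM; case/eqP: a0; apply: val_idealC.
  by rewrite -[c a](subKr f); apply: val_idealB.
have f0 : f != 0 by apply/eqP => f0; apply: nM; left.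
split=> //; have fO : val_ring f.
  by rewrite -(subrK (c a) f); apply: val_ringD; [apply: val_idealW|apply: val_ringC].
apply: le_anti; rewrite (val_ringP f0 fO) andbT leNgt.
by apply/negP => fv; apply: nM; right.
Qed.

Lemma val_horner (A : {poly K}) f a : val_ideal (f - c a) ->
  val_ideal (ev c f A - c A.[a]).
Proof.
move=> fa; have fO : val_ring f.
  by rewrite -(subrK (c a) f); apply: val_ringD; [apply: val_idealW|apply: val_ringC].
elim/poly_ind: A => [|A b IHA].
  by rewrite ev0 horner0 rmorph0 subr0; left.
rewrite !evE !hornerE rmorphD rmorphM /=.
set x := ev _ _ _; rewrite opprD addrACA subrr addr0.
have -> : x * f - c A.[a] * c a = (x - c A.[a]) * f + c A.[a] * (f - c a).
  by ring.
by apply: val_idealD; [apply: val_idealMr | apply: val_idealMl => //; apply: val_ringC].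
Qed.

Lemma val_ring_horner (A : {poly K}) f : val_ring f ->
  val_ring (ev c f A).
Proof.
move=> fO; elim/poly_ind: A => [|A b IHA].
  by rewrite ev0; left.
rewrite !evE.
by apply: val_ringD; [apply: val_ringM | apply: val_ringC].
Qed.

End ValuationRing.

(* A smooth point (a, b) of the affine curve eta^2 = P(xi). Both the points
   at finite distance and the one at infinity of a hyperelliptic curve are of
   this form in a suitable chart. At a ramified point (b = 0) the uniformiser
   is eta; elsewhere it is xi - a. *)
Section Chart.

Variables (K F : fieldType) (c : {rmorphism K -> F}).
Variables (xi eta : F) (P : {poly K}) (a b : K).
Local Notation "A .<x>" := (ev c xi A) (at level 2, format "A .<x>").

Hypothesis two_neq0 : 2%:R != 0 :> K.
Hypothesis eta2 : eta ^+ 2 = P.<x>.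
Hypothesis xi_inj : forall A B, A.<x> + B.<x> * eta = 0 -> A = 0 /\ B = 0.
Hypothesis xi_span : forall f, exists A B D,
  D.<x> != 0 /\ f * D.<x> = A.<x> + B.<x> * eta.
Hypothesis bE : b ^+ 2 = P.[a].
Hypothesis smooth : b = 0 -> exists2 Q, P = Q * ('X - a%:P) & Q.[a] != 0.

(** The elements A + B eta of the coordinate ring, with their values; the
    denominators are left to the construction of the valuation. *)
Definition chart_reg f r :=
  exists A B, f = A.<x> + B.<x> * eta /\ r = A.[a] + B.[a] * b.

Definition chart_unif := if b == 0 then eta else xi - c a.

Let hE := (evE, hornerD, hornerN, hornerM, hornerX, hornerC, horner_exp).

Lemma chart_regP A B : chart_reg (A.<x> + B.<x> * eta) (A.[a] + B.[a] * b).
Proof. by exists A, B. Qed.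

Lemma chart_reg_fun f r s : chart_reg f r -> chart_reg f s -> r = s.
Proof.
move=> [A [B [-> ->]]] [A' [B' [e ->]]].
have [] := @xi_inj (A - A') (B - B').
  by rewrite !hE mulrBl addrACA -opprD e subrr.
by move/subr0_eq => -> /subr0_eq ->.
Qed.

Lemma chart_regD f g r s :
  chart_reg f r -> chart_reg g s -> chart_reg (f + g) (r + s).
Proof.
move=> [A [B [-> ->]]] [A' [B' [-> ->]]]; exists (A + A'), (B + B').
by rewrite !hE; split; ring.
Qed.

Lemma chart_regM f g r s :
  chart_reg f r -> chart_reg g s -> chart_reg (f * g) (r * s).
Proof.
move=> [A [B [-> ->]]] [A' [B' [-> ->]]].
exists (A * A' + B * B' * P), (A * B' + B * A').
by rewrite !hE -eta2 -bE; split; ring.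
Qed.

Lemma chart_reg_poly A : chart_reg A.<x> A.[a].
Proof. by exists A, 0; rewrite !hE !mul0r !addr0. Qed.

Lemma chart_regC r : chart_reg (c r) r.
Proof. by have := chart_reg_poly r%:P; rewrite !hE. Qed.

Lemma chart_reg_xi : chart_reg xi a.
Proof. by have := chart_reg_poly 'X; rewrite !hE. Qed.

Lemma chart_reg_eta : chart_reg eta b.
Proof. by exists 0, 1; rewrite !hE !mul1r !add0r. Qed.

Lemma chart_reg_frac f : exists g h r s,
  [/\ g != 0, chart_reg g r, chart_reg h s & f * g = h].
Proof.
have [A [B [D [D0 fD]]]] := xi_span f.
exists D.<x>, (A.<x> + B.<x> * eta), D.[a], (A.[a] + B.[a] * b).
by split=> //; [apply: chart_reg_poly | apply: chart_regP].
Qed.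

Lemma xi_neqC : xi - c a != 0.
Proof.
apply/eqP => e; have [] := @xi_inj ('X - a%:P) 0.
  by rewrite !hE e mul0r addr0.
by move/eqP; rewrite polyXsubC_eq0.
Qed.

Lemma eta_neqC : eta - c b != 0.
Proof.
apply/eqP => e; have [] := @xi_inj (- b%:P) 1.
  by rewrite !hE mul1r addrC e.
by move=> _ /eqP; rewrite oner_eq0.
Qed.

Lemma chart_unif_neq0 : chart_unif != 0.
Proof.
rewrite /chart_unif; case: (b =P 0) => [b0|_]; last exact: xi_neqC.
by have := eta_neqC; rewrite b0 rmorph0 subr0.
Qed.

Lemma chart_reg_unif : chart_reg chart_unif 0.
Proof.
rewrite /chart_unif; case: eqP => [b0|_]; first by rewrite -b0; apply: chart_reg_eta.
by rewrite -(subrr a) -rmorphN; apply: chart_regD (chart_regC _); apply: chart_reg_xi.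
Qed.

Lemma factor_at (A : {poly K}) : A.[a] = 0 -> exists B, A = B * ('X - a%:P).
Proof. by move/rootP/factor_theorem. Qed.

(** If b = 0, then A = A1 (xi - a), and (xi - a) Q = eta^2 with Q(a) nonzero.
    Otherwise eta + b is a unit at the point and (eta - b) (eta + b) = P -
    b^2 is a multiple of xi - a. *)
Lemma chart_reg_divt f : chart_reg f 0 -> exists u w r s,
  [/\ chart_reg u r, r != 0, chart_reg w s & f * u = chart_unif * w].
Proof.
move=> [A [B [-> /esym AB0]]]; rewrite /chart_unif; case: eqP => [b0|/eqP b0].
  have [Q PQ Qa] := smooth b0.
  have [A' ->] : exists A', A = A' * ('X - a%:P).
    by apply: factor_at; rewrite b0 mulr0 addr0 in AB0.
  have := eta2; rewrite PQ !hE => e2.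
  exists Q.<x>, (A'.<x> * eta + B.<x> * Q.<x>), Q.[a],
    (A'.[a] * b + B.[a] * Q.[a]).
  split=> //; first exact: chart_reg_poly.
    apply: chart_regD; apply: chart_regM;
    by [apply: chart_reg_poly | apply: chart_reg_eta].
  transitivity (A'.<x> * (Q.<x> * (xi - c a)) + B.<x> * eta * Q.<x>); first ring.
  by rewrite -e2; ring.
have [A' A'E] : exists A', A + b *: B = A' * ('X - a%:P).
  by apply: factor_at; rewrite hornerD hornerZ mulrC.
have [Q QE] : exists Q, P - (b ^+ 2)%:P = Q * ('X - a%:P).
  by apply: factor_at; rewrite hornerD hornerN hornerC bE subrr.
have A1 : A.<x> = A'.<x> * (xi - c a) - c b * B.<x>.
  rewrite -[A](addrK (b *: B)) A'E -mul_polyC !hE; ring.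
have P1 : eta ^+ 2 = Q.<x> * (xi - c a) + c b ^+ 2.
  by rewrite eta2 -[P](subrK (b ^+ 2)%:P) QE !hE rmorphXn.
exists (eta + c b), (A'.<x> * (eta + c b) + B.<x> * Q.<x>), (b + b),
  (A'.[a] * (b + b) + B.[a] * Q.[a]).
have rb : chart_reg (eta + c b) (b + b).
  by apply: chart_regD (chart_regC _); apply: chart_reg_eta.
split=> //; first by rewrite -mulr2n -mulr_natr mulf_neq0.
  by do !(apply: chart_regD || apply: chart_regM) => //; apply: chart_reg_poly.
transitivity ((A.<x> + c b * B.<x>) * (eta + c b)
              + B.<x> * (eta ^+ 2 - c b ^+ 2)); first by ring.
rewrite P1 A1; ring.
Qed.

(** The norm f f1 = A^2 - B^2 P is a nonzero polynomial, and its multiplicity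
    at a bounds the powers of xi - a, hence those of the uniformiser. *)
Lemma chart_reg_bound f r : f != 0 -> chart_reg f r -> exists d : nat,
  forall n u w r s, chart_reg u r -> r != 0 -> chart_reg w s ->
  f * u = chart_unif ^+ n * w -> (n <= d)%N.
Proof.
move=> f0 [A [B [fE _]]].
pose f' := A.<x> - B.<x> * eta.
have f'r : chart_reg f' (A.[a] - B.[a] * b).
  by exists A, (- B); rewrite !hE !mulNr.
have f'0 : f' != 0.
  apply/eqP => e; case/eqP: f0; have [] := @xi_inj A (- B).
    by rewrite -{}e /f' !hE mulNr.
  move=> A0 /eqP; rewrite fE A0 oppr_eq0 => /eqP ->.
  by rewrite !hE mul0r addr0.
pose N := A ^+ 2 - B ^+ 2 * P.
have NE : f * f' = N.<x> by rewrite /N !hE -eta2 fE /f'; ring.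
have N0 : N != 0.
  apply: contraTneq (mulf_neq0 f0 f'0) => e.
  by rewrite NE e !hE eqxx.
have [d [M Ma NM]] := multiplicity_XsubC N a; rewrite N0 /= in Ma.
have [e [G [H [g [h [Gg g0 Hh eq1]]]]]] : exists e G H g h,
    [/\ chart_reg G g, g != 0, chart_reg H h
      & (xi - c a) ^+ d * H = chart_unif ^+ e * G].
  rewrite /chart_unif; case: eqP => [b0|_]; last first.
    by exists d, 1, 1, 1, 1; rewrite oner_neq0 -(rmorph1 c); split=> //; apply: chart_regC.
  have [Q PQ Qa] := smooth b0.
  exists (2 * d)%N, 1, (Q.<x> ^+ d), 1, (Q.[a] ^+ d).
  split; rewrite ?oner_neq0 ?mulr1 //.
  - by rewrite -(rmorph1 c); apply: chart_regC.
  - by have := chart_reg_poly (Q ^+ d); rewrite !hE.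
  - by rewrite -exprMn mulrC exprM eta2 PQ !hE.
exists e => n u w r1 s ur r0 ws eq2; rewrite leqNgt; apply/negP => lt_en.
have : M.<x> * G * u = chart_unif ^+ (n - e) * (w * f' * H).
  have te : chart_unif ^+ e != 0 by rewrite expf_neq0 // chart_unif_neq0.
  apply: (mulfI te); rewrite [RHS]mulrA -exprD subnKC ?(ltnW lt_en) //.
  transitivity ((f * u) * f' * H); last by rewrite eq2; ring.
  have -> : f * u * f' * H = N.<x> * H * u by rewrite -NE; ring.
  rewrite NM !hE.
  transitivity (M.<x> * (chart_unif ^+ e * G) * u); first ring.
  rewrite -eq1; ring.
rewrite -(subnSK lt_en) exprS => eq3.
have /eqP : M.[a] * g * r1 = 0.
  apply: (@chart_reg_fun (M.<x> * G * u)).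
    by do !apply: chart_regM => //; apply: chart_reg_poly.
  rewrite eq3 -mulrA -[0](mul0r (0 ^+ (n - e.+1) * (s * (A.[a] - B.[a] * b) * h))).
  apply: chart_regM chart_reg_unif _.
  do !apply: chart_regM => //; apply: regX chart_reg_unif.
    exact: chart_regM.
  exact: chart_regC.
by rewrite !mulf_eq0 (negPf r0) (negPf g0) orbF orbF; apply: negP.
Qed.

Lemma chart_val (v : place c) f r :
  val_ideal v (xi - c a) -> val_ideal v (eta - c b) -> chart_reg f r ->
  val_ideal v (f - c r).
Proof.
move=> va vb [A [B [-> ->]]]; rewrite rmorphD rmorphM /=.
have -> : A.<x> + B.<x> * eta - (c A.[a] + c B.[a] * c b) =
   (A.<x> - c A.[a]) + ((B.<x> - c B.[a]) * eta + c B.[a] * (eta - c b)).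
  by ring.
have etaO : val_ring v eta.
  by rewrite -(subrK (c b) eta); apply: val_ringD; [apply: val_idealW|apply: val_ringC].
apply: val_idealD; first exact: val_horner.
apply: val_idealD; first by apply: val_idealMr => //; apply: val_horner.
by apply: val_idealMl => //; apply: val_ringC.
Qed.

Lemma chart_placeP : exists v : place c,
  [/\ val_ideal v (xi - c a), val_ideal v (eta - c b), v chart_unif = 1,
      forall f, f != 0 -> 0 <= v f -> exists r, val_ideal v (f - c r)
    & forall v' : place c, val_ideal v' (xi - c a) -> val_ideal v' (eta - c b) ->
      v' = v].
Proof.
pose v := local_place chart_reg_fun chart_regD chart_regM chart_regC
  chart_reg_frac chart_unif_neq0 chart_reg_unif chart_reg_divt chart_reg_bound.
have regB r f : chart_reg f r -> chart_reg (f - c r) 0.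
  move=> fr; rewrite -(subrr r) -rmorphN.
  by apply: chart_regD fr (chart_regC _).
exists v; split.
- right; apply: local_place_gt0; [exact: xi_neqC|exact/regB/chart_reg_xi].
- right; apply: local_place_gt0; [exact: eta_neqC|exact/regB/chart_reg_eta].
- exact: local_place_t.
- move=> f f0 /(local_place_residue f0)[r [->|fr]]; exists r; [left|by right].
  by rewrite subrr.
move=> v' va vb; apply: local_place_uniq => [f r fr r0|].
  by have [] := ord_unit r0 (chart_val va vb fr).
apply: val_idealP chart_unif_neq0 _.
by have := chart_val va vb chart_reg_unif; rewrite rmorph0 subr0.
Qed.

End Chart.

(** * Places of a hyperelliptic function field *)

Section Involution.

Variables (K : closedFieldType) (F : fieldType) (c : {rmorphism K -> F}).

Lemma ev_eq0 z A : (forall a, z != c a) -> ev c z A = 0 -> A = 0.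
Proof.
move=> nz; have [rs ->] := closed_field_poly_normal A.
rewrite evZ ev_prod => /eqP; rewrite mulf_eq0 fmorph_eq0 => /orP[/eqP->|].
  by rewrite scale0r.
rewrite prodf_seq_eq0 => /hasP[a _ /=]; rewrite !evE subr_eq0.
by rewrite (negPf (nz a)).
Qed.

(** The elements of K(z). *)
Definition ratl (z f : F) :=
  exists A D, ev c z D != 0 /\ f = ev c z A / ev c z D.

Lemma ratlC z a : ratl z (c a).
Proof. by exists a%:P, 1; rewrite !evE oner_neq0 divr1. Qed.

Lemma ratl_ev z A : ratl z (ev c z A).
Proof. by exists A, 1; rewrite !evE oner_neq0 divr1. Qed.

Lemma ratl_id z : ratl z z.
Proof. by rewrite -[X in ratl _ X](evX c); apply: ratl_ev. Qed.

Lemma ratlD z f g : ratl z f -> ratl z g -> ratl z (f + g).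
Proof.
move=> [A [D [D0 ->]]] [A' [D' [D'0 ->]]].
exists (A * D' + A' * D), (D * D'); rewrite !evE mulf_neq0 //; split=> //.
by rewrite addf_div.
Qed.

Lemma ratlM z f g : ratl z f -> ratl z g -> ratl z (f * g).
Proof.
move=> [A [D [D0 ->]]] [A' [D' [D'0 ->]]].
by exists (A * A'), (D * D'); rewrite !evE mulf_neq0 //; split=> //; rewrite mulf_div.
Qed.

Lemma ratlV z f : ratl z f -> ratl z f^-1.
Proof.
move=> [A [D [D0 ->]]]; have [A0|A0] := eqVneq (ev c z A) 0.
  by rewrite A0 mul0r invr0 -(rmorph0 c); apply: ratlC.
by exists D, A; rewrite A0 invf_div.
Qed.

Lemma ratl_trans z w f : ratl w z -> ratl z f -> ratl w f.
Proof.
move=> zw; have evr A : ratl w (ev c z A).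
  elim/poly_ind: A => [|A a IHA]; first by rewrite ev0 -(rmorph0 c); apply: ratlC.
  by rewrite !evE; apply: ratlD (ratlC _ _); apply: ratlM.
by move=> [A [D [_ ->]]]; apply: ratlM => //; apply: ratlV.
Qed.

Variables (s : {rmorphism F -> F}) (xi eta : F).
Hypothesis two_neq0 : 2%:R != 0 :> K.
Hypothesis sK : involutive s.
Hypothesis sc : forall a, s (c a) = c a.
Hypothesis sxi : s xi = xi.
Hypothesis seta : s eta = - eta.
Hypothesis eta_neq0 : eta != 0.
Hypothesis xiC : forall a, xi != c a.
Hypothesis s_fix : forall f, s f = f -> ratl xi f.

Lemma fix_ev A : s (ev c xi A) = ev c xi A.
Proof.
elim/poly_ind: A => [|A a IHA]; first by rewrite ev0 rmorph0.
by rewrite !evE rmorphD rmorphM /= sxi sc IHA.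
Qed.

Lemma two_neq0F : 2%:R != 0 :> F.
Proof. by rewrite -(rmorph_nat c) fmorph_eq0. Qed.

Lemma invol_inj A B : ev c xi A + ev c xi B * eta = 0 -> A = 0 /\ B = 0.
Proof.
move=> e; have := congr1 s e; rewrite rmorph0 rmorphD rmorphM /= !fix_ev seta.
move=> e'; have /eqP : 2%:R * ev c xi A = 0.
  by rewrite -[RHS](addr0 0) -{1}e -e'; ring.
rewrite mulf_eq0 (negPf two_neq0F) => /eqP A0.
move/eqP: e; rewrite A0 add0r mulf_eq0 (negPf eta_neq0) orbF => /eqP B0.
by split; apply: ev_eq0 xiC _.
Qed.

(** f is the sum of its invariant half and its anti-invariant half, and the
    latter divided by eta is invariant. *)
Lemma invol_span f : exists A B D,
  ev c xi D != 0 /\ f * ev c xi D = ev c xi A + ev c xi B * eta.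
Proof.
have [A [D [D0 AD]]] : ratl xi ((f + s f) / 2%:R).
  by apply: s_fix; rewrite fmorph_div rmorph_nat rmorphD /= sK addrC.
have [B [E [E0 BE]]] : ratl xi ((f - s f) / (2%:R * eta)).
  apply: s_fix; rewrite fmorph_div rmorphM rmorph_nat rmorphB /= sK seta.
  by rewrite mulrN invrN mulrN -mulNr opprB.
exists (A * E), (B * D), (D * E); rewrite !evE mulf_neq0 //; split=> //.
have -> : f = (f + s f) / 2%:R + (f - s f) / (2%:R * eta) * eta.
  by field; rewrite eta_neq0 two_neq0F.
by rewrite AD BE; field; rewrite D0 E0.
Qed.

End Involution.

(** A presentation of F as the function field of y^2 = f(x) with f monic and
    separable of odd degree, so that there is a single point at infinity.
    That F is quadratic over K(x) is expressed by the involution: hfix says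
    that its fixed field is K(x). *)
Record hyperelliptic (K : closedFieldType) (F : fieldType)
    (c : {rmorphism K -> F}) := Hyperelliptic {
  hx : F;
  hy : F;
  hsig : {rmorphism F -> F};
  hroots : seq K;
  h_two : 2%:R != 0 :> K;
  hsigK : involutive hsig;
  hsigC : forall a, hsig (c a) = c a;
  hsigx : hsig hx = hx;
  hsigy : hsig hy = - hy;
  hx_neqC : forall a, hx != c a;
  hfix : forall f, hsig f = f -> ratl c hx f;
  hy2 : hy ^+ 2 = ev c hx (\prod_(r <- hroots) ('X - r%:P));
  hroots_uniq : uniq hroots;
  hroots_odd : odd (size hroots)
}.

Section Points.

Variables (K : closedFieldType) (F : fieldType) (c : {rmorphism K -> F}).
Variable C : hyperelliptic c.

Local Notation x := (hx C).
Local Notation y := (hy C).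
Local Notation s := (hsig C).
Local Notation rs := (hroots C).
Local Notation "A .<x>" := (ev c x A) (at level 2, format "A .<x>").

Definition hpoly : {poly K} := \prod_(r <- rs) ('X - r%:P).
Local Notation p := hpoly.

Lemma hpoly_neq0 : p != 0.
Proof. by apply: monic_neq0; apply: monic_prod_XsubC. Qed.

Lemma hy2E : y ^+ 2 = p.<x>. Proof. exact: hy2. Qed.

Lemma ev_neq0 A : A != 0 -> A.<x> != 0.
Proof. by apply: contra_neq; apply: ev_eq0; apply: hx_neqC. Qed.

Lemma hy_neq0 : y != 0.
Proof.
by apply: contra_neq (ev_neq0 hpoly_neq0) => y0; rewrite -hy2E y0 expr0n.
Qed.

Lemma hx_subC_neq0 a : x - c a != 0.
Proof. by rewrite subr_eq0 hx_neqC. Qed.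

Lemma hx_neq0 : x != 0.
Proof. by rewrite -(rmorph0 c) hx_neqC. Qed.

Lemma hinj A B : A.<x> + B.<x> * y = 0 -> A = 0 /\ B = 0.
Proof.
exact: (invol_inj (h_two C) (hsigC C) (hsigx C) (hsigy C) hy_neq0 (hx_neqC C)).
Qed.

Lemma hspan f : exists A B D, D.<x> != 0 /\ f * D.<x> = A.<x> + B.<x> * y.
Proof.
exact: (invol_span (h_two C) (hsigK C) (hsigy C) hy_neq0 (@hfix _ _ _ C)).
Qed.

Lemma hsig_ev A : s A.<x> = A.<x>.
Proof. exact: fix_ev (hsigC C) (hsigx C) A. Qed.

Lemma hpoly_root a : (p.[a] == 0) = (a \in rs).
Proof. by rewrite -[_ == 0]/(root p a) root_prod_XsubC. Qed.

Lemma hpoly_smooth a : a \in rs ->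
  exists2 Q, p = Q * ('X - a%:P) & Q.[a] != 0.
Proof.
move=> ars; exists (\prod_(r <- rem a rs) ('X - r%:P)).
  by rewrite /p (perm_big _ (perm_to_rem ars)) big_cons mulrC.
rewrite -[_ == 0]/(root _ a) root_prod_XsubC mem_rem_uniq ?hroots_uniq //.
by rewrite inE eqxx.
Qed.

Definition at_point (v : place c) (a b : K) :=
  val_ideal v (x - c a) /\ val_ideal v (y - c b).

Lemma at_pointP a b : b ^+ 2 = p.[a] -> exists v : place c,
  [/\ at_point v a b, v (if b == 0 then y else x - c a) = 1,
      forall f, f != 0 -> 0 <= v f -> exists r, val_ideal v (f - c r)
    & forall v', at_point v' a b -> v' = v].
Proof.
move=> e; have sm : b = 0 -> exists2 Q, p = Q * ('X - a%:P) & Q.[a] != 0.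
  by move=> b0; apply: hpoly_smooth; rewrite -hpoly_root -e b0 expr0n.
have [v [va vb vt vr vu]] := chart_placeP (h_two C) hy2E hinj hspan e sm.
by exists v; split=> // v' [? ?]; apply: vu.
Qed.

Lemma at_point_eq (v : place c) a b : at_point v a b -> b ^+ 2 = p.[a].
Proof.
move=> [va vb]; apply/eqP; rewrite -subr_eq0; apply/eqP.
apply: (@val_idealC _ _ _ v).
have h1 := val_horner p va; have h2 := val_horner ('X ^+ 2) vb.
rewrite evXn evX hy2E horner_exp hornerX in h2.
suff -> : c (b ^+ 2 - p.[a]) = p.<x> - c p.[a] - (p.<x> - c (b ^+ 2)).
  exact: val_idealB.
by rewrite rmorphB; ring.
Qed.

Definition hgenus := (size rs)./2.
Local Notation g := hgenus.

Lemma size_roots : size rs = (g * 2).+1.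
Proof. by rewrite muln2 -add1n -[LHS]odd_double_half (hroots_odd C). Qed.

(** In the coordinates 1/x and y/x^(g+1) the curve has the equation yinf^2 =
    xinf qinf(xinf), and the point at infinity becomes the smooth ramified
    point (0, 0). *)
Definition xinf := x^-1.
Definition yinf := y / x ^+ g.+1.
Definition qinf : {poly K} := \prod_(r <- rs) (1 - r *: 'X).

Lemma qinf0 : qinf.[0] = 1.
Proof.
rewrite /qinf horner_prod big1 // => r _.
by rewrite hornerD hornerN hornerZ hornerX hornerC mulr0 subr0.
Qed.

Lemma hpoly_inf : p.<x> = x ^+ size rs * ev c xinf qinf.
Proof.
rewrite /p /qinf !ev_prod; elim: rs => [|r l IHl]; first by rewrite !big_nil mulr1.
rewrite !big_cons IHl !evE /= exprS /xinf.
have := hx_neq0; set w := \prod_(_ <- _) _ => x0; field => //.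
Qed.

Lemma yinf2 : yinf ^+ 2 = ev c xinf ('X * qinf).
Proof.
rewrite evM evX /yinf expr_div_n hy2E hpoly_inf size_roots -exprM mulSn add2n.
rewrite !exprS /xinf; have := hx_neq0 => x0.
by field; rewrite x0 expf_neq0.
Qed.

Lemma xinf_neqC a : xinf != c a.
Proof.
apply: contraTneq (hx_neqC C a^-1) => e.
by rewrite fmorphV -e invrK eqxx.
Qed.

Lemma yinf_neq0 : yinf != 0.
Proof. by rewrite mulf_neq0 ?hy_neq0 // invr_neq0 // expf_neq0 // hx_neq0. Qed.

Lemma hsig_xinf : s xinf = xinf. Proof. by rewrite fmorphV hsigx. Qed.

Lemma hsig_yinf : s yinf = - yinf.
Proof. by rewrite fmorph_div rmorphXn hsigx hsigy mulNr. Qed.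

Definition at_inf (v : place c) := val_ideal v xinf.

Lemma at_infP : exists v : place c,
  [/\ at_inf v, v yinf = 1,
      forall f, f != 0 -> 0 <= v f -> exists r, val_ideal v (f - c r)
    & forall v', at_inf v' -> v' = v].
Proof.
have inj := invol_inj (h_two C) (hsigC C) hsig_xinf hsig_yinf yinf_neq0 xinf_neqC.
have fixi f : s f = f -> ratl c xinf f.
  move=> sf; apply: ratl_trans (hfix sf).
  by rewrite -[X in ratl _ _ X]invrK; apply/ratlV/ratl_id.
have span := invol_span (h_two C) (hsigK C) hsig_yinf yinf_neq0 fixi.
have e : 0 ^+ 2 = ('X * qinf).[0] :> K by rewrite hornerM hornerX mul0r expr0n.
have sm : 0 = 0 :> K ->
    exists2 Q, 'X * qinf = Q * ('X - 0%:P) & Q.[0] != 0.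
  by move=> _; exists qinf; rewrite ?qinf0 ?oner_neq0 // subr0 mulrC.
have [v [va _ vt vr vu]] := chart_placeP (h_two C) yinf2 inj span e sm.
exists v; split=> //; first by rewrite rmorph0 subr0 in va.
  by rewrite /chart_unif eqxx in vt.
move=> v' v'x; apply: vu; rewrite rmorph0 subr0 //.
have xO : val_ring v' xinf by apply: val_idealW.
have y2 : val_ideal v' (yinf * yinf).
  rewrite -expr2 yinf2 evM evX; apply: val_idealMr => //.
  exact: val_ring_horner.
right; have := val_idealP (mulf_neq0 yinf_neq0 yinf_neq0) y2.
by rewrite ordM ?yinf_neq0 //; lia.
Qed.

Definition vinf : place c := projT1 (cid at_infP).

Lemma vinf_at : at_inf vinf.
Proof. by rewrite /vinf; case: cid => v [] /=. Qed.

Lemma vinf_yinf : vinf yinf = 1.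
Proof. by rewrite /vinf; case: cid => v [] /=. Qed.

Lemma vinf_uniq v : at_inf v -> v = vinf.
Proof. by rewrite /vinf; case: cid => w [] /= ? ? ?; apply. Qed.

Definition pt (a b : K) : place c := xget vinf [set v | at_point v a b]%classic.

Lemma pt_at a b : b ^+ 2 = p.[a] -> at_point (pt a b) a b.
Proof.
move=> /at_pointP[v [va _ _ _]].
by apply: (@xgetPex _ _ [set v | at_point v a b]%classic); exists v.
Qed.

Lemma pt_uniq v a b : at_point v a b -> v = pt a b.
Proof.
move=> va; have e := at_point_eq va; have [w [_ _ _ wu]] := at_pointP e.
by rewrite (wu v va) (wu _ (pt_at e)).
Qed.

Lemma pt_x a b : b ^+ 2 = p.[a] -> b != 0 -> pt a b (x - c a) = 1.
Proof.
move=> e b0; have [w [_ + _ wu]] := at_pointP e.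
by rewrite (negPf b0) (wu _ (pt_at e)).
Qed.

Lemma pt_y a : a \in rs -> pt a 0 y = 1.
Proof.
rewrite -hpoly_root => /eqP pa; have e : 0 ^+ 2 = p.[a] by rewrite expr0n pa.
by have [w [_ + _ wu]] := at_pointP e; rewrite eqxx (wu _ (pt_at e)).
Qed.

(** If 1/x is in the maximal ideal, the place is the one at infinity.
    Otherwise x and y are in the valuation ring, and their residues are the
    coordinates of a point. *)
Lemma placeP (v : place c) :
  v = vinf \/ exists a b, b ^+ 2 = p.[a] /\ v = pt a b.
Proof.
have [xv|xv] := ltrP (v x) 0.
  by left; apply: vinf_uniq; right; rewrite ord_inv oppr_gt0.
right; have xO : val_ring v x by right.
have [a va] : exists a, val_ideal v (x - c a).
  apply: contrapT => H; have vev A : A != 0 -> v A.<x> = 0.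
    have [l ->] := closed_field_poly_normal A; rewrite scaler_eq0 negb_or.
    case/andP=> A0 _; rewrite evZ ordM ?fmorph_eq0 //; last first.
      by apply: ev_neq0; rewrite monic_neq0 // monic_prod_XsubC.
    rewrite ord_const // add0r ev_prod.
    elim: l => [|r l IHl]; first by rewrite big_nil Defs.ord1.
    have np : \prod_(j <- l) ('X - j%:P).<x> != 0.
      rewrite prodf_seq_neq0; apply/allP => j _ /=.
      by rewrite !evE hx_subC_neq0.
    rewrite big_cons ordM ?IHl ?addr0 ?evE ?hx_subC_neq0 //; apply: le_anti.
    apply/andP; split; rewrite ?leNgt; first by apply/negP => ?; apply: H; exists r; right.
    rewrite -leNgt; apply: val_ringP (hx_subC_neq0 r) _.
    by apply: val_ringD => //; apply/val_ringN/val_ringC.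
  have [f f0 fv] := ord_onto v; have [A [B [D [D0 fD]]]] := hspan f.
  pose N := A ^+ 2 - B ^+ 2 * p.
  have AB0 : A.<x> + B.<x> * y != 0 by rewrite -fD mulf_neq0.
  have AB0' : A.<x> - B.<x> * y != 0.
    apply/eqP => e; case/eqP: AB0; have [] := @hinj A (- B).
      by rewrite -e !evE mulNr.
    by move=> -> /eqP; rewrite oppr_eq0 => /eqP ->; rewrite !evE mul0r addr0.
  have NE : N.<x> = (f * D.<x>) * (A.<x> - B.<x> * y).
    by rewrite fD /N !evE -hy2E; ring.
  have N0 : N != 0.
    apply: contraTneq (mulf_neq0 AB0 AB0') => e.
    by rewrite -fD -NE e ev0 eqxx.
  have yO : val_ring v y.
    right; rewrite leNgt; apply/negP => y0.
    have := vev _ hpoly_neq0; rewrite -hy2E ordX; lia.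
  have := vev _ N0; have Dv : v D.<x> = 0.
    by apply: vev; apply: contraNneq D0 => ->; rewrite ev0.
  rewrite NE !ordM ?mulf_neq0 // fv Dv.
  have : val_ring v (A.<x> - B.<x> * y).
    apply: val_ringD; first exact: val_ring_horner.
    by apply/val_ringN/val_ringM => //; apply: val_ring_horner.
  by move/(val_ringP AB0'); lia.
have [b bE] : exists b, b ^+ 2 = p.[a].
  have [b] := @solve_monicpoly K 2 (fun i => if i is 0%N then p.[a] else 0) isT.
  by rewrite !big_ord_recl big_ord0 /= mul0r !addr0 expr0 mulr1; exists b.
have yO : val_ring v y.
  right; rewrite leNgt; apply/negP => y0.
  have := val_ring_horner p xO.
  move/(val_ringP (ev_neq0 hpoly_neq0)); 
  by rewrite -hy2E ordX; lia.
have : val_ideal v ((y - c b) * (y + c b)).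
  have := val_horner p va; rewrite -hy2E -bE rmorphXn -subr_sqr.
  by [].
case/val_ideal_prime.
- by apply: val_ringD => //; apply/val_ringN/val_ringC.
- by apply: val_ringD => //; apply/val_ringC.
- by move=> vb; exists a, b; split=> //; apply: pt_uniq.
- move=> vb; exists a, (- b); rewrite sqrrN; split=> //; apply: pt_uniq.
  by split=> //; rewrite rmorphN opprK.
Qed.

Lemma residue (v : place c) f : f != 0 -> 0 <= v f ->
  exists r, val_ideal v (f - c r).
Proof.
have [->|[a [b [e ->]]]] := placeP v.
  have [w [_ _ wr wu]] := at_infP; rewrite (wu _ vinf_at); exact: wr.
have [w [_ _ wr wu]] := at_pointP e; rewrite (wu _ (pt_at e)); exact: wr.
Qed.

End Points.

(** * Fibres over the projective line and degrees *)

Section RootMultiplicities.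

Variable K : closedFieldType.

Lemma prod_count (R : comPzRingType) (T : eqType) (f : T -> R) (l zs : seq T) :
  uniq l -> {subset zs <= l} ->
  \prod_(a <- l) f a ^+ count_mem a zs = \prod_(z <- zs) f z.
Proof.
move=> ul; elim: zs => [|z zs IHzs] zl.
  by rewrite big_nil big1 // => a _; rewrite expr0.
rewrite big_cons -IHzs; last by move=> a azs; apply: zl; rewrite inE azs orbT.
under eq_bigr do rewrite /= exprD.
rewrite big_split /=; congr (_ * _).
rewrite (bigD1_seq z) ?zl ?mem_head //= eqxx expr1 big1 ?mulr1 // => a az.
by rewrite eq_sym (negPf az) expr0.
Qed.

Lemma sum_count (T : eqType) (l zs : seq T) :
  uniq l -> {subset zs <= l} -> (\sum_(a <- l) count_mem a zs)%N = size zs.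
Proof.
move=> ul; elim: zs => [|z zs IHzs] zl; first by rewrite big1.
rewrite /= big_split /= IHzs; last by move=> a azs; apply: zl; rewrite inE azs orbT.
rewrite (bigD1_seq z) ?zl ?mem_head //= eqxx big1 // => a az.
by rewrite eq_sym (negPf az).
Qed.

Lemma mup_prod (d : K) (zs : seq K) a : d != 0 ->
  mup a (d *: \prod_(z <- zs) ('X - z%:P)) = count_mem a zs.
Proof.
move=> d0; rewrite -mul_polyC mupMr; last by rewrite rootC.
elim: zs => [|z zs IHzs].
  by rewrite big_nil mupNroot // root1.
rewrite big_cons mupM ?polyXsubC_eq0 ?IHzs //=; last first.
  by rewrite monic_neq0 // monic_prod_XsubC.
by rewrite -['X - _]expr1 mup_XsubCX; case: eqP.
Qed.

Lemma mup_factor (N : {poly K}) (l : seq K) : N != 0 -> uniq l ->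
  (forall a, root N a -> a \in l) ->
  N = lead_coef N *: \prod_(a <- l) ('X - a%:P) ^+ mup a N /\
  (size N).-1 = (\sum_(a <- l) mup a N)%N.
Proof.
move=> N0 ul Nl; have [zs Nz] := closed_field_poly_normal N.
have d0 : lead_coef N != 0 by rewrite lead_coef_eq0.
have zl : {subset zs <= l}.
  by move=> a az; apply: Nl; rewrite Nz rootZ // root_prod_XsubC.
have mE a : mup a N = count_mem a zs by rewrite {1}Nz mup_prod.
split.
  by rewrite {1}Nz -(prod_count _ ul zl); congr (_ *: _); apply: eq_bigr => a _; rewrite mE.
rewrite {1}Nz size_scale // size_prod_XsubC /= -(sum_count ul zl).
by apply: eq_bigr => a _; rewrite mE.
Qed.

End RootMultiplicities.

Section Fibres.

Variables (K : closedFieldType) (F : fieldType) (c : {rmorphism K -> F}).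
Variable C : hyperelliptic c.

Local Notation x := (hx C).
Local Notation y := (hy C).
Local Notation s := (hsig C).
Local Notation rs := (hroots C).
Local Notation p := (hpoly C).
Local Notation vinf := (vinf C).
Local Notation xinf := (xinf C).
Local Notation yinf := (yinf C).
Local Notation pt := (pt C).
Local Notation "A .<x>" := (ev c x A) (at level 2, format "A .<x>").

Implicit Types (v : place c) (a b : K) (A B : {poly K}) (f : F).

Lemma hsig_eq0 f : (s f == 0) = (f == 0).
Proof. exact: fmorph_eq0. Qed.

Definition sigp (v : place c) : place c :=
  transport_place (s' := idfun) (t := s) (t' := s) (hsigK C) (hsigK C)
    (hsigC C) v.

Lemma sigpE v f : sigp v f = v (s f). Proof. by []. Qed.

Lemma place_eq (v w : place c) : (forall f, v f = w f) -> v = w.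
Proof.
case: v w => o o0 oM oD oc oo [o' o0' oM' oD' oc' oo'] /= E.
have {}E : o = o' by apply/funext.
by subst o'; congr Place; exact: Prop_irrelevance.
Qed.

Lemma sigpK v : sigp (sigp v) = v.
Proof. by apply: place_eq => f; rewrite !sigpE hsigK. Qed.

Lemma val_ideal_sigp v f : val_ideal v (s f) -> val_ideal (sigp v) f.
Proof.
by case=> [/eqP|]; [rewrite hsig_eq0 => /eqP; left | right].
Qed.

Lemma sigp_over v a : val_ideal v (x - c a) -> val_ideal (sigp v) (x - c a).
Proof. by move=> h; apply: val_ideal_sigp; rewrite rmorphB /= hsigx hsigC. Qed.

Lemma sigp_pt a b : b ^+ 2 = p.[a] -> sigp (pt a b) = pt a (- b).
Proof.
move=> e; have [va vb] := pt_at e; apply: pt_uniq; split; first exact: sigp_over.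
apply: val_ideal_sigp; rewrite rmorphB /= hsigy hsigC rmorphN -opprD.
exact: val_idealN.
Qed.

Lemma sigp_inf : sigp vinf = vinf.
Proof.
apply: vinf_uniq; apply: val_ideal_sigp; rewrite hsig_xinf.
exact: vinf_at.
Qed.

Lemma hx_eq0 : (x == 0) = false. Proof. exact: negPf (hx_neq0 C). Qed.

Lemma vinf_x : vinf x = -2%:R.
Proof.
have e := congr1 vinf (yinf2 C); move: e.
have Q1 : val_ideal vinf (ev c xinf (qinf C) - c 1).
  rewrite -(qinf0 C); apply: val_horner; rewrite rmorph0 subr0; exact: vinf_at.
have [Q0 Qv] := ord_unit (oner_neq0 _) Q1.
rewrite ordX vinf_yinf evM evX ordM ?invr_neq0 ?hx_eq0 // Qv addr0 ord_inv.
by lia.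
Qed.

Lemma vinf_xC a : vinf (x - c a) = -2%:R.
Proof.
have e : (x - c a) = (1 - c a * xinf) * x.
  by rewrite mulrBl mul1r -mulrA /xinf mulVf ?mulr1 ?hx_eq0.
have [U0 Uv] : 1 - c a * xinf != 0 /\ vinf (1 - c a * xinf) = 0.
  apply: (@ord_unit _ _ c _ _ 1); rewrite ?oner_neq0 // rmorph1 addrC addKr.
  by apply/val_idealN/val_idealMl; [apply: val_ringC|apply: vinf_at].
by rewrite e ordM ?hx_neq0 // Uv add0r vinf_x.
Qed.

Lemma over_uniq v a a' :
  val_ideal v (x - c a) -> val_ideal v (x - c a') -> a = a'.
Proof.
move=> va va'; apply/eqP; rewrite -subr_eq0; apply/eqP/(@val_idealC _ _ _ v).
suff -> : c (a - a') = x - c a' - (x - c a) by exact: val_idealB.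
by rewrite rmorphB; ring.
Qed.

Lemma over_neq v a a' : val_ideal v (x - c a) -> a != a' -> v (x - c a') = 0.
Proof.
move=> va na; have [] // := @ord_unit _ _ c v (x - c a') (a - a').
  by rewrite subr_eq0.
suff -> : x - c a' - c (a - a') = x - c a by [].
by rewrite rmorphB; ring.
Qed.

Lemma over_notinf v a : val_ideal v (x - c a) -> v <> vinf.
Proof.
by move=> va E; have := val_idealP (hx_subC_neq0 C a) va; rewrite E vinf_xC.
Qed.

Lemma over_ex v : v <> vinf -> exists a, val_ideal v (x - c a).
Proof.
have [//|[a [b [e ->]]] _] := placeP C v.
by exists a; have [] := pt_at e.
Qed.

Lemma ev_XsubC a : ('X - a%:P).<x> = x - c a.
Proof. by rewrite !evE. Qed.

Lemma prod_XsubC_neq0 (l : seq K) : \prod_(j <- l) ('X - j%:P).<x> != 0.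
Proof.
by rewrite prodf_seq_neq0; apply/allP => j _ /=; rewrite ev_XsubC hx_subC_neq0.
Qed.

Lemma over_ev v a A : A != 0 -> val_ideal v (x - c a) ->
  v A.<x> = v (x - c a) * (mup a A)%:Z.
Proof.
move=> A0 va; have [l Al] := closed_field_poly_normal A.
have d0 : lead_coef A != 0 by rewrite lead_coef_eq0.
rewrite {2}Al mup_prod // Al evZ ordM ?fmorph_eq0 //; last first.
  by rewrite ev_prod prod_XsubC_neq0.
rewrite ord_const // add0r ev_prod; elim: (l) => [|r l' IHl].
  by rewrite big_nil Defs.ord1 mulr0.
rewrite big_cons ordM ?prod_XsubC_neq0 ?ev_XsubC ?hx_subC_neq0 // IHl /=.
rewrite PoszD mulrDr; congr (_ + _); case: (r =P a) => [->|/eqP ra].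
  by rewrite mulr1.
by rewrite mulr0 (over_neq va) // eq_sym.
Qed.

Lemma vinf_ev A : A != 0 -> vinf A.<x> = - (2 * (size A).-1)%:Z.
Proof.
move=> A0; have [l Al] := closed_field_poly_normal A.
have d0 : lead_coef A != 0 by rewrite lead_coef_eq0.
rewrite {2}Al size_scale // size_prod_XsubC Al evZ ordM ?fmorph_eq0 //; last first.
  by rewrite ev_prod prod_XsubC_neq0.
rewrite ord_const // add0r ev_prod; elim: (l) => [|r l' IHl].
  by rewrite big_nil Defs.ord1.
rewrite big_cons ordM ?prod_XsubC_neq0 ?ev_XsubC ?hx_subC_neq0 // IHl /=.
by rewrite vinf_xC; lia.
Qed.

Lemma pt0_y a : a \in rs -> pt a 0 y = 1. Proof. exact: pt_y. Qed.

Lemma root_sqr a : a \in rs -> 0 ^+ 2 = p.[a].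
Proof. by rewrite -hpoly_root => /eqP ->; rewrite expr0n. Qed.

Lemma pt0_over a : a \in rs -> val_ideal (pt a 0) (x - c a).
Proof. by move=> ar; have [] := pt_at (root_sqr ar). Qed.

Lemma mup_hpoly a : mup a p = (a \in rs) :> nat.
Proof.
by rewrite -[p]scale1r mup_prod ?oner_neq0 // count_uniq_mem ?hroots_uniq.
Qed.

Lemma pt0_x a : a \in rs -> pt a 0 (x - c a) = 2.
Proof.
move=> ar; have := congr1 (pt a 0) (hy2E C).
rewrite ordX pt_y // (over_ev (hpoly_neq0 C) (pt0_over ar)) mup_hpoly ar.
by lia.
Qed.

Definition ysqrt (a : K) : K := xget 0 [set b | b ^+ 2 = p.[a]]%classic.

Lemma ysqrtP a : ysqrt a ^+ 2 = p.[a].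
Proof.
apply: (@xgetPex _ 0 [set b | b ^+ 2 = p.[a]]%classic).
have [b] := @solve_monicpoly K 2 (fun i => if i is 0%N then p.[a] else 0) isT.
by rewrite !big_ord_recl big_ord0 /= mul0r !addr0 expr0 mulr1; exists b.
Qed.

Lemma ysqrt_eq0 a : (ysqrt a == 0) = (a \in rs).
Proof. by rewrite -hpoly_root -ysqrtP sqrf_eq0. Qed.

Definition fibre a : seq (place c) :=
  if a \in rs then [:: pt a 0] else [:: pt a (ysqrt a); sigp (pt a (ysqrt a))].

Lemma fibreP a v : reflect (val_ideal v (x - c a)) (v \in fibre a).
Proof.
apply: (iffP idP).
  rewrite /fibre; case: ifP => [ar|_]; rewrite !inE.
    by move=> ->; apply: pt0_over.
  have h : val_ideal (pt a (ysqrt a)) (x - c a) by have [] := pt_at (ysqrtP a).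
  by case/orP=> /eqP ->; last exact: sigp_over.
move=> va; have [E|[a' [b [e E]]]] := placeP C v.
  by case: (over_notinf va).
have aE : a' = a.
  by apply: over_uniq va; rewrite E; have [] := pt_at e.
rewrite aE in e E; have /eqP := ysqrtP a; rewrite -e eqf_sqr /fibre.
case: ifP => [ar|_] /orP[] /eqP bE; rewrite !inE E ?sigp_pt ?ysqrtP //.
- by have := ar; rewrite -ysqrt_eq0 bE => /eqP->.
- by have := ar; rewrite -ysqrt_eq0 bE oppr_eq0 => /eqP->.
- by rewrite bE eqxx.
- by rewrite bE opprK eqxx orbT.
Qed.

Lemma fibre_uniq a : uniq (fibre a).
Proof.
rewrite /fibre; case: ifP => // ar; rewrite /= inE andbT; apply/eqP => E.
have [_ h1] := pt_at (ysqrtP a).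
have [_] : at_point C (pt a (ysqrt a)) a (- ysqrt a).
  rewrite E sigp_pt ?ysqrtP //; apply: pt_at; rewrite sqrrN; exact: ysqrtP.
move/val_idealB/(_ h1) => h2; have /eqP : 2%:R * ysqrt a = 0.
  apply: (@val_idealC _ _ _ (pt a (ysqrt a))).
  suff -> : c (2%:R * ysqrt a) = y - c (- ysqrt a) - (y - c (ysqrt a)) by [].
  by rewrite rmorphM rmorph_nat rmorphN; ring.
by rewrite mulf_eq0 (negPf (h_two C)) ysqrt_eq0 ar.
Qed.

Definition places_over (l : seq K) := vinf :: flatten [seq fibre a | a <- l].

Lemma mem_places_over l v :
  v \in places_over l <-> v = vinf \/ exists2 a, a \in l & val_ideal v (x - c a).
Proof.
rewrite inE; split.
  case/orP=> [/eqP->|/flatten_mapP[a al /fibreP va]]; [by left|right].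
  by exists a.
case=> [->|[a al /fibreP va]]; first by rewrite eqxx.
by apply/orP; right; apply/flatten_mapP; exists a.
Qed.

Lemma places_over_uniq l : uniq l -> uniq (places_over l).
Proof.
move=> ul; rewrite /places_over cons_uniq; apply/andP; split.
  apply/negP => /flatten_mapP[a _ /fibreP va]; exact: (over_notinf va).
elim: l ul => //= a l IHl /andP[al ul]; rewrite cat_uniq fibre_uniq IHl // andbT.
apply/hasPn => v /flatten_mapP[a' a'l /fibreP va']; apply/negP => /fibreP va.
by case/negP: al; rewrite (over_uniq va va').
Qed.

Lemma big_places_over (R : Type) (idx : R) (op : Monoid.com_law idx) l
    (f : place c -> R) :
  \big[op/idx]_(v <- places_over l) f v =
  op (f vinf) (\big[op/idx]_(a <- l) \big[op/idx]_(v <- fibre a) f v).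
Proof. by rewrite big_cons big_flatten big_map. Qed.

(** All the zeros and poles of f lie over l or at infinity, so that sums and
    products over all places become sums and products over places_over l. *)
Definition covers (l : seq K) (f : F) :=
  forall v, v \notin places_over l -> v f = 0.

Lemma covers_sub l l' f : {subset l <= l'} -> covers l f -> covers l' f.
Proof.
move=> ll' cl v nv; apply: cl; apply: contra nv => /mem_places_over.
case=> [->|[a al va]]; first exact: mem_head.
by apply/mem_places_over; right; exists a => //; apply: ll'.
Qed.

Definition hnorm (A B : {poly K}) := A ^+ 2 - B ^+ 2 * p.

Lemma hnormE A B :
  (A.<x> + B.<x> * y) * s (A.<x> + B.<x> * y) = (hnorm A B).<x>.
Proof.
rewrite rmorphD rmorphM /= !hsig_ev hsigy /hnorm !evE -hy2E; ring.
Qed.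

Lemma hnorm_neq0 A B : A.<x> + B.<x> * y != 0 -> hnorm A B != 0.
Proof.
move=> f0; apply/eqP => N0; have := hnormE A B; rewrite N0 ev0 => /eqP.
by rewrite mulf_eq0 hsig_eq0 orbb (negPf f0).
Qed.

Lemma over_ring v a : val_ideal v (x - c a) -> val_ring v x.
Proof.
move=> va; rewrite -(subrK (c a) x).
by apply: val_ringD; [apply: val_idealW|apply: val_ringC].
Qed.

Lemma over_ringy v a : val_ideal v (x - c a) -> val_ring v y.
Proof.
move=> va; right; rewrite leNgt; apply/negP => y0.
have := val_ring_horner p (over_ring va).
move/(val_ringP (ev_neq0 C (hpoly_neq0 C))); rewrite -hy2E ordX; lia.
Qed.

Lemma over_ringf v a A B : val_ideal v (x - c a) ->
  val_ring v (A.<x> + B.<x> * y).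
Proof.
move=> va; have xO := over_ring va.
by apply: val_ringD; last apply: val_ringM; try exact: val_ring_horner;
   exact: over_ringy va.
Qed.

Lemma covers_poly l A B : A.<x> + B.<x> * y != 0 ->
  (forall a, root (hnorm A B) a -> a \in l) -> covers l (A.<x> + B.<x> * y).
Proof.
move=> f0 Nl v nv; have [E|vi] := EM (v = vinf).
  by case/negP: nv; apply/mem_places_over; left.
have [a va] := over_ex vi; have N0 := hnorm_neq0 f0.
have al : a \notin l.
  by apply: contra nv => al; apply/mem_places_over; right; exists a.
have := congr1 v (hnormE A B); rewrite ordM ?hsig_eq0 // -sigpE.
rewrite (over_ev N0 va) mupNroot; last by apply: contra al; apply: Nl.
have := val_ringP f0 (over_ringf A B va).
have := val_ringP f0 (over_ringf A B (sigp_over va)).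
by lia.
Qed.

Lemma covers_ex f : exists l, covers l f.
Proof.
have [->|f0] := eqVneq f 0; first by exists [::] => v _; rewrite Defs.ord0.
have [A [B [D [D0 fD]]]] := hspan C f.
have DE : D.<x> = D.<x> + 0.<x> * y by rewrite ev0 mul0r addr0.
have AB0 : A.<x> + B.<x> * y != 0 by rewrite -fD mulf_neq0.
have D0' : D.<x> + 0.<x> * y != 0 by rewrite -DE.
have [l1 e1] := closed_field_poly_normal (hnorm A B).
have [l2 e2] := closed_field_poly_normal (hnorm D 0).
have c1 : covers (l1 ++ l2) (A.<x> + B.<x> * y).
  apply: covers_poly => // a; rewrite e1 rootZ ?root_prod_XsubC.
    by rewrite mem_cat => ->.
  by rewrite lead_coef_eq0 hnorm_neq0.
have c2 : covers (l1 ++ l2) D.<x>.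
  rewrite DE; apply: covers_poly => // a; rewrite e2 rootZ ?root_prod_XsubC.
    by rewrite mem_cat orbC => ->.
  by rewrite lead_coef_eq0 hnorm_neq0.
exists (l1 ++ l2) => v nv; have := c1 _ nv; have := c2 _ nv.
by move=> e; rewrite -fD ordM // e addr0.
Qed.

Lemma covers_seq (fs : seq F) (vs : seq (place c)) : exists l,
  [/\ uniq l, forall f, f \in fs -> covers l f & {subset vs <= places_over l}].
Proof.
have [l1 h1] : exists l, forall f, f \in fs -> covers l f.
  elim: fs => [|f fs [l IH]]; first by exists [::].
  have [l' fl'] := covers_ex f; exists (l' ++ l) => h; rewrite inE.
  case/orP=> [/eqP->|/IH lh].
    by apply: (covers_sub _ fl') => a al; rewrite mem_cat al.
  by apply: (covers_sub _ lh) => a al; rewrite mem_cat al orbT.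
have [l2 h2] : exists l, {subset vs <= places_over l}.
  elim: vs => [|v vs [l IH]]; first by exists [::].
  have [E|/over_ex[a va]] := EM (v = vinf).
    by exists l => w; rewrite inE => /orP[/eqP->|/IH//]; rewrite E mem_head.
  exists (a :: l) => w; rewrite inE => /orP[/eqP->|/IH].
    by apply/mem_places_over; right; exists a => //; apply: mem_head.
  case/mem_places_over=> [->|[a' a'l va']]; first exact: mem_head.
  by apply/mem_places_over; right; exists a' => //; rewrite inE a'l orbT.
exists (undup (l1 ++ l2)); split; first exact: undup_uniq.
  move=> f /h1; apply: covers_sub => a al.
  by rewrite mem_undup mem_cat al.
move=> w /h2 /mem_places_over[->|[a al va]]; first exact: mem_head.
apply/mem_places_over; right; exists a => //.
by rewrite mem_undup mem_cat al orbT.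
Qed.

Lemma pt0_sig a : a \in rs -> sigp (pt a 0) = pt a 0.
Proof. by move=> ar; rewrite sigp_pt ?oppr0 //; apply: root_sqr. Qed.

(** The fibre is stable under the involution, so the sum is the order of the
    norm at one place of the fibre, and at a ramified place half of it. *)
Lemma fibre_sum A B a : A.<x> + B.<x> * y != 0 ->
  \sum_(v <- fibre a) v (A.<x> + B.<x> * y) = (mup a (hnorm A B))%:Z.
Proof.
move=> f0; have N0 := hnorm_neq0 f0; have NE := hnormE A B.
rewrite /fibre; case: ifP => ar.
  rewrite big_seq1; have := congr1 (pt a 0) NE.
  rewrite ordM ?hsig_eq0 // -sigpE pt0_sig // (over_ev N0 (pt0_over ar)).
  by rewrite pt0_x //; lia.
rewrite big_cons big_seq1 sigpE -ordM ?hsig_eq0 // NE.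
have [va _] := pt_at (ysqrtP a); rewrite (over_ev N0 va) pt_x ?mul1r ?ysqrtP //.
by rewrite ysqrt_eq0 ar.
Qed.

Lemma vinf_f A B : A.<x> + B.<x> * y != 0 ->
  vinf (A.<x> + B.<x> * y) = - ((size (hnorm A B)).-1)%:Z.
Proof.
move=> f0; have N0 := hnorm_neq0 f0; have := congr1 vinf (hnormE A B).
rewrite ordM ?hsig_eq0 // -sigpE sigp_inf vinf_ev //; lia.
Qed.

Lemma hnorm_roots A B l : A.<x> + B.<x> * y != 0 ->
  covers l (A.<x> + B.<x> * y) ->
  forall a, root (hnorm A B) a -> a \in l.
Proof.
move=> f0 cl a Na; apply/negPn/negP => al.
have N0 := hnorm_neq0 f0; have := fibre_sum a f0; rewrite big_seq big1.
  by move: Na; rewrite root_factor_theorem XsubC_dvd //; lia.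
move=> v /fibreP va; apply: cl; apply/negP => /mem_places_over.
by case=> [/(over_notinf va)//|[a' a'l va']]; rewrite -(over_uniq va va') (negPf al) in a'l.
Qed.

(** The zeros at finite distance are those of the norm of f, counted with
    multiplicity, and the pole at infinity has the degree of the norm as its
    order. *)
Lemma degree_poly A B l : A.<x> + B.<x> * y != 0 -> uniq l ->
  covers l (A.<x> + B.<x> * y) ->
  \sum_(v <- places_over l) v (A.<x> + B.<x> * y) = 0.
Proof.
move=> f0 ul cl; rewrite big_places_over vinf_f //=.
have [_ ->] := mup_factor (hnorm_neq0 f0) ul (hnorm_roots f0 cl).
rewrite (eq_bigr (fun a => (mup a (hnorm A B))%:Z)) => [|a _]; last exact: fibre_sum.
by rewrite -natz -sumrMnr; under [X in _ + X]eq_bigr do rewrite -natz; rewrite addNr.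
Qed.

End Fibres.

(** * Tame symbols *)

Section Symbols.

Variables (K : closedFieldType) (F : fieldType) (c : {rmorphism K -> F}).
Variable C : hyperelliptic c.

Local Notation x := (hx C).
Local Notation y := (hy C).
Local Notation s := (hsig C).
Local Notation rs := (hroots C).
Local Notation p := (hpoly C).
Local Notation vinf := (vinf C).
Local Notation xinf := (xinf C).
Local Notation yinf := (yinf C).
Local Notation pt := (pt C).
Local Notation sigp := (sigp C).
Local Notation covers := (covers C).
Local Notation places_over := (places_over C).
Local Notation fibre := (fibre C).
Local Notation hnorm := (hnorm C).
Local Notation "A .<x>" := (ev c x A) (at level 2, format "A .<x>").

Implicit Types (v w : place c) (a b : K) (A B : {poly K}) (f g h : F).

Lemma evalE v f a : val_ideal v (f - c a) -> eval v f = a.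
Proof.
move=> fa; pose P := [set r | f = c r \/ 0 < v (f - c r)]%classic.
have PE r : P r <-> val_ideal v (f - c r).
  by split=> [[->|]|[/subr0_eq|]]; rewrite /P /=; try by [left|right]; left; rewrite subrr.
have /PE Pe : P (eval v f) by apply: (@xgetPex _ 0 P); exists a; apply/PE.
apply/eqP; rewrite -subr_eq0; apply/eqP/(@val_idealC _ _ _ v).
suff -> : c (eval v f - a) = f - c a - (f - c (eval v f)) by exact: val_idealB.
by rewrite rmorphB; ring.
Qed.

Definition vunit v f := (f != 0) && (v f == 0).

Lemma vunitP v f : vunit v f -> val_ideal v (f - c (eval v f)) /\ eval v f != 0.
Proof.
case/andP=> f0 /eqP fv; have [|r fr] := residue C (v := v) f0.
  by rewrite fv.
rewrite (evalE fr); split=> //; apply/eqP => r0.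
rewrite r0 rmorph0 subr0 in fr.
by have := val_idealP f0 fr; rewrite fv.
Qed.

Lemma evalC v a : eval v (c a) = a.
Proof. by apply: evalE; left; rewrite subrr. Qed.

Lemma eval1 v : eval v (1 : F) = 1.
Proof. by rewrite -{1}(rmorph1 c) evalC. Qed.

Lemma vunitM v f g : vunit v f -> vunit v g -> vunit v (f * g).
Proof.
move=> /andP[f0 /eqP fv] /andP[g0 /eqP gv].
by rewrite /vunit mulf_neq0 // ordM // fv gv.
Qed.

Lemma vunitV v f : vunit v f -> vunit v f^-1.
Proof. by move=> /andP[f0 /eqP fv]; rewrite /vunit invr_eq0 f0 ord_inv fv. Qed.

Lemma vunitXz v f n : vunit v f -> vunit v (f ^ n).
Proof.
move=> /andP[f0 /eqP fv]; rewrite /vunit expfz_neq0 // ordXz fv mul0r.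
by rewrite eqxx.
Qed.

Lemma evalM v f g : vunit v f -> vunit v g ->
  eval v (f * g) = eval v f * eval v g.
Proof.
move=> uf ug; have [fr _] := vunitP uf; have [gr _] := vunitP ug; apply: evalE.
have fO : val_ring v f by case/andP: uf => _ /eqP fv; right; rewrite fv.
suff -> : f * g - c (eval v f * eval v g) =
   f * (g - c (eval v g)) + (f - c (eval v f)) * c (eval v g).
  by apply: val_idealD; [apply: val_idealMl | apply: val_idealMr => //; apply: val_ringC].
by rewrite rmorphM; ring.
Qed.

Lemma evalV v f : vunit v f -> eval v f^-1 = (eval v f)^-1.
Proof.
move=> uf; have [_ e0] := vunitP uf; have /andP[f0 _] := uf.
by apply: (mulfI e0); rewrite mulfV // -evalM ?vunitV // mulfV // eval1.
Qed.

Lemma evalX v f n : vunit v f -> eval v (f ^+ n) = eval v f ^+ n.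
Proof.
move=> uf; elim: n => [|n IHn]; first by rewrite !expr0 eval1.
by rewrite !exprS evalM ?IHn // exprnP vunitXz.
Qed.

Lemma evalXz v f n : vunit v f -> eval v (f ^ n) = eval v f ^ n.
Proof.
case: n => n uf; first exact: evalX.
by rewrite NegzE -!invr_expz evalV -?exprnP ?evalX // exprnP vunitXz.
Qed.

Lemma eval_ideal v f a : a != 0 -> val_ideal v (f - c a) ->
  vunit v f /\ eval v f = a.
Proof.
move=> a0 fa; have [f0 fv] := ord_unit a0 fa.
by rewrite /vunit f0 fv (evalE fa).
Qed.

Lemma eval_sigp v f : vunit v (s f) -> eval (sigp v) f = eval v (s f).
Proof.
move=> uf; have [fr _] := vunitP uf; apply: evalE; apply: val_ideal_sigp.
by rewrite rmorphB /= hsigC.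
Qed.

(** The tame symbol. The sign is what makes the Steinberg relation hold. *)
Definition tame v f g : K := (-1) ^ (v f * v g) * eval v (f ^ v g / g ^ v f).

Lemma vunit_tame v f g : f != 0 -> g != 0 -> vunit v (f ^ v g / g ^ v f).
Proof.
move=> f0 g0; rewrite /vunit mulf_neq0 ?invr_neq0 ?expfz_neq0 //.
by rewrite ordM ?invr_neq0 ?expfz_neq0 // ord_inv !ordXz mulrC subrr.
Qed.

Lemma sgz_sqr (n : int) : (-1) ^ n * (-1) ^ n = 1 :> K.
Proof. by rewrite -expfzMl mulrNN mulr1 exp1rz. Qed.

Lemma tameMl v f f' g : f != 0 -> f' != 0 -> g != 0 ->
  tame v (f * f') g = tame v f g * tame v f' g.
Proof.
move=> f0 f'0 g0; rewrite /tame mulrACA -evalM ?vunit_tame //.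
rewrite ordM // mulrDl !expfzDr ?oppr_eq0 ?oner_neq0 //; congr (_ * eval v _).
by rewrite expfzMl mulrACA -invfM.
Qed.

Lemma tame_sym v f g : f != 0 -> g != 0 -> tame v f g * tame v g f = 1.
Proof.
move=> f0 g0; rewrite /tame mulrACA [v g * _]mulrC sgz_sqr mul1r.
have uf := vunit_tame v f0 g0; have [_ e0] := vunitP uf.
by rewrite -[g ^ v f / _]invf_div evalV // mulfV.
Qed.

Lemma tame1l v g : tame v 1 g = 1.
Proof. by rewrite /tame Defs.ord1 mul0r !expr0z exp1rz divr1 eval1 mulr1. Qed.

Lemma sgz_cases (n : int) : (-1) ^ n = 1 :> K \/ (-1) ^ n = -1 :> K.
Proof.
have /eqP := sgz_sqr n; rewrite -expr2 sqrf_eq1.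
by case/orP=> /eqP ->; [left|right].
Qed.

Lemma sgz_mulnn (n : int) : (-1) ^ (n * n) = (-1) ^ n :> K.
Proof.
rewrite -exprz_exp; case: (sgz_cases n) => e; last by rewrite !e.
by rewrite e exp1rz.
Qed.

Lemma tame_self v f : f != 0 -> tame v f f = (-1) ^ v f.
Proof.
by move=> f0; rewrite /tame mulfV ?expfz_neq0 // eval1 mulr1 sgz_mulnn.
Qed.

Lemma tame_const v a f : a != 0 -> tame v (c a) f = a ^ v f.
Proof.
move=> a0; rewrite /tame ord_const // mul0r !expr0z divr1 mul1r.
rewrite evalXz ?evalC //; by rewrite /vunit fmorph_eq0 a0 ord_const.
Qed.

Lemma tame_unitr v f g a : f != 0 -> a != 0 -> val_ideal v (g - c a) ->
  tame v f g = a ^ (- v f).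
Proof.
move=> f0 a0 ga; have [ug ge] := eval_ideal a0 ga; have /andP[_ /eqP gv] := ug.
rewrite /tame gv mulr0 !expr0z !mul1r evalV ?vunitXz // evalXz // ge.
by rewrite invr_expz.
Qed.

Lemma tame_units v f g : f != 0 -> g != 0 -> v f = 0 -> v g = 0 ->
  tame v f g = 1.
Proof. by move=> f0 g0 fv gv; rewrite /tame fv gv mul0r !expr0z divr1 eval1 mulr1. Qed.

Lemma ord_1B v f : f != 0 -> 1 - f != 0 -> v f < 0 -> v (1 - f) = v f.
Proof.
move=> f0 g0 vf; have n1 : (1 : F) != 0 := oner_neq0 _.
have nf : - f != 0 by rewrite oppr_eq0.
have h1 := ordD v n1 nf g0.
have := @ordD _ _ _ v 1 (- (1 - f)) n1; rewrite oppr_eq0 subKr => /(_ g0 f0).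
move: h1; rewrite !ge_min !ordN Defs.ord1 (leNgt 0 (v f)) vf /= => h1 h2.
apply: le_anti; rewrite h2 /=; case/orP: h1 => // h1.
exact: le_trans (ltW vf) h1.
Qed.

(** If f is in the maximal ideal, 1 - f has value 1; by symmetry this settles
    the case where 1 - f is in it. If f has a pole, f / (1 - f) has value -1. *)
Lemma tame_steinberg v f : f != 0 -> 1 - f != 0 -> tame v f (1 - f) = 1.
Proof.
have pos g : g != 0 -> 1 - g != 0 -> 0 < v g -> tame v g (1 - g) = 1.
  move=> g0 g1 vg; rewrite (@tame_unitr v g (1 - g) 1) ?exp1rz ?oner_neq0 //.
  by right; rewrite rmorph1 addrAC subrr add0r ordN.
move=> f0 g0; case: (ltrgtP (v f) 0) => vf; last first.
- have [vg|vg] := eqVneq (v (1 - f)) 0; first by rewrite tame_units.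
  have h : 0 < v (1 - f) -> tame v (1 - f) f = 1.
    by move=> ?; have := pos (1 - f) g0; rewrite subKr; apply.
  have := tame_sym v f0 g0; rewrite h ?mulr1 //.
  rewrite lt_neqAle eq_sym vg /=; apply: val_ringP g0 _.
  by apply: val_ringD; [apply: val_ring1 | apply: val_ringN; right; rewrite vf].
- exact: pos.
have vg := ord_1B f0 g0 vf.
have [//||u e] := @eval_ideal v (f / (1 - f)) (-1).
- by rewrite oppr_eq0 oner_neq0.
- right; have -> : f / (1 - f) - c (-1) = (1 - f)^-1.
    by rewrite rmorphN1 opprK; field.
  by rewrite ord_inv vg oppr_gt0.
rewrite /tame vg sgz_mulnn.
have -> : f ^ v f / (1 - f) ^ v f = (f / (1 - f)) ^ v f by rewrite expfzMl exprz_inv invr_expz.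
by rewrite evalXz // e sgz_sqr.
Qed.

End Symbols.

(** * Weil reciprocity *)

Lemma big_support (R : Type) (idx : R) (op : Monoid.com_law idx) (T : eqType)
    (s1 s2 : seq T) (t : T -> R) : uniq s1 -> uniq s2 ->
  (forall v, v \notin s1 -> t v = idx) -> (forall v, v \notin s2 -> t v = idx) ->
  \big[op/idx]_(v <- s1) t v = \big[op/idx]_(v <- s2) t v.
Proof.
move=> u1 u2 h1 h2; have H (s s' : seq T) : (forall v, v \notin s' -> t v = idx) ->
    \big[op/idx]_(v <- s) t v = \big[op/idx]_(v <- [seq v <- s | v \in s']) t v.
  move=> hs; rewrite big_filter (bigID (mem s')) /= [X in op _ X]big1 ?Monoid.mulm1 //.
rewrite (H s1 s2) // (H s2 s1) //; apply: perm_big.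
apply: uniq_perm; rewrite ?filter_uniq // => v.
by rewrite !mem_filter andbC.
Qed.

(** With g the conjugate of f, the square f^2 is compared with the norm f g,
    up to the ratio f / g whose value at a ramified place is a sign. *)
Lemma sqr_div_norm (F : fieldType) (f g z : F) : g != 0 -> z != 0 ->
  f ^+ 2 / z = f * g / z * (f / g).
Proof. by move=> g0 z0; field; rewrite g0. Qed.

Section Reciprocity.

Variables (K : closedFieldType) (F : fieldType) (c : {rmorphism K -> F}).
Variable C : hyperelliptic c.

Local Notation x := (hx C).
Local Notation y := (hy C).
Local Notation s := (hsig C).
Local Notation rs := (hroots C).
Local Notation p := (hpoly C).
Local Notation vinf := (vinf C).
Local Notation xinf := (xinf C).
Local Notation yinf := (yinf C).
Local Notation pt := (pt C).
Local Notation sigp := (sigp C).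
Local Notation covers := (covers C).
Local Notation places_over := (places_over C).
Local Notation fibre := (fibre C).
Local Notation hnorm := (hnorm C).
Local Notation "A .<x>" := (ev c x A) (at level 2, format "A .<x>").

Implicit Types (v w : place c) (a b : K) (A B : {poly K}) (f g h : F).

Lemma coversM l f g : covers l f -> covers l g -> covers l (f * g).
Proof.
move=> cf cg v nv; have [->|f0] := eqVneq f 0; first by rewrite mul0r Defs.ord0.
have [->|g0] := eqVneq g 0; first by rewrite mulr0 Defs.ord0.
by rewrite ordM // cf // cg.
Qed.

Lemma coversV l f : covers l f -> covers l f^-1.
Proof. by move=> cf v nv; rewrite ord_inv cf // oppr0. Qed.

Lemma degree_principal l f : f != 0 -> uniq l -> covers l f ->
  \sum_(v <- places_over l) v f = 0.
Proof.
move=> f0 ul cf; have [A [B [D [D0 fD]]]] := hspan C f.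
have DE : D.<x> = D.<x> + 0.<x> * y by rewrite ev0 mul0r addr0.
have AB0 : A.<x> + B.<x> * y != 0 by rewrite -fD mulf_neq0.
have [l' [ul' h _]] := @covers_seq _ _ _ C [:: f; D.<x>; A.<x> + B.<x> * y] [::].
have cf' : covers l' f by apply: h; rewrite !in_cons eqxx.
have cD : covers l' D.<x> by apply: h; rewrite !in_cons eqxx orbT.
have cA : covers l' (A.<x> + B.<x> * y) by apply: h; rewrite !in_cons eqxx !orbT.
have -> : \sum_(v <- places_over l) v f = \sum_(v <- places_over l') v f.
  by apply: big_support; rewrite ?places_over_uniq.
have e1 := degree_poly AB0 ul' cA.
have e2 : \sum_(v <- places_over l') v D.<x> = 0.
  by rewrite DE in D0 cD *; apply: degree_poly.
rewrite -[LHS]addr0 -{2}e2 -big_split /= -[RHS]e1; apply: eq_bigr => v _.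
by rewrite -ordM ?fD.
Qed.

(** The product of the tame symbols of f and g over all places is 1. The
    finite set l of base points is arbitrary because the other symbols are
    trivial. *)
Definition recip f g := forall l, uniq l -> covers l f -> covers l g ->
  \prod_(v <- places_over l) tame v f g = 1.

Lemma recip_ex l f g : f != 0 -> g != 0 -> uniq l -> covers l f -> covers l g ->
  \prod_(v <- places_over l) tame v f g = 1 -> recip f g.
Proof.
move=> f0 g0 ul cf cg e l' ul' cf' cg'; rewrite -[RHS]e.
apply: big_support; rewrite ?places_over_uniq // => v nv; apply: tame_units => //;
by [apply: cf | apply: cg | apply: cf' | apply: cg'].
Qed.

Lemma recip_sym f g : f != 0 -> g != 0 -> recip f g -> recip g f.
Proof.
move=> f0 g0 H l ul cg cf; rewrite -[LHS]mulr1 -[X in _ * X](H l ul cf cg) -big_split /=.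
by apply: big1 => v _; apply: tame_sym.
Qed.

Lemma recipMl f f' g : f != 0 -> f' != 0 -> g != 0 ->
  recip f g -> recip f' g -> recip (f * f') g.
Proof.
move=> f0 f'0 g0 H H'.
have [l [ul h _]] := @covers_seq _ _ _ C [:: f; f'; g] [::].
have cf : covers l f by apply: h; rewrite !in_cons eqxx.
have cf' : covers l f' by apply: h; rewrite !in_cons eqxx orbT.
have cg : covers l g by apply: h; rewrite !in_cons eqxx !orbT.
apply: (@recip_ex l); rewrite ?mulf_neq0 //; first exact: coversM.
under eq_bigr do rewrite (tameMl C) //.
by rewrite big_split /= H // H' // mulr1.
Qed.

Lemma recipVl f g : f != 0 -> g != 0 -> recip f g -> recip f^-1 g.
Proof.
move=> f0 g0 H l ul cf cg; have f'0 : f^-1 != 0 by rewrite invr_eq0.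
have {}cf : covers l f by rewrite -[f]invrK; apply: coversV.
rewrite -[LHS]mul1r -[X in X * _](H l ul cf cg) -big_split /=.
apply: big1 => v _.
by rewrite -(tameMl C) // mulfV // (tame1l v).
Qed.

Lemma recip_divl f r g : f != 0 -> r != 0 -> g != 0 ->
  recip (r * f) g -> recip r g -> recip f g.
Proof.
move=> f0 r0 g0 H H'; have -> : f = r^-1 * (r * f) by rewrite mulKf.
by apply: recipMl; rewrite ?invr_eq0 ?mulf_neq0 //; apply: recipVl.
Qed.

Lemma recip_const a f : a != 0 -> f != 0 -> recip (c a) f.
Proof.
move=> a0 f0 l ul _ cf; under eq_bigr do rewrite (tame_const C) //.
have := degree_principal f0 ul cf; move: (places_over l) => vs.
suff -> : \prod_(v <- vs) a ^ v f = a ^ (\sum_(v <- vs) v f).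
  by move=> ->; rewrite expr0z.
elim: vs => [|v vs IH]; first by rewrite !big_nil expr0z.
by rewrite !big_cons IH expfzDr.
Qed.

(** f is a power of the anti-invariant uniformiser u times a unit, and a unit
    and its conjugate have the same value at a fixed place. *)
Lemma eval_ramified w u f : sigp w = w -> w u = 1 -> s u = - u -> u != 0 ->
  f != 0 -> vunit w (f / s f) /\ eval w (f / s f) = (-1) ^ w f.
Proof.
move=> sw wu su u0 f0; set n := w f.
have nu : u ^ n != 0 by rewrite expfz_neq0.
pose g := f / u ^ n; have ug : vunit w g.
  rewrite /vunit mulf_neq0 ?invr_neq0 //= ordM ?invr_neq0 // ord_inv ordXz wu.
  by rewrite mul1r subrr.
have usg : vunit w (s g).
  by have /andP[g0 gv] := ug; rewrite /vunit hsig_eq0 g0 -sigpE sw.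
have e1 : eval w (s g) = eval w g by rewrite -(eval_sigp usg) sw.
have sn : s (u ^ n) = (-1) ^ n * u ^ n.
  by rewrite -expfzMl mulN1r -su; case: (n) => k; rewrite ?NegzE -?invr_expz
    ?fmorphV -?exprnP rmorphXn.
have cn : (-1) ^ n = c ((-1) ^ n) :> F.
  by case: (n) => k; rewrite ?NegzE -?invr_expz ?fmorphV -?exprnP rmorphXn rmorphN1.
have sg1 : (-1) ^ n != 0 :> K by rewrite expfz_neq0 // oppr_eq0 oner_neq0.
have fE : f = g * u ^ n by rewrite /g divfK.
have h : f / s f = g / s g * c ((-1) ^ n).
  rewrite {1 2}fE rmorphM /= sn cn.
  have /andP[g0 _] := usg; have : c ((-1) ^ n) != 0 by rewrite fmorph_eq0.
  move=> c0; transitivity (g / s g * (c ((-1) ^ n))^-1).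
    by field; rewrite g0 c0 nu.
  congr (_ * _); apply: (mulfI c0); rewrite mulfV // -rmorphM sgz_sqr ?rmorph1 //.
have uc : vunit w (c ((-1) ^ n)) by rewrite /vunit fmorph_eq0 sg1 ord_const.
have [_ eg] := vunitP C ug; clearbody g.
rewrite h; split; first by do !apply: vunitM => //; apply: vunitV.
rewrite (evalM C) ?(evalM C) ?(evalV C) ?vunitV ?vunitM ?vunitV //.
by rewrite e1 mulfV // mul1r evalC.
Qed.

Lemma eval_inf A a : A != 0 ->
  vunit vinf (A.<x> / (x - c a) ^+ (size A).-1) /\
  eval vinf (A.<x> / (x - c a) ^+ (size A).-1) = lead_coef A.
Proof.
move=> A0; have [l Al] := closed_field_poly_normal A.
have d0 : lead_coef A != 0 by rewrite lead_coef_eq0.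
have -> : (size A).-1 = size l by rewrite Al size_scale // size_prod_XsubC.
have -> : A.<x> = c (lead_coef A) * \prod_(z <- l) ('X - z%:P).<x>.
  by rewrite {1}Al evZ ev_prod.
elim: (l) => [|r l' [u IHl]].
  rewrite big_nil expr0 mulr1 divr1 evalC; split=> //.
  by rewrite /vunit fmorph_eq0 d0 ord_const.
rewrite big_cons exprS.
have xa := hx_subC_neq0 C a.
have -> : c (lead_coef A) * (('X - r%:P).<x> * \prod_(j <- l') ('X - j%:P).<x>)
    / ((x - c a) * (x - c a) ^+ size l') =
  c (lead_coef A) * (\prod_(j <- l') ('X - j%:P).<x>) / (x - c a) ^+ size l' *
  ((x - c r) / (x - c a)).
  by rewrite ev_XsubC; field; rewrite xa expf_neq0.
have [//|u' e'] := @eval_ideal _ _ c vinf ((x - c r) / (x - c a)) 1 (oner_neq0 _).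
  have -> : (x - c r) / (x - c a) - c 1 = c (a - r) * (x - c a)^-1.
    by rewrite rmorph1 rmorphB /=; field.
  apply: val_idealMl; first exact: val_ringC.
  by right; rewrite ord_inv vinf_xC.
by split; [apply: vunitM | rewrite (evalM C) // IHl e' mulr1].
Qed.

Lemma eval_over v a A : A.[a] != 0 -> val_ideal v (x - c a) ->
  vunit v A.<x> /\ eval v A.<x> = A.[a].
Proof. by move=> Aa va; apply: eval_ideal => //; apply: val_horner. Qed.

Lemma fibre_other A B a a' : A.<x> + B.<x> * y != 0 -> a' != a ->
  \prod_(v <- fibre a') tame v (A.<x> + B.<x> * y) (x - c a) =
  (a' - a) ^- mup a' (hnorm A B).
Proof.
move=> f0 na; have na0 : a' - a != 0 by rewrite subr_eq0.
transitivity ((a' - a) ^ (- \sum_(v <- fibre a') v (A.<x> + B.<x> * y))).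
  have : {in fibre a', forall v, tame v (A.<x> + B.<x> * y) (x - c a) =
      (a' - a) ^ (- v (A.<x> + B.<x> * y))}.
    move=> v /fibreP va; apply: tame_unitr => //.
    suff -> : x - c a - c (a' - a) = x - c a' by [].
    by rewrite rmorphB; ring.
  elim: (fibre a') => [|v vs IH] H.
    by rewrite !big_nil oppr0 expr0z.
  rewrite !big_cons IH => [|w ws]; last by apply: H; rewrite in_cons ws orbT.
  by rewrite H ?mem_head // opprD expfzDr.
by rewrite fibre_sum // -invr_expz.
Qed.

(** Over a the symbol is computed from the norm N of f, whose part prime to x
    - a is M. At an unramified fibre the two symbols multiply to a norm; at a
    ramified place f^2 is replaced by N times f / sigma f. *)
Lemma fibre_self A B M a : A.<x> + B.<x> * y != 0 ->
  hnorm A B = ('X - a%:P) ^+ mup a (hnorm A B) * M -> M.[a] != 0 ->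
  \prod_(v <- fibre a) tame v (A.<x> + B.<x> * y) (x - c a) =
  (-1) ^+ mup a (hnorm A B) * M.[a].
Proof.
move=> f0; set f := A.<x> + B.<x> * y; set m := mup a _ => NM Ma.
have N0 := hnorm_neq0 f0; have NE : f * s f = (x - c a) ^+ m * M.<x>.
  by rewrite hnormE NM evM evXn ev_XsubC.
have xa := hx_subC_neq0 C a; have xam : (x - c a) ^+ m != 0 by rewrite expf_neq0.
have := fibre_sum a f0; rewrite -/m -/f /fibre; case: ifP => ar.
  rewrite !big_seq1 /tame => ->; rewrite pt0_x //.
  have [u e] := eval_ramified (pt0_sig ar) (pt0_y ar) (hsigy C) (hy_neq0 C) f0.
  have := fibre_sum a f0; rewrite /fibre ar big_seq1 -/f -/m => fm.
  rewrite fm in e; have [uM eM] := eval_over Ma (pt0_over ar).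
  have -> : f ^ 2 / (x - c a) ^ m = M.<x> * (f / s f).
    have sf0 : s f != 0 by rewrite hsig_eq0.
    have -> : M.<x> = f * s f / (x - c a) ^+ m by rewrite NE mulrC mulKf.
    exact: sqr_div_norm.
  rewrite (evalM C) // eM e mulrC -exprz_exp -exprnP.
  rewrite (_ : (-1) ^+ m ^ 2 = 1) ?mulr1 1?mulrC //.
  by rewrite -[RHS](sgz_sqr K m).
rewrite !big_cons !big_nil addr0 mulr1.
have bn : ysqrt C a != 0 by rewrite ysqrt_eq0 ar.
have va : val_ideal (pt a (ysqrt C a)) (x - c a) by have [] := pt_at (ysqrtP C a).
set v := pt a _ in va *; rewrite sigpE => fm.
have vx : v (x - c a) = 1 by rewrite pt_x // ysqrtP.
have sx : s (x - c a) = x - c a by rewrite rmorphB /= hsigx hsigC.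
have sf0 : s f != 0 by rewrite hsig_eq0.
have uf : vunit v (f / (x - c a) ^ v f).
  by rewrite /vunit mulf_neq0 ?invr_neq0 ?expfz_neq0 //= ordM ?invr_neq0
    ?expfz_neq0 // ord_inv ordXz vx mul1r subrr.
have usf : vunit v (s f / (x - c a) ^ v (s f)).
  by rewrite /vunit mulf_neq0 ?invr_neq0 ?expfz_neq0 //= ordM ?invr_neq0
    ?expfz_neq0 // ord_inv ordXz vx mul1r subrr.
rewrite /tame !sigpE sx vx !mulr1 !expr1z.
have h : s (f / (x - c a) ^ v (s f)) = s f / (x - c a) ^ v (s f).
  rewrite fmorph_div; congr (_ / _).
  by case: (v (s f)) => k; rewrite ?NegzE -?invr_expz ?fmorphV -?exprnP rmorphXn /= sx.
rewrite eval_sigp h // mulrACA -expfzDr ?oppr_eq0 ?oner_neq0 // fm.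
rewrite -(evalM C) // mulrACA NE -invfM -expfzDr // fm.
rewrite -exprnP [_ * M.<x>]mulrC mulfK //.
by have [_ ->] := eval_over Ma va.
Qed.

Lemma inf_self A B a : A.<x> + B.<x> * y != 0 ->
  tame vinf (A.<x> + B.<x> * y) (x - c a) =
  (-1) ^+ (size (hnorm A B)).-1 / lead_coef (hnorm A B).
Proof.
move=> f0; set f := A.<x> + B.<x> * y; set N := hnorm A B; set n := (size N).-1.
have N0 := hnorm_neq0 f0; have xa := hx_subC_neq0 C a.
have xan : (x - c a) ^+ n != 0 by rewrite expf_neq0.
have sf0 : s f != 0 by rewrite hsig_eq0.
have [u e] := eval_ramified (sigp_inf C) (vinf_yinf C) (hsig_yinf C) (yinf_neq0 C) f0.
have [uN eN] := eval_inf a N0; rewrite -/N -/n in uN eN.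
rewrite /tame vinf_xC vinf_f // -/N -/n.
have -> : f ^ (-2%:R) / (x - c a) ^ (- n%:Z) =
    ((N.<x> / (x - c a) ^+ n) * (f / s f))^-1.
  rewrite -!invr_expz -!exprnP -hnormE -/f -(sqr_div_norm f sf0 xan).
  by rewrite invrK invf_div mulrC.
have uNf := vunitM uN u.
rewrite (evalV C uNf) (evalM C uN u) eN e vinf_f // -/N -/n invfM.
have -> : (-1) ^ (- n%:Z * -2%:R) = 1 :> K.
  rewrite mulrNN -exprz_exp; case: (sgz_cases K n) => ->; first by rewrite exp1rz.
  by rewrite -exprnP sqrrN expr1n.
rewrite mul1r mulrC -invr_expz invrK; congr (_ / _).
Qed.

(** All the local factors are expressed by the norm N of A + B y. With N = d
    (x - a)^m (product of (x - a1)^(m1)), the fibres other than the one over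
    a contribute the inverses of (a1 - a)^(m1), the fibre over a contributes
    d times the product of these factors up to signs, and infinity cancels d
    and the signs. *)
Lemma recip_lin A B a : A.<x> + B.<x> * y != 0 ->
  recip (A.<x> + B.<x> * y) (x - c a).
Proof.
move=> f0; have xa := hx_subC_neq0 C a.
have [l [ul h hv]] :=
  @covers_seq _ _ _ C [:: A.<x> + B.<x> * y; x - c a] [:: pt a (ysqrt C a)].
have cf : covers l (A.<x> + B.<x> * y) by apply: h; rewrite !in_cons eqxx.
have cg : covers l (x - c a) by apply: h; rewrite !in_cons eqxx orbT.
have al : a \in l.
  have va : val_ideal (pt a (ysqrt C a)) (x - c a) by have [] := pt_at (ysqrtP C a).
  have /mem_places_over : pt a (ysqrt C a) \in places_over l.
    by apply: hv; apply: mem_head.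
  case=> [/(over_notinf va)//|[a' a'l va']].
  by rewrite (over_uniq va va').
apply: (recip_ex f0 xa ul cf cg).
have N0 := hnorm_neq0 f0; set N := hnorm A B.
have [NE Nn] := mup_factor N0 ul (hnorm_roots f0 cf).
rewrite -/N in NE Nn.
have pl := perm_to_rem al; have na a' : a' \in rem a l -> a' != a.
  by rewrite mem_rem_uniq // inE => /andP[].
pose M := lead_coef N *: \prod_(a' <- rem a l) ('X - a'%:P) ^+ mup a' N.
have d0 : lead_coef N != 0 by rewrite lead_coef_eq0.
have MaE : M.[a] = lead_coef N * \prod_(a' <- rem a l) (a - a') ^+ mup a' N.
  rewrite hornerZ horner_prod; congr (_ * _); apply: eq_bigr => a' _.
  by rewrite horner_exp hornerXsubC.
have Ma : M.[a] != 0.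
  rewrite MaE mulf_neq0 //; rewrite prodf_seq_neq0; apply/allP => a' /na na'.
  by rewrite /= expf_neq0 // subr_eq0 eq_sym.
have NM : N = ('X - a%:P) ^+ mup a N * M.
  by rewrite {1}NE (perm_big _ pl) big_cons /= -scalerAr.
rewrite big_places_over inf_self // -/N /= (perm_big _ pl) big_cons /=.
rewrite (fibre_self f0 NM Ma) -/N MaE.
have -> : \prod_(j <- rem a l) \prod_(v <- fibre j)
    tame v (A.<x> + B.<x> * y) (x - c a) =
  \prod_(a' <- rem a l) (a' - a) ^- mup a' N.
  by rewrite big_seq [RHS]big_seq; apply: eq_bigr => a' /na na'; apply: fibre_other.
have -> : \prod_(a' <- rem a l) (a - a') ^+ mup a' N =
  (\prod_(a' <- rem a l) (-1) ^+ mup a' N) *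
  \prod_(a' <- rem a l) (a' - a) ^+ mup a' N.
  by rewrite -big_split /=; apply: eq_bigr => a' _; rewrite -exprMn mulN1r opprB.
have -> : \prod_(a' <- rem a l) (a' - a) ^- mup a' N =
    (\prod_(a' <- rem a l) (a' - a) ^+ mup a' N)^-1.
  by rewrite prodfV.
have P0 : \prod_(a' <- rem a l) (a' - a) ^+ mup a' N != 0.
  rewrite prodf_seq_neq0; apply/allP => a' /na na'.
  by rewrite /= expf_neq0 // subr_eq0.
have -> : \prod_(a' <- rem a l) (-1) ^+ mup a' N =
    (-1) ^+ (mup a N) * (-1) ^+ (size N).-1 :> K.
  rewrite Nn (perm_big _ pl) big_cons /= exprD mulrA -exprD addnn -signr_odd.
  rewrite odd_double expr0 mul1r; elim: (rem a l) => [|r l' IH].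
    by rewrite !big_nil.
  by rewrite !big_cons IH exprD.
set P := \prod_(_ <- _) _ in P0 *.
have s1 : (-1) ^+ (mup a N) * (-1) ^+ (mup a N) = 1 :> K.
  by rewrite -exprMn mulrNN mulr1 expr1n.
have s2 : (-1) ^+ (size N).-1 * (-1) ^+ (size N).-1 = 1 :> K.
  by rewrite -exprMn mulrNN mulr1 expr1n.
move: s1 s2; set e1 := (-1) ^+ mup _ _; set e2 := (-1) ^+ (size N).-1.
move: e1 e2 (lead_coef N) d0 P P0 => e1 e2 d d0 P P0 s1 s2.
have -> : e2 / d * (e1 * (d * (e1 * e2 * P)) * P^-1) = (e1 * e1) * (e2 * e2).
  by field; rewrite P0 d0.
by rewrite s1 s2 mulr1.
Qed.

Lemma recip_linr f a : f != 0 -> recip f (x - c a).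
Proof.
move=> f0; have [A [B [D [D0 fD]]]] := hspan C f.
have DE : D.<x> = D.<x> + 0.<x> * y by rewrite ev0 mul0r addr0.
apply: (@recip_divl _ D.<x>); rewrite ?hx_subC_neq0 //.
  by rewrite mulrC fD; apply: recip_lin; rewrite -fD mulf_neq0.
by rewrite DE in D0 *; apply: recip_lin.
Qed.

Lemma recip_evr f A : f != 0 -> A != 0 -> recip A.<x> f.
Proof.
move=> f0 A0; have [l ->] := closed_field_poly_normal A.
have d0 : lead_coef A != 0 by rewrite lead_coef_eq0.
rewrite evZ ev_prod; apply: recipMl; rewrite ?fmorph_eq0 ?prod_XsubC_neq0 //.
  exact: recip_const.
elim: l => [|r l IHl]; first by rewrite big_nil -(rmorph1 c); apply: recip_const; rewrite ?oner_neq0.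
rewrite big_cons; apply: recipMl; rewrite ?prod_XsubC_neq0 // ev_XsubC ?hx_subC_neq0 //.
by apply: recip_sym; rewrite ?hx_subC_neq0 //; apply: recip_linr.
Qed.

Lemma recip_ratl f A D : f != 0 -> A.<x> != 0 -> D.<x> != 0 ->
  recip (A.<x> / D.<x>) f.
Proof.
have nz B : B.<x> != 0 -> B != 0 by apply: contraNneq => ->; rewrite ev0.
move=> f0 A0 D0; apply: recipMl; rewrite ?invr_eq0 //.
  by apply: recip_evr => //; apply: nz.
by apply: recipVl => //; apply: recip_evr => //; apply: nz.
Qed.

(** Bimultiplicativity reduces the claim to f = A + B y and g = A1 + B1 y,
    and to the known case where one of them is in K(x). The combination B1 f
    - B g = m is in K(x). If m = 0, then f / g is in K(x) and the symbol of g
    with itself is a sign governed by the degree of g. Otherwise B1 f / m and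
    - B g / m have sum 1 and the Steinberg relation applies. *)
Theorem weil_reciprocity f g : f != 0 -> g != 0 -> recip f g.
Proof.
wlog [A [B fE]] : f / exists A B, f = A.<x> + B.<x> * y.
  move=> H f0 g0; have [A [B [D [D0 fD]]]] := hspan C f.
  apply: (@recip_divl _ D.<x>) => //.
    by rewrite mulrC fD; apply: H => //; [exists A, B|rewrite -fD mulf_neq0].
  by apply: recip_evr => //; apply: contraNneq D0 => ->; rewrite ev0.
wlog [A' [B' gE]] : g / exists A B, g = A.<x> + B.<x> * y.
  move=> H f0 g0; have [A' [B' [D [D0 fD]]]] := hspan C g.
  apply: recip_sym => //; apply: (@recip_divl _ D.<x>) => //.
    rewrite mulrC fD; have h : A'.<x> + B'.<x> * y != 0 by rewrite -fD mulf_neq0.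
    by apply: recip_sym => //; apply: H => //; exists A', B'.
  by apply: recip_evr => //; apply: contraNneq D0 => ->; rewrite ev0.
move=> f0 g0.
have [B0|B0] := eqVneq B 0.
  rewrite fE B0 ev0 mul0r addr0 in f0 *; apply: recip_evr => //.
  by apply: contraNneq f0 => ->; rewrite ev0.
have [B'0|B'0] := eqVneq B' 0.
  rewrite gE B'0 ev0 mul0r addr0 in g0 *; apply: recip_sym => //.
  by apply: recip_evr => //; apply: contraNneq g0 => ->; rewrite ev0.
have bx := ev_neq0 C B0; have b'x := ev_neq0 C B'0.
pose m := A * B' - A' * B.
have mE : B'.<x> * f - B.<x> * g = m.<x> by rewrite fE gE /m !evE; ring.
have [m0|m0] := eqVneq m 0.
  have fg : f = B.<x> / B'.<x> * g.
    move/eqP: mE; rewrite m0 ev0 subr_eq0 => /eqP e.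
    by apply: (mulfI b'x); rewrite e; field.
  rewrite fg; apply: recipMl; rewrite ?mulf_neq0 ?invr_eq0 //.
    exact: recip_ratl.
  move=> l ul cg _; under eq_bigr do rewrite tame_self //.
  have := degree_principal g0 ul cg; move: (places_over l) => vs.
  suff -> : \prod_(v <- vs) (-1) ^ v g = (-1) ^ (\sum_(v <- vs) v g) :> K.
    by move=> ->; rewrite expr0z.
  elim: vs => [|v vs IH]; first by rewrite !big_nil expr0z.
  by rewrite !big_cons IH expfzDr // oppr_eq0 oner_neq0.
have mx := ev_neq0 C m0.
have st : recip (B'.<x> / m.<x> * f) ((- B).<x> / m.<x> * g).
  have -> : (- B).<x> / m.<x> * g = 1 - B'.<x> / m.<x> * f.
    by rewrite evN; apply: (mulfI mx); rewrite mulrBr mulr1 -{3}mE; field.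
  move=> l ul _ _; apply: big1 => v _; apply: (tame_steinberg C).
    by rewrite !mulf_neq0 ?invr_eq0.
  have -> : 1 - B'.<x> / m.<x> * f = - (B.<x> / m.<x> * g).
    by apply: (mulfI mx); rewrite mulrBr mulr1 -{1}mE; field.
  by rewrite oppr_eq0 !mulf_neq0 ?invr_eq0.
have nb : (- B).<x> != 0 by rewrite evN oppr_eq0.
have r1 : recip f ((- B).<x> / m.<x> * g).
  apply: recip_divl st _; rewrite ?mulf_neq0 ?invr_eq0 //.
  by apply: recip_ratl; rewrite ?mulf_neq0 ?invr_eq0.
apply: recip_sym => //.
have r0 : (- B).<x> / m.<x> != 0 by rewrite mulf_neq0 ?invr_eq0.
apply: (recip_divl g0 r0 f0).
  by apply: recip_sym; rewrite ?mulf_neq0 ?invr_eq0.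
exact: recip_ratl.
Qed.

End Reciprocity.

(** * Divisor classes of order 2 *)

Section DivisorClasses.

Variables (K F : fieldType) (c : {rmorphism K -> F}).
Implicit Types (v : place c) (D E : divisor c) (f g : F).

Local Notation cls := (@divisor_class K F c).

Lemma clsD D E : cls (D + E) = cls D + cls E.
Proof. exact: Quotient.pi_add. Qed.

Lemma clsN D : cls (- D) = - cls D.
Proof. exact: Quotient.pi_opp. Qed.

Lemma clsB D E : cls (D - E) = cls D - cls E.
Proof. by rewrite clsD clsN. Qed.

Lemma cls_eqE D E : (cls D == cls E) = principal (D - E).
Proof. exact: esym (Quotient.idealrBE _ D E). Qed.

Lemma cls_eq0 D : cls D = 0 <-> exists f, is_div f D.
Proof.
have -> : 0 = cls 0.
  by apply: (addIr (cls 0)); rewrite -clsD add0r addr0.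
split=> [/eqP|]; first by rewrite cls_eqE subr0 => /asboolP.
by move=> fD; apply/eqP; rewrite cls_eqE subr0; apply/asboolP.
Qed.

Lemma cls0 : cls 0 = 0.
Proof.
by apply/cls_eq0; exists 1; split=> [|v]; rewrite ?unitr1 // coeff0 Defs.ord1.
Qed.

Lemma cls_sum (I : Type) (r : seq I) (P : pred I) (f : I -> divisor c) :
  cls (\sum_(i <- r | P i) f i) = \sum_(i <- r | P i) cls (f i).
Proof.
apply: (big_morph cls clsD cls0).
Qed.

Lemma clsMn D n : cls (D *+ n) = cls D *+ n.
Proof. by elim: n => [|n IHn]; rewrite ?mulr0n ?cls0 // !mulrS clsD IHn. Qed.

Lemma clsMz D (n : int) : cls (D *~ n) = cls D *~ n.
Proof.
by case: n => n; rewrite ?NegzE ?mulrNz ?clsN -!pmulrn clsMn.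
Qed.

Lemma is_divE f D : is_div f D <-> f != 0 /\ forall v, coeff v D = v f.
Proof. by rewrite /is_div unitfE. Qed.

Lemma is_div1 : is_div (1 : F) (0 : divisor c).
Proof. by apply/is_divE; split=> [|v]; rewrite ?oner_neq0 // coeff0 Defs.ord1. Qed.

Lemma is_divM f g D E : is_div f D -> is_div g E -> is_div (f * g) (D + E).
Proof.
move=> /is_divE[f0 fD] /is_divE[g0 gE]; apply/is_divE.
by split=> [|v]; rewrite ?mulf_neq0 // coeffD fD gE ordM.
Qed.

Lemma is_divV f D : is_div f D -> is_div f^-1 (- D).
Proof.
move=> /is_divE[f0 fD]; apply/is_divE.
by split=> [|v]; rewrite ?invr_eq0 // coeffN fD ord_inv.
Qed.

Lemma is_divX f D n : is_div f D -> is_div (f ^+ n) (D *+ n).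
Proof.
move=> fD; elim: n => [|n IHn]; first by rewrite expr0 mulr0n; apply: is_div1.
by rewrite exprS mulrS; apply: is_divM.
Qed.

Lemma coeffU1 v w : coeff w << v >> = (v == w)%:R :> int.
Proof. by rewrite coeffU mul1r. Qed.

Lemma deg_sum D (s : seq (place c)) : uniq s -> {subset dom D <= s} ->
  deg D = \sum_(v <- s) coeff v D.
Proof.
move=> us Ds; rewrite -{1}[D]freeg_sumE raddf_sum /=.
under eq_bigr do rewrite degU.
apply: big_support; rewrite ?uniq_dom // => v; first exact: coeff_outdom.
by move=> nv; apply: coeff_outdom; apply: contra nv; apply: Ds.
Qed.

End DivisorClasses.

Section Divisors.

Variables (K : closedFieldType) (F : fieldType) (c : {rmorphism K -> F}).
Variable C : hyperelliptic c.

Local Notation x := (hx C).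
Local Notation y := (hy C).
Local Notation s := (hsig C).
Local Notation rs := (hroots C).
Local Notation p := (hpoly C).
Local Notation vinf := (vinf C).
Local Notation pt := (pt C).
Local Notation sigp := (sigp C).
Local Notation covers := (covers C).
Local Notation places_over := (places_over C).
Local Notation fibre := (fibre C).
Local Notation "A .<x>" := (ev c x A) (at level 2, format "A .<x>").
Local Notation cls := (@divisor_class K F c).

Implicit Types (v w : place c) (a b : K) (A B : {poly K}) (f g h : F).
Implicit Types (D E : divisor c).

(** Only the finitely many places over a cover of f can occur in its divisor. *)
Lemma div_ex f : f != 0 -> exists D : divisor c, is_div f D.
Proof.
move=> f0; have [l [ul h _]] := @covers_seq _ _ _ C [:: f] [::].
have cf : covers l f by apply: h; rewrite mem_head.
exists (\sum_(v <- places_over l) << v f *g v >>); apply/is_divE; split=> // v.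
rewrite raddf_sum /=; under eq_bigr do rewrite coeffU.
have [vl|vl] := boolP (v \in places_over l); last first.
  rewrite cf // big_seq big1 // => w wl; case: eqP => [E|_]; last by rewrite mulr0.
  by rewrite -E wl in vl.
rewrite (bigD1_seq v) ?places_over_uniq //= eqxx mulr1 big1 ?addr0 // => w wv.
by rewrite (negPf wv) mulr0.
Qed.

Lemma dom_covered l f D n : is_div f (D *+ n.+1) -> covers l f ->
  {subset dom D <= places_over l}.
Proof.
move=> /is_divE[_ fD] cf v; rewrite mem_dom; apply: contraR => /cf.
by rewrite -fD coeffMn => /eqP; rewrite mulrn_eq0.
Qed.

Lemma deg_principal f D : is_div f D -> deg D = 0.
Proof.
move=> fD; have /is_divE[f0 Df] := fD.
have [l [ul h _]] := @covers_seq _ _ _ C [:: f] [::].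
have cf : covers l f by apply: h; rewrite mem_head.
rewrite (@deg_sum _ _ _ _ (places_over l)) ?places_over_uniq //.
  by under eq_bigr do rewrite Df; apply: degree_principal.
by apply: (@dom_covered l f _ 0); rewrite ?mulr1n.
Qed.

Lemma deg_cls D E : cls D = cls E -> deg D = deg E.
Proof.
move/eqP; rewrite -subr_eq0 -clsB => /eqP/cls_eq0[f /deg_principal].
by rewrite degB => /eqP; rewrite subr_eq0 => /eqP.
Qed.

Lemma div_xC a : is_div (x - c a) (<< pt a (ysqrt C a) >> +
   << sigp (pt a (ysqrt C a)) >> - << vinf >> *+ 2 : divisor c).
Proof.
apply/is_divE; split=> [|v]; first exact: hx_subC_neq0.
rewrite coeffB coeffD coeffMn !coeffU1.
have va : val_ideal (pt a (ysqrt C a)) (x - c a) by have [] := pt_at (ysqrtP C a).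
have [->|vi] := EM (v = vinf).
  rewrite vinf_xC eqxx; case: eqP => [/(over_notinf va)//|_].
  by case: eqP => [/(over_notinf (sigp_over va))//|_].
rewrite [vinf == v]eq_sym; move/eqP/negPf: (vi) => -> /=; rewrite subr0.
have [/fibreP vf|vf] := boolP (v \in fibre a); last first.
  have [b vb] := over_ex vi; rewrite (over_neq vb); last first.
    by apply: contra vf => /eqP <-; apply/fibreP.
  case: eqP => [E|_]; first by case/fibreP: vf; rewrite -E.
  by case: eqP => [E|_] //; case/fibreP: vf; rewrite -E; apply: sigp_over.
have [ar|ar] := boolP (a \in rs).
  have -> : ysqrt C a = 0 by apply/eqP; rewrite ysqrt_eq0.
  rewrite pt0_sig //; move/fibreP: vf; rewrite /fibre ar mem_seq1 => /eqP ->.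
  by rewrite eqxx pt0_x.
have b0 : ysqrt C a != 0 by rewrite ysqrt_eq0.
have := fibre_uniq C a; move/fibreP: vf; rewrite /fibre (negPf ar) !in_cons !in_nil orbF.
rewrite /= inE andbT; case/orP=> /eqP -> /negPf ne.
  by rewrite eqxx eq_sym ne pt_x // ysqrtP.
by rewrite ne eqxx sigpE rmorphB /= hsigx hsigC pt_x // ysqrtP.
Qed.

(** The point v together with its conjugate is linearly equivalent to twice
    the point at infinity. *)
Lemma cls_conj v : cls << v >> + cls << sigp v >> = cls << vinf >> *+ 2.
Proof.
have [->|vi] := EM (v = vinf); first by rewrite sigp_inf.
have [a va] := over_ex vi.
apply/eqP; rewrite -subr_eq0 -clsD -clsMn -clsB; apply/eqP/cls_eq0.
exists (x - c a); have := div_xC a; move/fibreP: va; rewrite /fibre.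
case: ifP => [ar|_].
  rewrite mem_seq1 => /eqP ->; have -> // : ysqrt C a = 0.
  by apply/eqP; rewrite ysqrt_eq0.
rewrite !in_cons in_nil orbF => /orP[]/eqP -> //.
by rewrite sigpK [<< sigp _ >> + _]addrC.
Qed.

(** The class of the Weierstrass point over a, based at infinity. *)
Definition ecls (a : K) : Pic c := cls (<< pt a 0 >> - << vinf >>).

Lemma ecls2 a : a \in rs -> ecls a *+ 2 = 0.
Proof.
move=> ar; have := cls_conj (pt a 0); rewrite pt0_sig // -mulr2n => e.
by rewrite /ecls clsB mulrnBl e subrr.
Qed.

Lemma div_xr a : a \in rs -> is_div (x - c a) ((<< pt a 0 >> - << vinf >>) *+ 2 : divisor c).
Proof.
move=> ar; have := div_xC a; have -> : ysqrt C a = 0 by apply/eqP; rewrite ysqrt_eq0.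
by rewrite pt0_sig // mulrnBl [_ *+ 2]mulr2n.
Qed.

Lemma ecls_Jac2 a : a \in rs -> Jac2 (ecls a).
Proof.
by move=> ar; split; [exact: ecls2|exists (<< pt a 0 >> - << vinf >>);
  rewrite // degB !degU subrr].
Qed.

Lemma pt_inj a a' b b' : b ^+ 2 = p.[a] -> b' ^+ 2 = p.[a'] ->
  pt a b = pt a' b' -> a = a'.
Proof.
move=> e e' E; have [va _] := pt_at e; have [va' _] := pt_at e'.
by rewrite -E in va'; apply: over_uniq va va'.
Qed.

Lemma vinf_hy : vinf y = - (size rs)%:Z.
Proof.
have yE : y = yinf C * x ^+ (hgenus C).+1.
  by rewrite /yinf divfK // expf_neq0 // hx_neq0.
rewrite yE ordM ?yinf_neq0 ?expf_neq0 ?hx_neq0 // vinf_yinf ordX vinf_x.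
by rewrite size_roots; lia.
Qed.

Lemma ord_hy v : v y = (if v == vinf then - (size rs)%:Z else
   (v \in [seq pt a 0 | a <- rs])%:Z).
Proof.
case: eqP => [->|vi]; first exact: vinf_hy.
have [//|[a [b [e ->]]]] := placeP C v; have [b0|b0] := eqVneq b 0.
  have ar : a \in rs by rewrite -hpoly_root -e b0 expr0n.
  rewrite b0 pt_y //; have -> // : pt a 0 \in [seq pt i 0 | i <- rs].
  by apply/mapP; exists a.
have [va vb] := pt_at e; have [_ ->] := ord_unit b0 vb.
case: (boolP (_ \in _)) => // /mapP[a' a'r E].
have aa := pt_inj e (root_sqr a'r) E; rewrite -aa -hpoly_root -e in a'r.
by rewrite sqrf_eq0 (negPf b0) in a'r.
Qed.

Lemma div_hy : is_div y (\sum_(a <- rs) (<< pt a 0 >> - << vinf >>) : divisor c).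
Proof.
apply/is_divE; split=> [|v]; first exact: hy_neq0.
rewrite ord_hy raddf_sum /=; under eq_bigr do rewrite coeffB !coeffU1.
rewrite sumrB big_const_seq count_predT iter_addr addr0.
have [->|vi] := eqVneq v vinf.
  rewrite big_seq big1 ?sub0r ?natz // => a ar.
  by case: eqP => // E; case: (over_notinf (pt0_over ar)).
rewrite mul0rn subr0.
have ui : uniq [seq pt a 0 | a <- rs].
  rewrite map_inj_in_uniq ?hroots_uniq // => a a' ar a'r.
  exact: pt_inj (root_sqr ar) (root_sqr a'r).
rewrite -(big_map (fun a => pt a 0) predT (fun w => (w == v)%:R)) /=.
elim: [seq pt a 0 | a <- rs] ui => [|w l IHl] /=; first by rewrite big_nil.
case/andP=> wl ul; rewrite big_cons IHl // in_cons [v == w]eq_sym.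
by case: eqP wl => [<- /negPf ->|_ _] /=; rewrite ?addr0 ?add0r.
Qed.

(** The divisor of y is the sum of the divisors that define these classes. *)
Lemma sum_ecls : \sum_(a <- rs) ecls a = 0.
Proof. by rewrite -cls_sum; apply/cls_eq0; exists y; apply: div_hy. Qed.

(** If a is the value of h at infinity, h - a has no poles and a zero at
    infinity, against the vanishing of its degree. *)
Lemma unit_const h : h != 0 -> (forall v : place c, v h = 0) ->
  exists2 a, a != 0 & h = c a.
Proof.
move=> h0 hv; have [|a ha] := residue C (v := vinf) h0; first by rewrite hv.
have [E|nh] := eqVneq h (c a).
  by exists a => //; apply: contraNneq h0; rewrite E => ->; rewrite rmorph0.
have n0 : h - c a != 0 by rewrite subr_eq0.
have [l [ul H _]] := @covers_seq _ _ _ C [:: h - c a] [::].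
have cf : covers l (h - c a) by apply: H; rewrite mem_head.
have := degree_principal n0 ul cf; rewrite big_cons => /eqP.
rewrite gt_eqF //; apply: ltr_wpDr; last exact: val_idealP ha.
apply: sumr_ge0 => v _; apply: val_ringP n0 _.
by apply: val_ringD; [right; rewrite hv | apply/val_ringN/val_ringC].
Qed.

(** 1 + u works unless it vanishes, and then u = -1 is the ratio y / sigma y. *)
Lemma hilbert90 u : u != 0 -> u * s u = 1 -> exists2 w, w != 0 & w = u * s w.
Proof.
move=> u0 uu; have [u1|u1] := eqVneq (1 + u) 0.
  exists y; rewrite ?hy_neq0 // hsigy mulrN -mulNr.
  by move/eqP: u1; rewrite addr_eq0 => /eqP <-; rewrite mul1r.
by exists (1 + u); rewrite // rmorphD rmorph1 mulrDr mulr1 uu addrC.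
Qed.

Definition sigd D : divisor c := \sum_(v <- dom D) << coeff v D *g sigp v >>.

Lemma coeff_sigd D v : coeff v (sigd D) = coeff (sigp v) D.
Proof.
rewrite raddf_sum /=; under eq_bigr do rewrite coeffU.
have E w : (sigp w == v) = (w == sigp v).
  by apply/eqP/eqP => [<-|->]; rewrite sigpK.
under eq_bigr do rewrite E.
have [vd|vd] := boolP (sigp v \in dom D); last first.
  rewrite (coeff_outdom vd) big_seq big1 // => w wd.
  by case: eqP => [e|_]; [rewrite -e wd in vd | rewrite mulr0].
rewrite (bigD1_seq (sigp v)) ?uniq_dom //= eqxx mulr1 big1 ?addr0 // => w wv.
by rewrite (negPf wv) mulr0.
Qed.

Lemma clsU (k : int) v : cls << k *g v >> = cls << v >> *~ k.
Proof. by rewrite -clsMz freegU_mulz; congr (cls << _ *g _ >>); rewrite intz. Qed.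

Lemma cls_sumE D l : {subset dom D <= places_over l} -> uniq l ->
  cls D = \sum_(v <- places_over l) cls << v >> *~ coeff v D.
Proof.
move=> Dl ul; rewrite -{1}[D]freeg_sumE cls_sum; under eq_bigr do rewrite clsU.
apply: big_support; rewrite ?uniq_dom ?places_over_uniq // => v nv.
  by rewrite coeff_outdom ?mulr0z.
by rewrite coeff_outdom ?mulr0z //; apply: contra nv; apply: Dl.
Qed.

(** A divisor of degree 0 plus its conjugate is a combination of the divisors
    of the functions x - a. *)
Lemma cls_sigd D : deg D = 0 -> cls D + cls (sigd D) = 0.
Proof.
move=> dD; have -> : cls (sigd D) = \sum_(v <- dom D) cls << sigp v >> *~ coeff v D.
  by rewrite cls_sum; under eq_bigr do rewrite clsU.
rewrite -{1}[D]freeg_sumE cls_sum; under eq_bigr do rewrite clsU.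
rewrite -big_split /=; under eq_bigr do rewrite -mulrzDl cls_conj.
rewrite -mulrz_sumr -(@deg_sum _ _ _ D (dom D)) ?uniq_dom // dD mulr0z //.
Qed.

(** Since D and its conjugate have opposite classes and 2 D is principal, D -
    sigma D is the divisor of some u. The norm of u has no zeros or poles,
    hence is a constant, and after scaling u it is 1. Then u = w / sigma w,
    and D - div w is invariant. *)
Lemma invariant_rep D f : deg D = 0 -> is_div f (D *+ 2) ->
  exists D', [/\ cls D' = cls D, deg D' = 0 & forall v, coeff (sigp v) D' = coeff v D'].
Proof.
move=> dD fD; have := cls_sigd dD; rewrite -clsD => /cls_eq0[g gD].
have ud : is_div (f / g) (D *+ 2 - (D + sigd D)) by apply/is_divM/is_divV.
have /is_divE[u0 uv] := ud; set u := f / g in u0 uv; clear ud; clearbody u.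
have {}uv v : v u = coeff v D - coeff (sigp v) D.
  by rewrite -uv coeffB coeffD coeffMn coeff_sigd; lia.
have su0 : s u != 0 by rewrite hsig_eq0.
have [|v|a a0 ua] := @unit_const (u * s u); first by rewrite mulf_neq0.
  by rewrite ordM // -sigpE !uv sigpK; lia.
have [b ba] : exists b, b ^+ 2 = a.
  have [b] := @solve_monicpoly K 2 (fun i => if i is 0%N then a else 0) isT.
  by rewrite !big_ord_recl big_ord0 /= mul0r !addr0 expr0 mulr1; exists b.
have b0 : b != 0 by apply: contraNneq a0 => b0; rewrite -ba b0 expr0n.
have cb0 : c b != 0 by rewrite fmorph_eq0.
have [||w w0 wE] := @hilbert90 (u / c b).
- by rewrite mulf_neq0 ?invr_eq0.
- rewrite fmorph_div /= hsigC mulf_div ua -rmorphM -expr2 ba.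
  by rewrite mulfV // fmorph_eq0.
have [W /is_divE[_ Ww]] := div_ex w0.
have clW : cls W = 0 by apply/cls_eq0; exists w; apply/is_divE.
have sw0 : s w != 0 by rewrite hsig_eq0.
exists (D - W); split; first by rewrite clsB clW subr0.
  by rewrite degB dD (deg_principal (f := w)) ?subr0 //; apply/is_divE.
move=> v; rewrite !coeffB !Ww sigpE.
have e : v w = v u + v (s w).
  by rewrite {1}wE !ordM ?mulf_neq0 ?invr_eq0 // ord_inv ord_const // oppr0 addr0.
by rewrite e uv; lia.
Qed.

(** In an invariant divisor the two points of an unramified fibre occur with
    the same multiplicity, and their sum is equivalent to twice the point at
    infinity. Only the Weierstrass points with odd multiplicity remain. *)
Lemma invariant_cls D : deg D = 0 -> (forall v, coeff (sigp v) D = coeff v D) ->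
  exists S, [/\ uniq S, {subset S <= rs} & cls D = \sum_(a <- S) ecls a].
Proof.
move=> dD sD; have [l [ul _ Dl]] := @covers_seq _ _ _ C [::] (dom D).
pose S := [seq a <- l | (a \in rs) && odd `|coeff (pt a 0) D|%N].
exists S; split; first exact: filter_uniq.
  by move=> a; rewrite mem_filter => /andP[/andP[]].
have dD' : \sum_(v <- places_over l) coeff v D = 0.
  by rewrite -(deg_sum (places_over_uniq C ul) Dl).
transitivity (\sum_(v <- places_over l) (cls << v >> - cls << vinf >>) *~ coeff v D).
  rewrite (cls_sumE Dl ul); under [RHS]eq_bigr do rewrite mulrzBl.
  by rewrite sumrB -mulrz_sumr dD' mulr0z subr0.
rewrite big_places_over /= subrr mul0rz add0r big_filter [RHS]big_mkcond /=.
apply: eq_bigr => a _; rewrite /fibre; case: ifP => ar /=.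
  rewrite big_seq1 -clsB -/(ecls a); move: (coeff _ D) => n.
  have e2 := ecls2 ar.
  have eM k : ecls a *+ k = if odd k then ecls a else 0.
    rewrite -{1}(odd_double_half k) mulrnDr -mul2n mulrnA e2 mul0rn addr0.
    by case: odd.
  have eN : - ecls a = ecls a.
    by apply/eqP; rewrite eq_sym -addr_eq0 -mulr2n e2.
  case: n => n; rewrite -?pmulrn ?NegzE ?mulrNz -?pmulrn eM //.
  by rewrite abszN /=; case: odd; rewrite ?oppr0 //= eN.
rewrite big_cons big_seq1 sD -mulrzDl addrACA cls_conj mulr2n -opprD subrr mul0rz.
by [].
Qed.

Lemma Jac2_rep (j : Pic c) : Jac2 j ->
  exists S, [/\ uniq S, {subset S <= rs} & j = \sum_(a <- S) ecls a].
Proof.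
move=> [j2 [D dD jD]]; rewrite jD -clsMn in j2; have /cls_eq0[f fD] := j2.
have [D' [D'D dD' sD']] := invariant_rep dD fD.
by rewrite jD -D'D; apply: invariant_cls.
Qed.

End Divisors.

(** * The Weil pairing on 2-torsion classes *)

Section WeilPairing.

Variables (K : closedFieldType) (F : fieldType) (c : {rmorphism K -> F}).
Variable C : hyperelliptic c.

Local Notation x := (hx C).
Local Notation y := (hy C).
Local Notation s := (hsig C).
Local Notation rs := (hroots C).
Local Notation p := (hpoly C).
Local Notation vinf := (vinf C).
Local Notation pt := (pt C).
Local Notation sigp := (sigp C).
Local Notation covers := (covers C).
Local Notation places_over := (places_over C).
Local Notation fibre := (fibre C).
Local Notation ecls := (ecls C).
Local Notation "A .<x>" := (ev c x A) (at level 2, format "A .<x>").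
Local Notation cls := (@divisor_class K F c).

Implicit Types (v w : place c) (a b : K) (A B : {poly K}) (f g h : F).
Implicit Types (D E H : divisor c).

(** A pair (f, D) with div f = 2 D represents the 2-torsion class of D. *)
Definition half f D := is_div f (D *+ 2).

Lemma half_neq0 f D : half f D -> f != 0.
Proof. by move=> /is_divE[]. Qed.

Lemma half_ord f D v : half f D -> v f = coeff v D * 2.
Proof. by case/is_divE=> _ h; rewrite -h coeffMn; lia. Qed.

Lemma halfM f f' D D' : half f D -> half f' D' -> half (f * f') (D + D').
Proof. by move=> fD fD'; rewrite /half mulrnDl; apply: is_divM. Qed.

Lemma half_sqr h H : is_div h H -> half (h ^+ 2) H.
Proof. exact: is_divX. Qed.

Lemma half_const a : a != 0 -> half (c a) 0.
Proof.
move=> a0; apply/is_divE; rewrite fmorph_eq0 a0; split=> // v.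
by rewrite mul0rn coeff0 ord_const.
Qed.

(** The local factor at v of the Weil pairing. It makes sense at all places,
    common points of D and E included, because the powers of f and g have the
    same order there. *)
Definition gloc v D f E g : K := eval v (f ^ coeff v E / g ^ coeff v D).

Lemma vunit_gloc v D f E g : half f D -> half g E ->
  vunit v (f ^ coeff v E / g ^ coeff v D).
Proof.
move=> fD gE; have f0 := half_neq0 fD; have g0 := half_neq0 gE.
rewrite /vunit mulf_neq0 ?invr_eq0 ?expfz_neq0 //=.
rewrite ordM ?invr_eq0 ?expfz_neq0 // ord_inv !ordXz (half_ord v fD) (half_ord v gE).
by rewrite subr_eq0 mulrC mulrCA [X in _ == X]mulrC.
Qed.

Definition wprod l D f E g := \prod_(v <- places_over l) gloc v D f E g.

Lemma half_covers l f D v : half f D -> covers l f -> v \notin places_over l ->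
  coeff v D = 0.
Proof. by move=> fD cf /cf; rewrite (half_ord v fD); lia. Qed.

Lemma wprod_indep l l' D f E g : half f D -> half g E -> uniq l -> uniq l' ->
  covers l f -> covers l g -> covers l' f -> covers l' g ->
  wprod l D f E g = wprod l' D f E g.
Proof.
move=> fD gE ul ul' cf cg cf' cg'.
apply: big_support; rewrite ?places_over_uniq // => v nv; rewrite /gloc.
  by rewrite (half_covers fD cf nv) (half_covers gE cg nv) !expr0z divr1 eval1.
by rewrite (half_covers fD cf' nv) (half_covers gE cg' nv) !expr0z divr1 eval1.
Qed.

Definition common_cover (fs : seq F) : seq K := projT1 (cid (covers_seq C fs [::])).

Lemma common_coverP fs : uniq (common_cover fs) /\
  forall f, f \in fs -> covers (common_cover fs) f.
Proof. by rewrite /common_cover; case: cid => l [] /=. Qed.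

(** The pairing f(E) / g(D) extended to divisors with common points, by means
    of the local factors. *)
Definition wpair D f E g := wprod (common_cover [:: f; g]) D f E g.

Lemma wpairE l D f E g : half f D -> half g E -> uniq l ->
  covers l f -> covers l g -> wpair D f E g = wprod l D f E g.
Proof.
move=> fD gE ul cf cg; have [u h] := common_coverP [:: f; g].
by apply: wprod_indep => //; apply: h; rewrite !in_cons eqxx ?orbT.
Qed.

Lemma wpairD D D' E f f' g : half f D -> half f' D' -> half g E ->
  wpair (D + D') (f * f') E g = wpair D f E g * wpair D' f' E g.
Proof.
move=> fD fD' gE; have [u h] := common_coverP [:: f; f'; g].
set l := common_cover _ in u h.
have cf : covers l f by apply: h; rewrite !in_cons eqxx.
have cf' : covers l f' by apply: h; rewrite !in_cons eqxx orbT.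
have cg : covers l g by apply: h; rewrite !in_cons eqxx !orbT.
rewrite (wpairE (halfM fD fD') gE u (coversM cf cf') cg) (wpairE fD gE u cf cg).
rewrite (wpairE fD' gE u cf' cg) -big_split; apply: eq_bigr => v _ /=.
rewrite /gloc -(evalM C) ?vunit_gloc //; congr (eval v _).
by rewrite coeffD expfzDr ?(half_neq0 gE) // invfM expfzMl mulrACA.
Qed.

(** The value is a to the power deg E. *)
Lemma wpair_const a E g : a != 0 -> half g E -> deg E = 0 ->
  wpair 0 (c a) E g = 1.
Proof.
move=> a0 gE dE; have [u h] := common_coverP [:: c a; g].
set l := common_cover _ in u h.
have cf : covers l (c a) by apply: h; rewrite !in_cons eqxx.
have cg : covers l g by apply: h; rewrite !in_cons eqxx orbT.
rewrite (wpairE (half_const a0) gE u cf cg).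
transitivity (\prod_(v <- places_over l) a ^ coeff v E).
  apply: eq_bigr => v _; rewrite /gloc coeff0 expr0z divr1.
  by rewrite (evalXz C) ?evalC // /vunit fmorph_eq0 a0 ord_const.
have dE' : \sum_(v <- places_over l) coeff v E = 0.
  rewrite -(deg_sum (places_over_uniq C u)) // => v; rewrite mem_dom.
  by apply: contraR => nv; rewrite (half_covers gE cg nv).
move: dE'; move: (places_over l) => vs.
suff -> : \prod_(v <- vs) a ^ coeff v E = a ^ (\sum_(v <- vs) coeff v E).
  by move=> ->; rewrite expr0z.
elim: vs => [|v vs IH]; first by rewrite !big_nil expr0z.
by rewrite !big_cons IH expfzDr.
Qed.

(** The local factors are the tame symbols of h and g, because all orders of
    g are even. This is where Weil reciprocity makes the pairing independent
    of the representatives. *)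
Lemma wpair_principal h H E g : is_div h H -> half g E -> wpair H (h ^+ 2) E g = 1.
Proof.
move=> hH gE; have /is_divE[h0 hv] := hH; have g0 := half_neq0 gE.
have [u cv] := common_coverP [:: h; g].
set l := common_cover _ in u cv.
have ch : covers l h by apply: cv; rewrite !in_cons eqxx.
have cg : covers l g by apply: cv; rewrite !in_cons eqxx orbT.
have ch2 : covers l (h ^+ 2) by rewrite expr2; apply: coversM.
rewrite (wpairE (half_sqr hH) gE u ch2 cg) -(weil_reciprocity h0 g0 u ch cg).
apply: eq_bigr => v _; rewrite /tame (half_ord v gE) /gloc hv.
have -> : (-1) ^ (v h * (coeff v E * 2)) = 1 :> K.
  by rewrite mulrA -exprz_exp -[RHS](sgz_sqr K (v h * coeff v E)).
by rewrite mul1r; congr (eval v (_ / _)); rewrite mulrC -exprz_exp.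
Qed.

Lemma wpair_sym D E f g : half f D -> half g E ->
  wpair D f E g * wpair E g D f = 1.
Proof.
move=> fD gE; have [u h] := common_coverP [:: f; g].
set l := common_cover _ in u h.
have cf : covers l f by apply: h; rewrite !in_cons eqxx.
have cg : covers l g by apply: h; rewrite !in_cons eqxx orbT.
rewrite (wpairE fD gE u cf cg) (wpairE gE fD u cg cf) -big_split big1 // => v _ /=.
have ug := vunit_gloc v fD gE; have [_ e0] := vunitP C ug.
by rewrite /gloc -[g ^ _ / f ^ _]invf_div (evalV C ug) mulfV.
Qed.

Lemma wpair_self D f : half f D -> wpair D f D f = 1.
Proof.
move=> fD; rewrite /wpair /wprod big1 // => v _.
by rewrite /gloc mulfV ?eval1 // expfz_neq0 // (half_neq0 fD).
Qed.

Lemma wpair_sqr D f E g : half f D -> half g E -> wpair D f E g ^+ 2 = 1.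
Proof.
move=> fD gE; rewrite expr2 -wpairD // -expr2 -mulr2n.
exact: wpair_principal.
Qed.

(** If D1 = D + div h, then f1 is a constant multiple of f h^2. *)
Lemma wpair_cls D f D' f' E g : cls D = cls D' -> half f D -> half f' D' ->
  half g E -> deg E = 0 -> wpair D f E g = wpair D' f' E g.
Proof.
move/eqP; rewrite eq_sym -subr_eq0 -clsB => /eqP/cls_eq0[h hD] fD fD' gE dE.
have /is_divE[h0 hv] := hD; have f0 := half_neq0 fD; have f'0 := half_neq0 fD'.
have [||a a0 fa] := @unit_const _ _ _ C (f' / (f * h ^+ 2)).
- by rewrite mulf_neq0 ?invr_eq0 ?mulf_neq0 // expf_neq0.
- move=> v; rewrite ordM ?invr_eq0 ?mulf_neq0 ?expf_neq0 //.
  rewrite ord_inv ordM ?expf_neq0 // ordX (half_ord v fD) (half_ord v fD') -hv.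
  by rewrite coeffB; lia.
have -> : f' = f * (c a * h ^+ 2).
  by rewrite mulrCA -fa divfK // mulf_neq0 // expf_neq0.
have -> : D' = D + (0 + (D' - D)) by rewrite add0r addrC subrK.
have ca := half_const a0; have h2 := half_sqr hD.
rewrite (wpairD fD (halfM ca h2) gE) (wpairD ca h2 gE) wpair_const //.
by rewrite wpair_principal // !mulr1.
Qed.

Lemma wpair_clsr D f E g E' g' : cls E = cls E' -> half f D -> half g E ->
  half g' E' -> deg D = 0 -> wpair D f E g = wpair D f E' g'.
Proof.
move=> EE fD gE gE' dD; apply: (mulIf (x := wpair E g D f)).
  have := wpair_sym gE fD; apply: contra_eq_neq => ->.
  by rewrite mul0r eq_sym oner_neq0.
by rewrite wpair_sym // (wpair_cls EE gE gE' fD dD) wpair_sym.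
Qed.

(** At each place one of the two multiplicities is 0, and the local factor is
    the corresponding factor of f(E) or of 1 / g(D). *)
Lemma eval_div_wpair D f E g : half f D -> half g E -> disjoint_div D E ->
  eval_div f E / eval_div g D = wpair D f E g.
Proof.
move=> fD gE DE; have [u h] := common_coverP [:: f; g].
set l := common_cover _ in u h.
have cf : covers l f by apply: h; rewrite !in_cons eqxx.
have cg : covers l g by apply: h; rewrite !in_cons eqxx orbT.
have eE : eval_div f E = \prod_(v <- places_over l) eval v f ^ coeff v E.
  apply: big_support; rewrite ?uniq_dom ?places_over_uniq // => v nv.
    by rewrite coeff_outdom ?expr0z.
  by rewrite (half_covers gE cg nv) expr0z.
have eD : eval_div g D = \prod_(v <- places_over l) eval v g ^ coeff v D.
  apply: big_support; rewrite ?uniq_dom ?places_over_uniq // => v nv.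
    by rewrite coeff_outdom ?expr0z.
  by rewrite (half_covers fD cf nv) expr0z.
rewrite (wpairE fD gE u cf cg) eE eD -prodfV -big_split /=.
apply: eq_bigr => v _; rewrite /gloc; case: (DE v) => e; rewrite e !expr0z ?divr1 ?mul1r.
  have uf : vunit v f by rewrite /vunit (half_neq0 fD) (half_ord v fD) e mul0r.
  by rewrite (evalXz C).
have ug : vunit v g by rewrite /vunit (half_neq0 gE) (half_ord v gE) e mul0r.
by rewrite (evalV C) ?vunitXz // (evalXz C).
Qed.

(** The divisor of the product of the x - a, for a in S, is twice this
    divisor; see half_wdiv. *)
Definition wdiv (S : seq K) : divisor c := \sum_(a <- S) (<< pt a 0 >> - << vinf >>).

Lemma cls_wdiv S : cls (wdiv S) = \sum_(a <- S) ecls a.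
Proof. exact: cls_sum. Qed.

Lemma half_wdiv S : {subset S <= rs} ->
  half (\prod_(a <- S) ('X - a%:P)).<x> (wdiv S).
Proof.
elim: S => [|a S IHS] Sr; first by rewrite /wdiv !big_nil ev1 -(rmorph1 c); apply/half_const/oner_neq0.
rewrite /wdiv !big_cons evM ev_XsubC; apply: halfM.
  by apply: div_xr; apply: Sr; rewrite mem_head.
by apply: IHS => b bS; apply: Sr; rewrite in_cons bS orbT.
Qed.

Lemma coeff_wdiv_inf S : {subset S <= rs} -> coeff vinf (wdiv S) = - (size S)%:Z.
Proof.
move=> Sr; rewrite raddf_sum /=; under eq_bigr do rewrite coeffB !coeffU1 eqxx.
rewrite big_seq (eq_bigr (fun=> -1)) => [|a aS].
  by rewrite -big_seq big_const_seq count_predT iter_addr addr0 mulNrn natz.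
by case: eqP => // E; case: (over_notinf (pt0_over (Sr _ aS))).
Qed.

Lemma coeff_wdiv_pt S a : uniq S -> {subset S <= rs} -> a \in rs ->
  coeff (pt a 0) (wdiv S) = (a \in S)%:Z.
Proof.
move=> uS Sr ar; rewrite raddf_sum /=; under eq_bigr do rewrite coeffB !coeffU1.
have [aS|aS] := boolP (a \in S).
  rewrite (bigD1_seq a) //= eqxx big_seq_cond big1 ?addr0 => [|b /andP[bS ba]].
    by case: eqP => // E; case: (over_notinf (pt0_over ar)).
  case: eqP => [E|_].
    by rewrite (pt_inj (root_sqr (Sr _ bS)) (root_sqr ar) E) eqxx in ba.
  by case: eqP => // E; case: (over_notinf (pt0_over ar)).
rewrite big_seq big1 // => b bS.
case: eqP => [E|_].
  by rewrite -(pt_inj (root_sqr (Sr _ bS)) (root_sqr ar) E) bS in aS.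
by case: eqP => // E; case: (over_notinf (pt0_over ar)).
Qed.

Lemma coeff_wdiv_out S v : v <> vinf -> (forall a, a \in S -> v <> pt a 0) ->
  coeff v (wdiv S) = 0.
Proof.
move=> vi vS; rewrite raddf_sum /= big_seq big1 // => a aS.
rewrite coeffB !coeffU1; case: eqP => [E|_]; first by case: (vS a).
by case: eqP => // E; case: vi.
Qed.

(** Since the Weierstrass classes add up to 0 and are odd in number, S can be
    replaced by its complement. *)
Lemma Jac2_rep_even (j : Pic c) : Jac2 j -> exists S, [/\ uniq S,
  {subset S <= rs}, ~~ odd (size S) & j = \sum_(a <- S) ecls a].
Proof.
move=> /(Jac2_rep C)[S [uS Sr jS]]; have [oS|] := boolP (odd (size S)); last by exists S.
exists [seq a <- rs | a \notin S]; split.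
- by rewrite filter_uniq // hroots_uniq.
- by move=> a; rewrite mem_filter => /andP[].
- have sA : size [seq a <- rs | mem S a] = size S.
    apply/perm_size/uniq_perm; rewrite ?filter_uniq ?hroots_uniq // => a.
    by rewrite mem_filter /=; case aS: (a \in S); rewrite // Sr.
  have := count_predC (mem S) rs; rewrite -!size_filter sA => e.
  by have := hroots_odd C; rewrite -e oddD oS.
have := sum_ecls C; rewrite (bigID (mem S)) /= -big_filter => /eqP.
rewrite addr_eq0 -[X in _ == - X]big_filter => /eqP; have -> : \sum_(a <- [seq a <- rs | a \in S]) ecls a = j.
  rewrite jS; apply/perm_big/uniq_perm; rewrite ?filter_uniq ?hroots_uniq // => a.
  by rewrite mem_filter /=; case aS: (a \in S); rewrite // Sr.
move=> ->; apply/eqP; rewrite eq_sym -addr_eq0 -big_split big_seq big1 // => a.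
by rewrite mem_filter => /andP[_ ar]; rewrite /= -mulr2n ecls2.
Qed.

(** Two 2-torsion classes have disjoint representatives: the divisor of
    y + f_T moves away from the Weierstrass points, and a multiple of a generic
    fibre replaces the point at infinity. *)
Lemma disjoint_reps (j j' : Pic c) : Jac2 j -> Jac2 j' -> exists D E f g,
  [/\ j = cls D, j' = cls E & disjoint_div D E] /\ half f D /\ half g E.
Proof.
move=> /Jac2_rep_even[S [uS Sr eS jS]] /(Jac2_rep C)[T [uT Tr jT]].
pose fT := (\prod_(a <- T) ('X - a%:P)).<x>.
have fT2 := half_wdiv Tr; rewrite -/fT in fT2.
(* At the Weierstrass points y has order 1 and f_T has order 2 or 0. Hence div h
   agrees there with the divisor attached to T, and cancels it in E. *)
pose h := y + fT; have h0 : h != 0.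
  apply/eqP => e; have [] := @hinj _ _ _ C (\prod_(a <- T) ('X - a%:P)) 1.
    by rewrite ev1 mul1r addrC.
  by move=> _ /eqP; rewrite oner_eq0.
have [H hH] := div_ex C h0; have /is_divE[_ hv] := hH.
pose E := H - wdiv T; have gE : half (h ^+ 2 / fT) E.
  rewrite /half /E mulrnBl; apply: is_divM; first exact: is_divX.
  exact: is_divV.
have clH : cls H = 0 by apply/cls_eq0; exists h.
have clE : cls E = j'.
  rewrite clsB clH sub0r cls_wdiv -jT; apply/eqP.
  rewrite eq_sym -addr_eq0 jT -big_split big_seq big1 // => a aT /=.
  by rewrite -mulr2n ecls2 // Tr.
have E_pt a : a \in rs -> coeff (pt a 0) E = 0.
  move=> ar; rewrite coeffB hv coeff_wdiv_pt //.
  have va := pt0_over ar; have [_ yM] := pt_at (root_sqr ar).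
  rewrite rmorph0 subr0 in yM; have fT0 := half_neq0 fT2.
  case: (boolP (a \in T)) => aT.
    have vy := pt0_y ar; have vf : pt a 0 fT = 2.
      by rewrite (half_ord _ fT2) coeff_wdiv_pt // aT.
    have := ordD (pt a 0) (hy_neq0 C) fT0 h0; rewrite vy vf => h1.
    have := @ordD _ _ _ (pt a 0) h (- fT) h0; rewrite oppr_eq0 addrK.
    move/(_ fT0 (hy_neq0 C)); rewrite ordN vy vf ge_min => /orP[h2|] //.
    have {}h1 : 1 <= pt a 0 h by exact: h1.
    by apply/eqP; rewrite subr_eq0 eq_le h1 h2.
  have fa : (\prod_(b <- T) ('X - b%:P)).[a] != 0.
    by rewrite -[_ == 0]/(root _ a) root_prod_XsubC.
  have [_ ->] : h != 0 /\ pt a 0 h = 0.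
    apply: (ord_unit fa); rewrite /h -addrA; apply: val_idealD => //.
    exact: val_horner.
  by rewrite subr0.
have [l [ul cl _]] := @covers_seq _ _ _ C [:: h] [::].
have ch : covers l h by apply: cl; rewrite mem_head.
have [a0 a0n] : exists a0, a0 \notin l ++ rs.
  have /closed_nonrootP[a0] : \prod_(b <- l ++ rs) ('X - b%:P) != 0 :> {poly K}.
    by rewrite monic_neq0 // monic_prod_XsubC.
  by rewrite root_prod_XsubC; exists a0.
have /negP a0l : a0 \notin l by apply: contra a0n; rewrite mem_cat => ->.
have /negP a0r : a0 \notin rs by apply: contra a0n; rewrite mem_cat orbC => ->.
have E_over v : val_ideal v (x - c a0) -> coeff v E = 0.
  move=> va; have vi := over_notinf va.
  rewrite coeffB hv ch; last first.
    apply/negP => /mem_places_over[//|[b bl vb]].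
    by rewrite (over_uniq va vb) in a0l.
  rewrite coeff_wdiv_out ?subrr // => a aT Ev.
  by case: a0r; rewrite (over_uniq va (a' := a)) ?Tr // Ev; apply/pt0_over/Tr.
(* S has even size, so the order of k at infinity is minus the size of S. *)
pose k := (x - c a0) ^+ (size S)./2.
have k0 : k != 0 by rewrite expf_neq0 // hx_subC_neq0.
have [M kM] := div_ex C k0; have /is_divE[_ kv] := kM.
have fD : half ((\prod_(a <- S) ('X - a%:P)).<x> / k ^+ 2) (wdiv S - M).
  rewrite /half mulrnBl; apply: is_divM; first exact: half_wdiv.
  by apply/is_divV/is_divX.
exists (wdiv S - M), E, ((\prod_(a <- S) ('X - a%:P)).<x> / k ^+ 2), (h ^+ 2 / fT).
have clM : cls M = 0 by apply/cls_eq0; exists k.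
split; last by split.
split; rewrite ?clE //; first by rewrite clsB clM subr0 cls_wdiv.
move=> v; have [->|vi] := EM (v = vinf).
  left; rewrite coeffB coeff_wdiv_inf // kv ordX vinf_xC.
  by have := odd_double_half (size S); rewrite (negPf eS); lia.
have [va|va] := EM (val_ideal v (x - c a0)); first by right; apply: E_over.
have [[a aS ->]|nS] := EM (exists2 a, a \in S & v = pt a 0).
  by right; apply/E_pt/Sr.
left; rewrite coeffB coeff_wdiv_out // ?kv ?ordX; last first.
  by move=> a aS Ev; apply: nS; exists a.
have [b vb] := over_ex vi; rewrite (over_neq vb) ?mul0rn ?subrr //.
by apply/eqP => ba; apply: va; rewrite -ba.
Qed.

(** The definition of the pairing requires disjoint representatives; these
    exist and compute the same value as any others. *)
Lemma weil2_wpair D f E g : half f D -> half g E -> deg D = 0 -> deg E = 0 ->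
  weil2 (cls D) (cls E) = wpair D f E g.
Proof.
move=> fD gE dD dE; rewrite /weil2; set P := (X in xget 0 X).
have PE z : P z -> z = wpair D f E g.
  move=> [D' [E' [f' [g' [[DD EE dis] [fD' gE' ->]]]]]].
  rewrite eval_div_wpair //.
  have dD' : deg D' = 0 by rewrite -(deg_cls C DD).
  rewrite (wpair_cls DD fD fD' gE dE).
  by rewrite (wpair_clsr EE fD' gE gE' dD').
apply: PE; apply: xgetPex.
have jD : Jac2 (cls D).
  by split; [rewrite -clsMn; apply/cls_eq0; exists f | exists D].
have jE : Jac2 (cls E).
  by split; [rewrite -clsMn; apply/cls_eq0; exists g | exists E].
have [D' [E' [f' [g' [dis [fD' gE']]]]]] := disjoint_reps jD jE.
by exists (eval_div f' E' / eval_div g' D'), D', E', f', g'.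
Qed.

Lemma Jac2_half (j : Pic c) : Jac2 j -> exists D f,
  [/\ j = cls D, deg D = 0 & half f D].
Proof.
by move=> [j2 [D dD jD]]; rewrite jD -clsMn in j2; have /cls_eq0[f fD] := j2; exists D, f.
Qed.

Lemma weil2Dl (i j k : Pic c) : Jac2 i -> Jac2 j -> Jac2 k ->
  weil2 (i + j) k = weil2 i k * weil2 j k.
Proof.
move=> /Jac2_half[D [f [-> dD fD]]] /Jac2_half[E [g [-> dE gE]]].
move=> /Jac2_half[H [h [-> dH hH]]]; rewrite -clsD.
rewrite (weil2_wpair fD hH) // (weil2_wpair gE hH) //.
by rewrite (weil2_wpair (halfM fD gE) hH) ?wpairD // degD dD dE.
Qed.

Lemma weil2_sqr (i j : Pic c) : Jac2 i -> Jac2 j -> weil2 i j ^+ 2 = 1.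
Proof.
move=> /Jac2_half[D [f [-> dD fD]]] /Jac2_half[E [g [-> dE gE]]].
by rewrite (weil2_wpair fD gE) // wpair_sqr.
Qed.

Lemma weil2_sym (i j : Pic c) : Jac2 i -> Jac2 j -> weil2 i j = weil2 j i.
Proof.
move=> ji jj; have e := weil2_sqr ji jj; move: ji jj e.
move=> /Jac2_half[D [f [-> dD fD]]] /Jac2_half[E [g [-> dE gE]]].
rewrite (weil2_wpair fD gE) // (weil2_wpair gE fD) // => e.
have := wpair_sym fD gE; rewrite -{}e expr2 => /esym; apply: mulfI.
by apply/eqP => e0; have := wpair_sym fD gE; rewrite e0 mul0r => /esym/eqP; rewrite oner_eq0.
Qed.

Lemma weil2_self (i : Pic c) : Jac2 i -> weil2 i i = 1.
Proof.
by move=> /Jac2_half[D [f [-> dD fD]]]; rewrite (weil2_wpair fD fD) // wpair_self.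
Qed.

(** The functions are x - a and x - b. The local factors at the two
    Weierstrass points are the inverse of a - b and b - a, and at infinity
    the factor is 1. *)
Lemma weil2_ecls a b : a \in rs -> b \in rs -> a != b ->
  weil2 (ecls a) (ecls b) = -1.
Proof.
move=> ar br ab; have fD := div_xr ar; have gE := div_xr br.
have cov r l : r \in l -> covers l (x - c r).
  move=> rl v nv; have [e|vi] := EM (v = vinf).
    by case/negP: nv; apply/mem_places_over; left.
  have [b' vb] := over_ex vi; apply: (over_neq vb).
  apply: contraNneq nv => e; apply/mem_places_over; right; exists r => //.
  by rewrite -e.
have ul : uniq [:: a; b] by rewrite /= in_cons in_nil orbF ab.
have dpt r : deg (<< pt r 0 >> - << vinf >>) = 0 by rewrite degB !degU subrr.
rewrite (weil2_wpair fD gE) // (wpairE fD gE ul); last first.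
- by apply: cov; rewrite !in_cons eqxx orbT.
- by apply: cov; rewrite mem_head.
rewrite /wprod big_places_over !big_cons big_nil /= /fibre ar br !big_seq1 mulr1.
have pa := pt0_over ar; have pb := pt0_over br.
have ia := over_notinf pa; have ib := over_notinf pb.
have pab : pt a 0 <> pt b 0.
  by move=> E; case/eqP: ab; apply: pt_inj E; apply: root_sqr.
rewrite /gloc !coeffB !coeffU1 !eqxx.
have nia : (pt a 0 == vinf) = false by apply/eqP.
have nib : (pt b 0 == vinf) = false by apply/eqP.
have nai : (vinf == pt a 0) = false by rewrite eq_sym.
have nbi : (vinf == pt b 0) = false by rewrite eq_sym.
have nab : (pt a 0 == pt b 0) = false by apply/eqP.
have nba : (pt b 0 == pt a 0) = false by rewrite eq_sym.
rewrite nia nib nai nbi nab nba /= !subr0 sub0r !expr0z !expr1z divr1 mul1r.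
have xa := hx_subC_neq0 C a; have xb := hx_subC_neq0 C b.
have -> : (x - c a) ^ (-1) / (x - c b) ^ (-1) = ('X - b%:P).<x> / (x - c a) ^+ (size ('X - b%:P)%R).-1.
  by rewrite size_XsubC expr1 ev_XsubC -!invr_expz !expr1z invrK mulrC.
have [_ ->] := eval_inf C a (negbT (polyXsubC_eq0 b)).
rewrite lead_coefXsubC mul1r.
have [u1 e1] : vunit (pt a 0) (x - c b) /\ eval (pt a 0) (x - c b) = a - b.
  apply: eval_ideal; first by rewrite subr_eq0.
  suff -> : x - c b - c (a - b) = x - c a by [].
  by rewrite rmorphB; ring.
have [u2 e2] : vunit (pt b 0) (x - c a) /\ eval (pt b 0) (x - c a) = b - a.
  apply: eval_ideal; first by rewrite subr_eq0 eq_sym.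
  suff -> : x - c a - c (b - a) = x - c b by [].
  by rewrite rmorphB; ring.
by rewrite (evalV C u1) e1 e2 -(opprB a b) mulrN mulVf // subr_eq0.
Qed.

End WeilPairing.

(** * The function field of a hyperelliptic equation *)

Section FunctionField.

Variables (K : closedFieldType) (p : {poly K}).
Hypotheses (two_neq0 : 2%:R != 0 :> K).
Hypotheses (p_sep : separable_poly p) (p_gt1 : (1 < size p)%N).

Fact funfield_field_axiom : GRing.field_axiom (funfield p).
Proof. by move=> f nf; rewrite funfield_unitE. Qed.

(** The field structure on the function field, which is constructed as a unit
    ring. *)
Definition ff : fieldType := HB.pack (funfield p)
  (GRing.ComUnitRing_isField.Build (funfield p) funfield_field_axiom).

Local Notation c := (const_funfield p : {rmorphism K -> ff}).
Local Notation h := (hyperell_eq p).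
Local Notation tofrac := (@FracField.tofrac {poly K}).

(** The inclusion of K(x). *)
Definition ffE (r : {fraction {poly K}}) : ff := in_qpoly h r%:P.

Fact ffE_zmod : zmod_morphism ffE.
Proof. by move=> r r'; rewrite /ffE polyCB rmorphB. Qed.

Fact ffE_monoid : monoid_morphism ffE.
Proof.
by split=> [|r r']; rewrite /ffE; [apply: in_qpoly1 | rewrite polyCM rmorphM].
Qed.

HB.instance Definition _ :=
  GRing.isZmodMorphism.Build {fraction {poly K}} ff ffE ffE_zmod.
HB.instance Definition _ :=
  GRing.isMonoidMorphism.Build {fraction {poly K}} ff ffE ffE_monoid.

Definition ffx : ff := ffE (tofrac 'X).
Definition ffy : ff := in_qpoly h 'X.

Lemma ffE_const a : c a = ffE (tofrac a%:P).
Proof. by rewrite -[LHS]in_qpolyK; congr in_qpoly. Qed.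

Lemma ffE_ev A : ffE (tofrac A) = ev c ffx A.
Proof.
elim/poly_ind: A => [|A a IHA]; first by rewrite ev0 -[RHS](rmorph0 ffE) tofrac0.
by rewrite !evE -IHA ffE_const /ffx -rmorphM -rmorphD tofracD tofracM.
Qed.

Lemma in_qpoly_h : in_qpoly h h = 0 :> ff.
Proof.
apply: val_inj; rewrite /= mk_monic_hyperell_eq.
have hM : h \is monic by rewrite -mk_monic_hyperell_eq monic_mk_monic.
by rewrite -Pdiv.IdomainMonic.modpE // modpp.
Qed.

Lemma ffy2 : ffy ^+ 2 = ev c ffx p.
Proof.
rewrite -ffE_ev -[RHS]add0r -in_qpoly_h /ffy /ffE -rmorphXn -rmorphD /=.
by rewrite /hyperell_eq subrK.
Qed.

Lemma ff_decomp (f : ff) : exists r r', f = ffE r + ffE r' * ffy.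
Proof.
exists (f : {poly _})`_0, (f : {poly _})`_1.
rewrite /ffE /ffy -rmorphM -rmorphD /= -[LHS]in_qpolyK; congr in_qpoly.
have : (size (f : {poly _}) < 3)%N.
  by rewrite -[X in (_ < X)%N](size_hyperell_eq p) -{2}mk_monic_hyperell_eq size_mk_monic.
move: (f : {poly _}) => q sq; apply/polyP => i; rewrite coefD coefC coefMX coefC.
case: i => [|[|i]] //=; rewrite ?addr0 ?add0r // nth_default //.
by apply: leq_trans (_ : size q <= 2)%N _.
Qed.

(** The hyperelliptic involution, which substitutes - y for y. *)
Definition ffs (f : ff) : ff := in_qpoly h ((f : {poly _}) \Po (- 'X)).

Lemma h_comp : h \Po (- 'X) = h.
Proof. by rewrite /hyperell_eq comp_polyB comp_polyC rmorphXn /= comp_polyX sqrrN. Qed.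

Lemma ffs_in q : ffs (in_qpoly h q) = in_qpoly h (q \Po (- 'X)).
Proof.
have hM : h \is monic by rewrite -mk_monic_hyperell_eq monic_mk_monic.
rewrite /ffs /= mk_monic_hyperell_eq {2}(Pdiv.RingMonic.rdivp_eq hM q).
rewrite comp_polyD comp_polyM h_comp rmorphD rmorphM /=.
by rewrite (in_qpoly_h : in_qpoly h h = 0 :> funfield p) mulr0 add0r.
Qed.

Fact ffs_zmod : zmod_morphism ffs.
Proof.
move=> f g; rewrite -[f]in_qpolyK -[g]in_qpolyK -[in_qpoly _ _ - _]rmorphB.
by rewrite !ffs_in comp_polyB rmorphB.
Qed.

Fact ffs_monoid : monoid_morphism ffs.
Proof.
split=> [|f g].
  by rewrite -[1](in_qpoly1 h) ffs_in comp_polyC.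
rewrite -[f]in_qpolyK -[g]in_qpolyK -[in_qpoly _ _ * _]rmorphM.
by rewrite !ffs_in comp_polyM rmorphM.
Qed.

HB.instance Definition _ := GRing.isZmodMorphism.Build ff ff ffs ffs_zmod.
HB.instance Definition _ := GRing.isMonoidMorphism.Build ff ff ffs ffs_monoid.

Lemma ffs_E r : ffs (ffE r) = ffE r.
Proof. by rewrite ffs_in comp_polyC. Qed.

Lemma ffs_const a : ffs (c a) = c a.
Proof. by rewrite ffE_const; apply: ffs_E. Qed.

Lemma ffs_x : ffs ffx = ffx.
Proof. exact: ffs_E. Qed.

Lemma ffs_y : ffs ffy = - ffy.
Proof. by rewrite ffs_in comp_polyX rmorphN. Qed.

Lemma ffs_fixed (u w : ff) : ffs u = u -> ffs w = w ->
  ffs (u + w * ffy) = u - w * ffy.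
Proof.
move=> su sw; have fD := ffs_zmod; have [_ fM] := ffs_monoid.
have f0 : ffs 0 = 0 by rewrite -[0 in LHS](subrr u) fD subrr.
have fN f : ffs (- f) = - ffs f by rewrite -[- f]sub0r fD f0 sub0r.
by rewrite -[w * _]opprK fD fN fM su sw ffs_y mulrN.
Qed.

Lemma ffs_decomp r r' : ffs (ffE r + ffE r' * ffy) = ffE r - ffE r' * ffy.
Proof. by apply: ffs_fixed; apply: ffs_E. Qed.

Lemma ffsK : involutive ffs.
Proof.
move=> f; have [r [r' ->]] := ff_decomp f; rewrite ffs_decomp -mulNr.
rewrite ffs_fixed ?mulNr ?opprK //; first exact: ffs_E.
have fN := ffs_zmod 0 (ffE r'); rewrite !sub0r in fN.
have f0 := ffs_zmod 0 0; rewrite !subrr in f0.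
by rewrite fN f0 ffs_E sub0r.
Qed.

Lemma ffx_neqC a : ffx != c a.
Proof.
rewrite ffE_const (inj_eq (fmorph_inj ffE)) tofrac_eq.
by rewrite -subr_eq0 polyXsubC_eq0.
Qed.

Lemma ffy_neq0 : ffy != 0.
Proof.
have np := separable_poly_neq0 p_sep.
have : ffy ^+ 2 != 0 by rewrite ffy2 -ffE_ev fmorph_eq0 tofrac_eq0.
by rewrite expf_eq0.
Qed.

Lemma ffs_fix f : ffs f = f -> ratl c ffx f.
Proof.
have [r [r' ->]] := ff_decomp f; rewrite ffs_decomp.
have h (R : pzRingType) (u w : R) : u - w = u + w -> 2%:R * w = 0.
  by move/addrI => e; rewrite mulr_natl mulr2n -{1}e addNr.
move/h/eqP.
rewrite mulf_eq0 mulf_eq0 (negPf ffy_neq0) orbF -(rmorph_nat c) fmorph_eq0.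
rewrite (negPf two_neq0) => /eqP ->; rewrite mul0r addr0 (frac_numden r) fmorph_div.
exists \n_(repr r), \d_(repr r); rewrite -!ffE_ev; split=> //.
by rewrite fmorph_eq0 tofrac_eq0; apply: denom_ratioP.
Qed.

End FunctionField.

(** * Models ramified at infinity *)

Section Model.

Variables (K : closedFieldType) (F : fieldType) (c : {rmorphism K -> F}).
Variables (s : {rmorphism F -> F}) (x0 y0 : F) (p : {poly K}).
Hypothesis two_neq0 : 2%:R != 0 :> K.
Hypothesis sK : involutive s.
Hypothesis sc : forall a, s (c a) = c a.
Hypothesis sx : s x0 = x0.
Hypothesis sy : s y0 = - y0.
Hypothesis xC : forall a, x0 != c a.
Hypothesis s_fix : forall f, s f = f -> ratl c x0 f.
Hypothesis y2 : y0 ^+ 2 = ev c x0 p.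
Hypothesis p_sep : separable_poly p.
Hypothesis p_gt1 : (1 < size p)%N.

Implicit Types (q : {poly K}) (v : place c).

Definition root_seq (q : {poly K}) : seq K := sval (closed_field_poly_normal q).

Lemma root_seqE q : q = lead_coef q *: \prod_(z <- root_seq q) ('X - z%:P).
Proof. by rewrite /root_seq; case: closed_field_poly_normal. Qed.

Lemma mem_root_seq q z : q != 0 -> (z \in root_seq q) = root q z.
Proof.
move=> q0; rewrite [in RHS](root_seqE q) rootZ ?lead_coef_eq0 //.
by rewrite root_prod_XsubC.
Qed.

Lemma size_root_seq q : q != 0 -> size q = (size (root_seq q)).+1.
Proof.
by move=> q0; rewrite {1}(root_seqE q) size_scale ?lead_coef_eq0 // size_prod_XsubC.
Qed.

Lemma root_seq_uniq q : separable_poly q -> uniq (root_seq q).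
Proof.
move=> qs; have q0 := separable_poly_neq0 qs.
rewrite -separable_prod_XsubC; move: qs; rewrite {1}(root_seqE q).
by rewrite (eqp_separable (eqp_scale _ _)) // lead_coef_eq0.
Qed.

(** The branch points of the curve y^2 = q(x) on the projective line. None is
    the point at infinity, which is one of them when the degree is odd, that
    is, when size q is even. *)
Definition branch (q : {poly K}) : seq (option K) :=
  (if odd (size q) then [::] else [:: None]) ++ map Some (root_seq q).

Lemma mem_branch q b : q != 0 -> (b \in branch q) =
  if b is Some z then root q z else ~~ odd (size q).
Proof.
move=> q0; rewrite mem_cat; case: b => [z|].
  rewrite (mem_map Some_inj) mem_root_seq //.
  by case: ifP; rewrite ?in_nil // in_cons in_nil.
have -> : (None \in [seq Some i | i <- root_seq q]) = false.
  by apply/negP => /mapP[].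
by case: ifP => //.
Qed.

Lemma branch_uniq q : separable_poly q -> uniq (branch q).
Proof.
move=> qs; rewrite cat_uniq (map_inj_uniq Some_inj) root_seq_uniq // andbT.
apply/andP; split; first by case: ifP.
by apply/hasPn => b /mapP[z _ ->]; case: ifP; rewrite ?in_nil // in_cons in_nil.
Qed.

Lemma size_branch q : q != 0 -> size (branch q) = (size q).-1 + ~~ odd (size q).
Proof.
move=> q0; rewrite size_cat size_map addnC (size_root_seq q0) /=.
by case: (odd _).
Qed.

Definition over (v : place c) (b : option K) : Prop :=
  if b is Some a then val_ideal v (x0 - c a) else val_ideal v x0^-1.

Let sqrtK (a : K) : exists b, b ^+ 2 = a.
Proof.
have [b] := @solve_monicpoly K 2 (fun i => if i is 0%N then a else 0) isT.
by rewrite !big_ord_recl big_ord0 /= mul0r !addr0 expr0 mulr1; exists b.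
Qed.

(** C presents the same function field with the branch point b0 moved to
    infinity, and the other branch points t moved to phi t. *)
Let is_model (C : hyperelliptic c) b0 (ts : seq K) (phi : K -> K) :=
  [/\ perm_eq (branch p) (b0 :: map Some ts), hroots C = map phi ts,
      (forall v, over v b0 <-> v = vinf C)
    & forall t, t \in ts -> forall v, over v (Some t) <-> v = pt C (phi t) 0].

(** It is enough to divide y by a square root of the leading coefficient. *)
Lemma odd_model : ~~ odd (size p) -> exists C b0 ts phi, is_model C b0 ts phi.
Proof.
move=> sp; have p0 := separable_poly_neq0 p_sep.
have d0 : lead_coef p != 0 by rewrite lead_coef_eq0.
have [b bE] := sqrtK (lead_coef p).
have b0 : b != 0 by apply: contraNneq d0 => b0; rewrite -bE b0 expr0n.
have cb0 : c b != 0 by rewrite fmorph_eq0.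
have sy' : s (y0 / c b) = - (y0 / c b) by rewrite fmorph_div sy /= sc mulNr.
have y2' : (y0 / c b) ^+ 2 = ev c x0 (\prod_(r <- root_seq p) ('X - r%:P)).
  rewrite expr_div_n y2 {1}(root_seqE p) evZ -rmorphXn bE mulrC mulKf //.
  by rewrite fmorph_eq0.
have odr : odd (size (root_seq p)).
  by move: sp; rewrite (size_root_seq p0) /= negbK.
pose C := Hyperelliptic two_neq0 sK sc sx sy' xC s_fix y2' (root_seq_uniq p_sep) odr.
exists C, None, (root_seq p), id; split.
- by rewrite /branch (negPf sp).
- by rewrite map_id.
- by move=> v; split=> [/(@vinf_uniq _ _ _ C)//|->]; apply: (vinf_at C).
move=> t tp v; have h := @fibreP _ _ _ C t v; split=> [/h|E].
  by rewrite /fibre /= tp mem_seq1 => /eqP.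
by apply/h; rewrite /fibre /= tp mem_seq1 E.
Qed.

(** A root a of p is moved to infinity by 1 / (x - a), and y is divided by a
    power of x - a and by a constant. *)
Lemma even_model : odd (size p) -> exists C b0 ts phi, is_model C b0 ts phi.
Proof.
move=> sp; have p0 := separable_poly_neq0 p_sep.
have d0 : lead_coef p != 0 by rewrite lead_coef_eq0.
have := root_seqE p; have := root_seq_uniq p_sep; have := size_root_seq p0.
case rE : (root_seq p) => [|a ts] szp /= uts pE.
  by have := p_gt1; rewrite szp.
move/andP: uts => [ats uts].
have odt : odd (size ts) by rewrite szp /= negbK in sp.
have ta t : t \in ts -> t - a != 0.
  by move=> tts; rewrite subr_eq0; apply: contraNneq ats => <-.
pose phi t := (t - a)^-1.
pose lam := lead_coef p * \prod_(t <- ts) (a - t).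
have lam0 : lam != 0.
  rewrite mulf_neq0 // prodf_seq_neq0; apply/allP => t tts.
  by rewrite /= -opprB oppr_eq0 ta.
have [b bE] := sqrtK lam.
have b0 : b != 0 by apply: contraNneq lam0 => b0; rewrite -bE b0 expr0n.
have cb0 : c b != 0 by rewrite fmorph_eq0.
pose x := (x0 - c a)^-1; have x00 : x0 - c a != 0 by rewrite subr_eq0 xC.
have x_neq0 : x != 0 by rewrite invr_eq0.
pose g := (size ts)./2; have sts : size ts = (g * 2).+1.
  by rewrite muln2 -add1n -[LHS]odd_double_half odt.
pose y := y0 * x ^+ g.+1 / c b.
have sx' : s x = x by rewrite fmorphV rmorphB sx /= sc.
have sy' : s y = - y.
  by rewrite fmorph_div rmorphM rmorphXn /= sy sx' sc !mulNr.
have xC' e : x != c e.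
  apply: contraTneq (xC (e^-1 + a)) => xe.
  by rewrite -subr_eq0 rmorphD opprD addrCA addrC fmorphV -xe invrK subrr eqxx.
have fixx f : s f = f -> ratl c x f.
  move=> /s_fix; apply: ratl_trans; rewrite -[x0](subrK (c a)) -[x0 - c a]invrK.
  by apply: ratlD (ratlC _ _ _); apply/ratlV/ratl_id.
have y2' : y ^+ 2 = ev c x (\prod_(r <- map phi ts) ('X - r%:P)).
  have key : \prod_(t <- ts) ((x0 - c t) * x) =
      c (\prod_(t <- ts) (a - t)) * ev c x (\prod_(r <- map phi ts) ('X - r%:P)).
    rewrite big_map ev_prod rmorph_prod -big_split /=.
    rewrite big_seq [RHS]big_seq; apply: eq_bigr => t tts.
    have ct : c (t - a) != 0 by rewrite fmorph_eq0 ta.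
    rewrite !evE /phi fmorphV /x -[a - t]opprB rmorphN rmorphB in ct *.
    by field; rewrite ct.
  have xx : x ^+ g.+1 ^+ 2 = x * \prod_(t <- ts) x.
    have -> : \prod_(t <- ts) x = x ^+ size ts.
      by elim: (ts) => [|t l IH]; rewrite ?big_nil ?expr0 // big_cons IH exprS.
    by rewrite -exprM mulSn add2n sts -exprS.
  have -> : y ^+ 2 = ev c x0 p * x ^+ g.+1 ^+ 2 / c lam.
    by rewrite expr_div_n exprMn y2 -rmorphXn bE.
  rewrite pE evZ ev_prod big_cons !evE xx.
  have -> : c (lead_coef p) * ((x0 - c a) * \prod_(j <- ts) ev c x0 ('X - j%:P)) *
     (x * \prod_(t <- ts) x) = c (lead_coef p) * \prod_(t <- ts) ((x0 - c t) * x).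
    rewrite -mulrA; congr (_ * _); rewrite mulrACA mulfV // mul1r -big_split /=.
    by apply: eq_bigr => t _; rewrite !evE.
  rewrite key mulrA -rmorphM -/lam mulrAC mulfV ?mul1r // fmorph_eq0 //.
have uphi : uniq (map phi ts).
  by rewrite map_inj_uniq // => t t' /invr_inj /addIr.
have oph : odd (size (map phi ts)) by rewrite size_map.
pose C := Hyperelliptic two_neq0 sK sc sx' sy' xC' fixx y2' uphi oph.
exists C, (Some a), ts, phi; split=> //.
- by rewrite /branch sp rE.
- move=> v; split=> [va|->].
    by apply: vinf_uniq; rewrite /at_inf /xinf /= invrK.
  by have := vinf_at C; rewrite /at_inf /xinf /= invrK.
move=> t tts v; have h := @fibreP _ _ _ C (phi t) v.
have ptE : v \in fibre C (phi t) <-> v = pt C (phi t) 0.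
  rewrite /fibre /= (map_f phi tts) mem_seq1; split=> [/eqP//|->].
  exact: eqxx.
have ct : c (t - a) != 0 by rewrite fmorph_eq0 ta.
have [h1 h2] := ptE; split=> [vt|E].
  apply/h1/h; rewrite /= /x /phi fmorphV.
  have -> : (x0 - c a)^-1 - (c (t - a))^-1 = - (x0 - c t) * ((x0 - c a)^-1 * (c (t - a))^-1).
    by move: ct; rewrite rmorphB => ct; field; rewrite ct.
  apply: val_idealMr; first exact: val_idealN.
  have [_ va] : x0 - c a != 0 /\ v (x0 - c a) = 0.
    apply: (ord_unit (ta _ tts)); rewrite rmorphB opprB addrA subrK //.
  by right; rewrite ordM ?invr_eq0 // !ord_inv va ord_const ?ta.
have := h2 E => /h; rewrite /= => vt.
have pt0 : phi t != 0 by rewrite invr_eq0 ta.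
have [_ vx] := ord_unit pt0 vt.
have -> : x0 - c t = (x - c (phi t)) * (- c (t - a) * x^-1).
  by move: ct; rewrite /phi fmorphV /x invrK rmorphB => ct; field; rewrite ct.
apply: val_idealMr => //; apply: val_ringM; first exact/val_ringN/val_ringC.
by right; rewrite ord_inv vx.
Qed.

Lemma model : exists C b0 ts phi, is_model C b0 ts phi.
Proof. by case: (boolP (odd (size p))); [apply: even_model | apply: odd_model]. Qed.

End Model.

(** * 2-torsion in terms of branch points *)

(** The structure of the 2-torsion V of a Jacobian with its pairing e. The
    elements d i j are differences of Weierstrass points, indexed by the
    branch points bs. For at most 6 branch points every nonzero element is of
    this form, which is tt_gen. *)
Record two_torsion (K : fieldType) (A : zmodType) (T : eqType) (V : set A)
    (e : A -> A -> K) (bs : seq T) (d : T -> T -> A) : Prop := TwoTorsion {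
  tt_uniq : uniq bs;
  tt_0 : V 0;
  tt_D : forall a b, V a -> V b -> V (a + b);
  tt_2 : forall a, V a -> a + a = 0;
  tt_M : forall a b j, V a -> V b -> V j -> e (a + b) j = e a j * e b j;
  tt_sym : forall a b, V a -> V b -> e a b = e b a;
  tt_self : forall a, V a -> e a a = 1;
  tt_sqr : forall a b, V a -> V b -> e a b ^+ 2 = 1;
  tt_d : forall i j, i \in bs -> j \in bs -> V (d i j);
  tt_dii : forall i, d i i = 0;
  tt_dD : forall i j k, d i j + d j k = d i k;
  tt_gen : forall a, V a -> a = 0 \/
    exists i j, [/\ i \in bs, j \in bs, i != j & a = d i j];
  tt_pair : forall i j k, i \in bs -> j \in bs -> k \in bs ->
    uniq [:: i; j; k] -> e (d i j) (d i k) = -1;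
  tt_rel : exists2 i, i \in bs & \sum_(j <- bs) d j i = 0
}.

Section Weierstrass.

Variables (K : closedFieldType) (F : fieldType) (c : {rmorphism K -> F}).
Variables (s : {rmorphism F -> F}) (x0 y0 : F) (p : {poly K}).
Hypothesis two_neq0 : 2%:R != 0 :> K.
Hypothesis sK : involutive s.
Hypothesis sc : forall a, s (c a) = c a.
Hypothesis sx : s x0 = x0.
Hypothesis sy : s y0 = - y0.
Hypothesis xC : forall a, x0 != c a.
Hypothesis s_fix : forall f, s f = f -> ratl c x0 f.
Hypothesis y2 : y0 ^+ 2 = ev c x0 p.
Hypothesis p_sep : separable_poly p.
Hypothesis p_size : size (branch p) = 4%N \/ size (branch p) = 6%N.

Local Notation cls := (@divisor_class K F c).

(** In a model with b0 at infinity, a 2-torsion class is a sum of an even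
    number of classes eps t = [w_t - w_b0]. With at most five of them, the
    sum is empty, has two terms, or has four terms, and is then the remaining
    eps t by the relation sum_ecls. The values of the pairing follow by
    bilinearity from those on the eps t. *)
Lemma weierstrass : exists w : option K -> place c,
  (forall b, b \in branch p -> forall v : place c, over x0 v b <-> v = w b) /\
  two_torsion (@Jac2 K F c) (@weil2 K F c) (branch p)
    (fun i j => cls (<< w i >> - << w j >>)).
Proof.
have p_gt1 : (1 < size p)%N.
  rewrite ltnNge; apply/negP => sp; have := size_branch (separable_poly_neq0 p_sep).
  have := separable_poly_neq0 p_sep; rewrite -size_poly_gt0.
  by case: (size p) sp => [|[|//]] //= _ _; case: p_size => ->.
have [C [b0 [ts [phi [br rs_ts inf_b0 pt_t]]]]] :=
  model two_neq0 sK sc sx sy xC s_fix y2 p_sep p_gt1.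
have ubr := branch_uniq p_sep.
pose w b := if b == b0 then vinf C else
  if b is Some t then pt C (phi t) 0 else vinf C.
have mem_br b : (b \in branch p) = (b == b0) || (b \in map Some ts).
  by rewrite (perm_mem br) in_cons.
have u_bts : uniq (b0 :: map Some ts) by rewrite -(perm_uniq br).
have brP b : b \in branch p -> b = b0 \/ exists t,
    [/\ b = Some t, t \in ts, b != b0 & w b = pt C (phi t) 0].
  rewrite mem_br => /orP[/eqP|/mapP[t tts ->]]; [by left|right].
  have nb : (Some t == b0) = false.
    apply: contraTF u_bts => /eqP <-; rewrite cons_uniq (mem_map Some_inj) tts.
    by [].
  by exists t; rewrite nb /w nb.
have phi_r t : t \in ts -> phi t \in hroots C.
  by move=> tts; rewrite rs_ts; apply: map_f.
have phi_inj t t' : t \in ts -> t' \in ts -> phi t = phi t' -> t = t'.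
  move=> tts t'ts E; have h1 : over x0 (pt C (phi t) 0) (Some t) by apply/pt_t.
  have h2 : over x0 (pt C (phi t) 0) (Some t') by apply/pt_t; rewrite ?E.
  apply/eqP; rewrite -subr_eq0; apply/eqP/(@val_idealC _ _ c (pt C (phi t) 0)).
  suff -> : c (t - t') = x0 - c t' - (x0 - c t) by apply: val_idealB.
  by rewrite rmorphB; ring.
exists w; split.
  move=> b /brP[->|[t [-> tts nb wt]]] v; first by rewrite /w eqxx; apply: inf_b0.
  by rewrite wt; apply: pt_t.
pose eps b := cls (<< w b >> - << vinf C >>).
have w0 : w b0 = vinf C by rewrite /w eqxx.
have eps0 : eps b0 = 0 by rewrite /eps w0 subrr cls0.
have epsE b : b \in branch p -> b = b0 \/
    exists t, [/\ b = Some t, t \in ts, b != b0 & eps b = ecls C (phi t)].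
  move/brP=> [|[t [-> tts nb wt]]]; [by left|right].
  by exists t; rewrite /eps wt.
have ecls_eps t : t \in ts -> ecls C (phi t) = eps (Some t) /\ Some t \in branch p.
  move=> tts; have tb : Some t \in branch p by rewrite mem_br (mem_map Some_inj) tts orbT.
  split=> //; have [E|[t' [[->] _ _ ->]]] := epsE _ tb; last by [].
  by move: u_bts; rewrite -E cons_uniq (mem_map Some_inj) tts.
have J0 : Jac2 (0 : Pic c) by split; [rewrite mul0rn|exists 0; rewrite ?deg0 ?cls0].
have JD (a b : Pic c) : Jac2 a -> Jac2 b -> Jac2 (a + b).
  move=> [a2 [D dD aD]] [b2 [E dE bE]]; split; first by rewrite mulrnDl a2 b2 addr0.
  by exists (D + E); rewrite ?degD ?dD ?dE // clsD aD bE.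
have J2 (a : Pic c) : Jac2 a -> a + a = 0 by case; rewrite mulr2n.
have JN (a : Pic c) : Jac2 a -> - a = a.
  by move=> /J2 aa; apply/eqP; rewrite eq_sym -addr_eq0 aa.
have Je b : b \in branch p -> Jac2 (eps b).
  move=> /epsE[->|[t [_ tts _ ->]]]; first by rewrite eps0.
  exact/ecls_Jac2/phi_r.
have dE i j : cls (<< w i >> - << w j >>) = eps i - eps j.
  by rewrite /eps -clsB opprB addrA subrK.
have dE' i j : j \in branch p -> cls (<< w i >> - << w j >>) = eps i + eps j.
  by move=> /Je/JN e; rewrite dE -{2}e.
have W0 (a : Pic c) : Jac2 a -> weil2 0 a = 1.
  move=> Ja; have := weil2Dl C J0 J0 Ja; rewrite addr0.
  by rewrite -expr2 (weil2_sqr C J0 Ja).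
have W i k : i \in branch p -> k \in branch p -> weil2 (eps i) (eps k) =
    if [|| i == b0, k == b0 | i == k] then 1 else -1.
  move=> ib kb; have [->|ni] /= := eqVneq i b0; first by rewrite eps0 W0 //; apply: Je.
  have [->|nk] /= := eqVneq k b0.
    by rewrite eps0 (weil2_sym C) ?W0 //; apply: Je.
  have [->|nik] := eqVneq i k; first by rewrite (weil2_self C) //; apply: Je.
  have [E|[t [it tts _ ->]]] := epsE _ ib; first by rewrite E eqxx in ni.
  have [E|[t' [kt t'ts _ ->]]] := epsE _ kb; first by rewrite E eqxx in nk.
  rewrite (weil2_ecls) ?phi_r //; apply: contra nik => /eqP E.
  by rewrite it kt (phi_inj _ _ tts t'ts E).
have tsz : size ts = 3%N \/ size ts = 5%N.
  by case: p_size; rewrite (perm_size br) /= size_map => -[->]; [left|right].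
split=> //.
- exact: weil2Dl.
- exact: weil2_sym.
- exact: weil2_self.
- exact: weil2_sqr.
- by move=> i j ib jb; rewrite dE' //; apply: JD; apply: Je.
- by move=> i; rewrite subrr cls0.
- by move=> i j k; rewrite -clsD addrA subrK.
- move=> a /(Jac2_rep_even C)[S [uS Sr eS aS]].
  have Sts r : r \in S -> exists t, [/\ r = phi t, t \in ts, ecls C r = eps (Some t)
      & Some t \in branch p].
    move=> /Sr; rewrite rs_ts => /mapP[t tts ->]; exists t.
    by have [-> ->] := ecls_eps _ tts.
  have Ssz : (size S <= size ts)%N.
    by rewrite -(size_map phi) -rs_ts; apply: uniq_leq_size.
  have b0b : b0 \in branch p by rewrite mem_br eqxx.
  case: S uS Sr eS aS Sts Ssz => [|r1 [|r2 [|r3 [|r4 [|r5 S]]]]] //= uS Sr eS aS Sts Ssz.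
  + by left; rewrite aS big_nil.
  + right; have [|t1 [e1 t1s E1 b1]] := Sts r1; first by rewrite mem_head.
    have [|t2 [e2 t2s E2 b2]] := Sts r2; first by rewrite !in_cons eqxx orbT.
    exists (Some t1), (Some t2); split=> //.
      apply: contraTneq uS => -[t12]; rewrite e1 e2 t12 in_cons eqxx.
      by [].
    by rewrite aS !big_cons big_nil addr0 E1 E2 dE'.
  + right; pose S4 := [:: r1; r2; r3; r4].
    have uS4 : uniq S4 by [].
    have rsz : size (hroots C) = 5%N.
      by rewrite rs_ts size_map; case: tsz => e //; rewrite e in Ssz.
    have [r rr] : exists r, perm_eq (hroots C) (r :: S4).
      have S4r : {subset S4 <= hroots C} by [].
      have [r rh] : exists r, r \in [seq r <- hroots C | r \notin S4].
        case E : [seq r <- hroots C | r \notin S4] => [|r l]; last first.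
          by exists r; rewrite mem_head.
        have : {subset hroots C <= S4}.
          move=> z zr; apply/negPn/negP => zS.
          by have : z \in [seq r <- hroots C | r \notin S4]; [rewrite mem_filter zS|rewrite E].
        by move/(uniq_leq_size (hroots_uniq C)); rewrite rsz.
      move: rh; rewrite mem_filter => /andP[rS rh]; exists r.
      have ur : uniq (r :: S4) by rewrite cons_uniq rS.
      have sub : {subset r :: S4 <= hroots C}.
        by move=> z; rewrite in_cons => /orP[/eqP->|/S4r].
      rewrite perm_sym; apply: uniq_perm; rewrite ?hroots_uniq //.
      by have [|_ e] := uniq_min_size ur sub; [rewrite rsz | exact: e].
    have rts : r \in map phi ts by rewrite -rs_ts (perm_mem rr) mem_head.
    move/mapP: rts => [t tts rt]; have [Et tb] := ecls_eps _ tts.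
    exists (Some t), b0; split=> //.
      have [E|[t' [_ _ nb _]]] := epsE _ tb; last exact: nb.
      by move: u_bts; rewrite -E cons_uniq (mem_map Some_inj) tts.
    rewrite dE' // eps0 addr0 -Et -rt.
    have e : ecls C r + a = 0.
      by rewrite -(sum_ecls C) (perm_big _ rr) [RHS]big_cons aS.
    have Jr : Jac2 (ecls C r) by rewrite rt; apply/ecls_Jac2/phi_r.
    by move/eqP: e; rewrite addrC addr_eq0 JN // => /eqP.
  + by move: Ssz eS; case: tsz => -> //; rewrite !ltnS leqn0 => /eqP ->.
- move=> i j k ib jb kb; rewrite /= !in_cons !in_nil !orbF negb_or andbT.
  move=> /andP[/andP[ij ik] jk]; rewrite !dE' //.
  have Ji := Je _ ib; have Jj := Je _ jb; have Jk := Je _ kb.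
  have Jik : Jac2 (eps i + eps k) by apply: JD.
  rewrite (weil2Dl C) // (weil2_sym C Ji) // (weil2_sym C Jj) // !(weil2Dl C) //.
  rewrite !W // !eqxx [k == i]eq_sym [k == j]eq_sym.
  rewrite (negPf ij) (negPf ik) (negPf jk) !orbT !orbF.
  have : ~~ ((i == b0) && (j == b0)) by apply: contra ij => /andP[/eqP -> /eqP ->].
  have : ~~ ((i == b0) && (k == b0)) by apply: contra ik => /andP[/eqP -> /eqP ->].
  have : ~~ ((j == b0) && (k == b0)) by apply: contra jk => /andP[/eqP -> /eqP ->].
  case: (i == b0); case: (j == b0); case: (k == b0) => //= _ _ _;
  by rewrite ?mulrN ?mulNr ?mulr1 ?mul1r ?opprK.
exists b0; first by rewrite mem_br eqxx.
rewrite (perm_big _ br) big_cons big_map /= subrr cls0 add0r.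
rewrite -[RHS](sum_ecls C) rs_ts big_map big_seq [RHS]big_seq.
apply: eq_bigr => t tts; have [-> _] := ecls_eps _ tts.
by rewrite dE eps0 subr0.
Qed.

End Weierstrass.

(** * Galois action on the 2-torsion *)

Section TransportClasses.

Variables (K : closedFieldType) (F : fieldType) (c : {rmorphism K -> F}).
Variables (s s' : {rmorphism K -> K}) (t t' : {rmorphism F -> F}).
Hypotheses (tK : cancel t t') (t'K : cancel t' t).
Hypothesis tc : forall a, t (c a) = c (s a).
Hypothesis t'c : forall a, t' (c a) = c (s' a).

Local Notation tp := (transport_place tK t'K t'c).
Local Notation tp' := (transport_place t'K tK tc).
Local Notation td := (transport_div tK t'K t'c).
Local Notation cls := (@divisor_class K F c).

Lemma transport_placeK v : tp' (tp v) = v.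
Proof. by apply: place_eq => f /=; rewrite tK. Qed.

Lemma transport_placeKV v : tp (tp' v) = v.
Proof. by apply: place_eq => f /=; rewrite t'K. Qed.

Lemma transport_divE D :
  td D = \sum_(v <- dom D) << coeff v D *g tp v >>.
Proof.
rewrite -{1}[D]freeg_sumE /transport_div.
have fgB := @lift_is_additive int (place c) _ (fun v => << tp v >> : divisor c).
have fg0 : fglift (fun v => << tp v >> : divisor c) 0 = 0.
  by rewrite -[0 in LHS](subrr 0) fgB subrr.
have fgD x y : fglift (fun v => << tp v >> : divisor c) (x + y) =
    fglift (fun v => << tp v >>) x + fglift (fun v => << tp v >>) y.
  by rewrite -{1}[y]opprK -{1}[- y]sub0r !fgB fg0 sub0r opprK.
rewrite (big_morph _ fgD fg0); apply: eq_bigr => v _; rewrite liftU.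
apply/eqP/freeg_eqP => w; rewrite coeffZ !coeffU mul1r.
by [].
Qed.

Lemma coeff_transport D v : coeff v (td D) = coeff (tp' v) D.
Proof.
rewrite transport_divE raddf_sum /=; under eq_bigr do rewrite coeffU.
have E w : (tp w == v) = (w == tp' v).
  by apply/eqP/eqP => [<-|->]; rewrite ?transport_placeK ?transport_placeKV.
under eq_bigr do rewrite E.
have [vd|vd] := boolP (tp' v \in dom D); last first.
  rewrite (coeff_outdom vd) big_seq big1 // => w wd.
  by case: eqP => [e|_]; [rewrite -e wd in vd | rewrite mulr0].
rewrite (bigD1_seq (tp' v)) ?uniq_dom //= eqxx mulr1 big1 ?addr0 // => w wv.
by rewrite (negPf wv) mulr0.
Qed.

Lemma transport_divB D E : td (D - E) = td D - td E.
Proof. by apply/eqP/freeg_eqP => v; rewrite coeffB !coeff_transport coeffB. Qed.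

Lemma transport_divU v : td << v >> = << tp v >>.
Proof.
apply/eqP/freeg_eqP => w; rewrite coeff_transport !coeffU1.
congr (_%:R); congr nat_of_bool; apply/eqP/eqP => [->|<-].
  by rewrite transport_placeKV.
by rewrite transport_placeK.
Qed.

Lemma transport_cls D : transport_Pic tK t'K t'c (cls D) = cls (td D).
Proof.
apply/eqP; rewrite /transport_Pic -subr_eq0 -clsB -transport_divB.
have : cls (repr (cls D) - D) = 0.
  by rewrite clsB /divisor_class reprK subrr.
move=> /cls_eq0[f /is_divE[f0 fD]]; apply/eqP/cls_eq0; exists (t f).
apply/is_divE; split=> [|v]; first by rewrite fmorph_eq0.
by rewrite coeff_transport fD.
Qed.

Lemma transport_cls_diff v w : transport_Pic tK t'K t'c (cls (<< v >> - << w >>)) =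
  cls (<< tp v >> - << tp w >>).
Proof. by rewrite transport_cls transport_divB !transport_divU. Qed.

End TransportClasses.

Section CurveTorsion.

Variables (k : fieldType) (K : closedFieldType) (iota : {rmorphism k -> K}).
Variable q : {poly k}.
Hypothesis two_neq0 : 2%:R != 0 :> K.
Hypothesis q_sep : separable_poly q.
Hypothesis q_size : size q \in [:: 4%N; 5; 6; 7].

Local Notation p := (map_poly iota q).
Local Notation c := (const_funfield p).

Lemma p_sep : separable_poly p. Proof. by rewrite separable_map. Qed.

Lemma size_branch_q : size (branch p) = 4%N \/ size (branch p) = 6%N.
Proof.
have p0 := separable_poly_neq0 p_sep; rewrite (size_branch p0) size_map_poly.
by move: q_size; rewrite !in_cons in_nil orbF => /or4P[] /eqP ->; auto.
Qed.

Lemma p_gt1 : (1 < size p)%N.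
Proof.
by rewrite size_map_poly; move: q_size; rewrite !in_cons in_nil orbF => /or4P[] /eqP ->.
Qed.

Lemma omap_gal_branch (s : galois_aut iota) b :
  b \in branch p -> omap s b \in branch p.
Proof.
have p0 := separable_poly_neq0 p_sep; rewrite !mem_branch //.
case: b => //= z; rewrite /root => /eqP pz; rewrite -[p in p.[_]](gal_poly s).
by rewrite horner_map pz rmorph0.
Qed.

(** An automorphism of K carries the Weierstrass point over b to the one over
    its image, because the latter is the only place there. *)
Lemma curve_torsion : exists d : option K -> option K -> JacPic iota q,
  two_torsion (@tors2 k K iota q) (@weil k K iota q) (branch p) d /\
  forall (s : galois_aut iota) i j, i \in branch p -> j \in branch p ->
    gal_Pic s (d i j) = d (omap s i) (omap s j).
Proof.
pose F := ff p_sep p_gt1; pose x : F := ffx p_sep p_gt1.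
have [w [wP tt]] := @weierstrass K F c (@ffs K p p_sep p_gt1) x (ffy p_sep p_gt1)
  p two_neq0 (@ffsK K p p_sep p_gt1) (@ffs_const K p p_sep p_gt1)
  (@ffs_x K p p_sep p_gt1) (@ffs_y K p p_sep p_gt1) (@ffx_neqC K p p_sep p_gt1)
  (@ffs_fix K p two_neq0 p_sep p_gt1) (@ffy2 K p p_sep p_gt1) p_sep size_branch_q.
exists (fun i j => @divisor_class K F c (<< w i >> - << w j >>)); split; first exact: tt.
move=> s i j ib jb.
pose t : {rmorphism F -> F} := funfield_rmorph (gal_poly s q).
pose t' : {rmorphism F -> F} := funfield_rmorph (gal_inv_poly s q).
pose tK : cancel t t' := funfield_mapK (gal_inv_poly s q) (Defs.galK s) (gal_invK s).
pose t'K : cancel t' t := funfield_mapK (gal_poly s q) (gal_invK s) (Defs.galK s).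
have tc a : t (c a) = c (s a) := funfield_map_const (gal_poly s q) a.
pose t'c : forall a, t' (c a) = c (Defs.gal_inv s a) :=
  funfield_map_const (gal_inv_poly s q).
have := @transport_cls_diff K F c s (Defs.gal_inv s) t t' tK t'K tc t'c (w i) (w j).
have tw b : b \in branch p -> transport_place tK t'K t'c (w b) = w (omap s b).
  move=> bb; have h := (wP _ bb (w b)).2 erefl.
  apply/(wP _ (omap_gal_branch s bb)).
  have t'x : t' x = x.
    rewrite /t' /= /x /ffx /ffE funfield_map_in ?gal_inv_poly // map_polyC /=.
    by rewrite rat_map_tofrac map_polyX.
  have vt f : val_ideal (w b) (t' f) -> val_ideal (transport_place tK t'K t'c (w b)) f.
    by case=> [/eqP|]; [rewrite fmorph_eq0 => /eqP; left | right].
  move: (w b) h vt => v; case: b bb => [a|] bb /= h vt; apply: vt.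
    have e : t' (x - c (s a)) = x - c a.
      by rewrite (rmorphB t') t'x t'c Defs.galK.
    by have := h; rewrite -e.
  have e : t' x^-1 = x^-1 by rewrite (fmorphV t') t'x.
  by have := h; rewrite -{1}e.
by rewrite !tw // => <-.
Qed.

End CurveTorsion.

(** * Extension of homomorphisms *)

Section HomExtension.

Variables (k L : fieldType) (K : closedFieldType).
Variables (i : {rmorphism k -> L}) (j : {rmorphism k -> K}).
Hypothesis alg : forall a : L, algebraicOver i a.

(** The graph of a homomorphism to K from a subring of L containing k. *)
Definition partial_hom (G : set (L * K)) : Prop :=
  [/\ forall a, G (i a, j a),
      forall a b a' b', G (a, b) -> G (a', b') -> G (a - a', b - b'),
      forall a b a' b', G (a, b) -> G (a', b') -> G (a * a', b * b')
    & forall b, G (0, b) -> b = 0].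

Section OnePartialHom.

Variable G : set (L * K).
Hypothesis Ghom : partial_hom G.

Let Gk a : G (i a, j a). Proof. by case: Ghom. Qed.
Let GB a b a' b' : G (a, b) -> G (a', b') -> G (a - a', b - b').
Proof. by case: Ghom => _ h _ _; apply: h. Qed.
Let GM a b a' b' : G (a, b) -> G (a', b') -> G (a * a', b * b').
Proof. by case: Ghom => _ _ h _; apply: h. Qed.
Let G0 b : G (0, b) -> b = 0. Proof. by case: Ghom => _ _ _; apply. Qed.
Let G00 : G (0, 0). Proof. by have := Gk 0; rewrite !rmorph0. Qed.
Let G11 : G (1, 1). Proof. by have := Gk 1; rewrite !rmorph1. Qed.
Let GD a b a' b' : G (a, b) -> G (a', b') -> G (a + a', b + b').
Proof.
by move=> h h'; have := GB h (GB G00 h'); rewrite !sub0r !opprK.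
Qed.

Lemma partial_hom_fun a b b' : G (a, b) -> G (a, b') -> b = b'.
Proof.
by move=> h h'; have := GB h h'; rewrite subrr => /G0/eqP; rewrite subr_eq0 => /eqP.
Qed.

Lemma partial_hom_horner (R : {poly k}) a b : G (a, b) ->
  G ((map_poly i R).[a], (map_poly j R).[b]).
Proof.
move=> ab; elim/poly_ind: R => [|R r IHR]; first by rewrite !rmorph0 !horner0.
rewrite !rmorphD !rmorphM /= !map_polyX !map_polyC /= !hornerMXaddC.
by apply: GD => //; apply: GM.
Qed.

(** A polynomial vanishing at a can be divided by powers of the variable
    until its constant term is nonzero; its other terms then give a multiple
    of a that is a nonzero constant. *)
Lemma alg_inverse a : a != 0 -> exists R : {poly k}, a * (map_poly i R).[a] = 1.
Proof.
move=> a0; have [q q0 qa] := alg a.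
have [m [q1 q10 qE]] := multiplicity_XsubC q 0; rewrite q0 /= in q10.
rewrite polyC0 subr0 in qE.
have qa1 : (map_poly i q1).[a] = 0.
  move: qa; rewrite /root qE rmorphM /= map_polyXn.
  rewrite hornerM hornerXn mulf_eq0 expf_eq0 (negPf a0) andbF orbF.
  by move/eqP.
have [q2 q2E] : exists q2, q1 - (q1.[0])%:P = q2 * ('X - 0%:P).
  by apply/factor_theorem; rewrite /root hornerD hornerN hornerC subrr.
exists (- (q1.[0])^-1 *: q2); rewrite polyC0 subr0 in q2E.
have e : (map_poly i q2).[a] * a = - i q1.[0].
  have := congr1 (fun r => (map_poly i r).[a]) q2E.
  rewrite rmorphB rmorphM /= map_polyX map_polyC hornerMX => <-.
  by rewrite hornerD hornerN hornerC qa1 sub0r.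
rewrite map_polyZ hornerZ mulrCA [a * _]mulrC e mulrN rmorphN mulNr opprK.
by rewrite -rmorphM mulVf ?rmorph1.
Qed.

Lemma partial_homV a b : a != 0 -> G (a, b) -> G (a^-1, b^-1) /\ b != 0.
Proof.
move=> a0 ab; have [R aR] := alg_inverse a0; have h := partial_hom_horner R ab.
have e : b * (map_poly j R).[b] = 1.
  by apply: (@partial_hom_fun 1) => //; rewrite -aR; apply: GM.
have b0 : b != 0.
  by apply/eqP => b0; move/eqP: e; rewrite b0 mul0r eq_sym oner_eq0.
split=> //; move: h; rewrite -[X in G (X, _)](mulKf a0) aR mulr1.
by rewrite -[X in G (_, X)](mulKf b0) e mulr1.
Qed.

Definition gpoly (P : {poly L}) (Q : {poly K}) := forall n, G (P`_n, Q`_n).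

Lemma gpolyC a b : G (a, b) -> gpoly a%:P b%:P.
Proof. by move=> ab n; rewrite !coefC; case: eqP. Qed.

Lemma gpolyX : gpoly 'X 'X.
Proof. by move=> n; rewrite !coefX; case: eqP. Qed.

Lemma gpolyB P Q P' Q' : gpoly P Q -> gpoly P' Q' -> gpoly (P - P') (Q - Q').
Proof. by move=> h h' n; rewrite !coefB; apply: GB. Qed.

Lemma gpolyM P Q P' Q' : gpoly P Q -> gpoly P' Q' -> gpoly (P * P') (Q * Q').
Proof.
move=> h h' n; rewrite !coefM; elim/big_ind2: _ => //; last by move=> m _; apply: GM.
by move=> *; apply: GD.
Qed.

Lemma gpoly_size P Q : gpoly P Q -> (size Q <= size P)%N.
Proof.
move=> h; apply/leq_sizeP => n Pn; have := h n.
by rewrite nth_default // => /G0.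
Qed.

(** If some a is missed, the homomorphism extends to it. Among the nonzero
    polynomials over the domain that vanish at a, one of least degree is made
    monic, and b is a root of its image. Euclidean division shows that the
    image of every polynomial vanishing at a vanishes at b. *)
Lemma partial_hom_maximal :
  (forall G', (G `<` G')%classic -> ~ partial_hom G') ->
  forall a, exists b, G (a, b).
Proof.
move=> Gmax a; apply: contrapT => nGa.
have exP : exists n, `[< exists P Q, [/\ gpoly P Q, P != 0, root P a & size P = n] >].
  have [q q0 qa] := alg a; exists (size (map_poly i q)); apply/asboolP.
  exists (map_poly i q), (map_poly j q); split=> //; last by rewrite map_poly_eq0.
  by move=> n; rewrite !coef_map; apply: Gk.
case: (ex_minnP exP) => n /asboolP[P1 [Q1 [PQ1 P10 P1a szP1]]] nmin.
have l0 : lead_coef P1 != 0 by rewrite lead_coef_eq0.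
have [hl m0] := partial_homV l0 (PQ1 (size P1).-1).
set m := Q1`_(size P1).-1 in hl m0.
pose P0 := (lead_coef P1)^-1%:P * P1; pose Q0 := m^-1%:P * Q1.
have PQ0 : gpoly P0 Q0 by apply: gpolyM => //; apply: gpolyC.
have szP0 : size P0 = n by rewrite /P0 mul_polyC size_scale ?invr_eq0.
have lP0 : lead_coef P0 = 1.
  by rewrite /P0 mul_polyC lead_coefZ mulVf.
have P0a : root P0 a by rewrite /P0 mul_polyC rootZ ?invr_eq0.
have n0 : P0 != 0 by rewrite -lead_coef_eq0 lP0 oner_neq0.
have n1 : (1 < n)%N by rewrite -szP0; apply: root_size_gt1 P0a.
have Q0n : Q0`_n.-1 = 1.
  by rewrite /Q0 mul_polyC coefZ -szP1 -/m mulVf.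
have szQ0 : size Q0 = n.
  apply/eqP; rewrite eqn_leq -{1}szP0 gpoly_size //=.
  rewrite leqNgt; apply/negP => h.
  have : Q0`_n.-1 = 0 by apply: nth_default; case: (n) n1 h.
  by rewrite Q0n => /eqP; rewrite oner_eq0.
have [b Q0b] : exists b, root Q0 b.
  by apply/closed_rootP; rewrite szQ0; case: (n) n1 => [|[]].
have key N (P : {poly L}) (Q : {poly K}) : (size P <= N)%N -> gpoly P Q -> P.[a] = 0 -> Q.[b] = 0.
  elim: N P Q => [|N IHN] P Q.
    rewrite leqn0 size_poly_eq0 => /eqP -> h _.
    suff -> : Q = 0 by rewrite horner0.
    by apply/polyP => l; have := h l; rewrite !coef0 => /G0.
  move=> sP h Pa; have [szP|szP] := ltnP (size P) n.
    have P00 : P = 0.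
      apply/eqP/negPn/negP => nP; have : (n <= size P)%N.
        by apply: nmin; apply/asboolP; exists P, Q; split=> //; apply/eqP.
      by rewrite leqNgt szP.
    suff -> : Q = 0 by rewrite horner0.
    by apply/polyP => l; have := h l; rewrite P00 !coef0 => /G0.
  pose d := (size P - n)%N; pose l := lead_coef P; pose l' := Q`_(size P).-1.
  pose S := l%:P * 'X ^+ d; pose S' := l'%:P * 'X ^+ d.
  have SS : gpoly S S'.
    apply: gpolyM; first by apply: gpolyC; apply: h.
    by move=> e; rewrite !coefXn; case: eqP.
  have hR : gpoly (P - S * P0) (Q - S' * Q0) by apply: gpolyB => //; apply: gpolyM.
  have P0' : P != 0 by rewrite -size_poly_gt0 (leq_trans _ szP) // ltnW.
  have sR : (size (P - S * P0)%R <= N)%N.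
    have lS : lead_coef (S * P0) = lead_coef P.
      by rewrite lead_coefM lP0 mulr1 /S mul_polyC lead_coefZ lead_coefXn mulr1.
    have sS : size (S * P0)%R = size P.
      rewrite -mulrA mul_polyC size_scale ?lead_coef_eq0 // mulrC.
      by rewrite size_mulXn // szP0 subnK.
    apply: (@leq_trans (size P).-1); last by case: (size P) sP.
    apply/leq_sizeP => e; rewrite leq_eqVlt coefB => /orP[/eqP <-|ee].
      by rewrite -{2}sS -!lead_coefE lS subrr.
    have {}ee : (size P <= e)%N by case: (size P) ee.
    by rewrite !nth_default ?sS // subrr.
  have := IHN _ _ sR hR; rewrite !hornerD !hornerN (hornerM S) (hornerM S') Pa.
  by rewrite (eqP P0a) (eqP Q0b) !mulr0 !subr0; apply.
pose G' := [set u : L * K | exists P Q, gpoly P Q /\ u = (P.[a], Q.[b])]%classic.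
apply: (Gmax G').
  split; last first.
    move=> sub; apply: nGa; exists b; apply: sub; exists 'X, 'X.
    by split; [exact: gpolyX | rewrite !hornerX].
  move=> [u w] uw; exists u%:P, w%:P; split; first exact: gpolyC.
  by rewrite !hornerC.
split.
- by move=> r; exists (i r)%:P, (j r)%:P; rewrite !hornerC; split=> //; apply: gpolyC.
- move=> u w u' w' [P [Q [h [-> ->]]]] [P' [Q' [h' [-> ->]]]].
  by exists (P - P'), (Q - Q'); rewrite !hornerD !hornerN; split=> //; apply: gpolyB.
- move=> u w u' w' [P [Q [h [-> ->]]]] [P' [Q' [h' [-> ->]]]].
  by exists (P * P'), (Q * Q'); rewrite !hornerM; split=> //; apply: gpolyM.
by move=> w [P [Q [h [e ->]]]]; apply: (key (size P) P Q).
Qed.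

End OnePartialHom.

(** A root of an irreducible polynomial can be sent to any other root:
    evaluation at the two roots defines a homomorphism on k[al], and a
    maximal extension given by the lemma of Zorn is defined everywhere. *)
Lemma hom_extension (f : {poly k}) al be : irreducible_poly f ->
  root (map_poly i f) al -> root (map_poly j f) be ->
  exists phi : {rmorphism L -> K}, (forall a, phi (i a) = j a) /\ phi al = be.
Proof.
move=> irrf fal fbe.
pose G0 := [set u : L * K | exists P, u = ((map_poly i P).[al], (map_poly j P).[be])]%classic.
have G0hom : partial_hom G0.
  split.
  - by move=> a; exists a%:P; rewrite !map_polyC !hornerC.
  - move=> a b a' b' [P [-> ->]] [P' [-> ->]]; exists (P - P').
    by rewrite !rmorphB !hornerD !hornerN.
  - move=> a b a' b' [P [-> ->]] [P' [-> ->]]; exists (P * P').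
    by rewrite !rmorphM !hornerM.
  move=> b [P [e ->]]; have fP : f %| P.
    have [//|nfP] := boolP (f %| P).
    have : coprimep f P by rewrite irreducible_poly_coprime.
    rewrite -(coprimep_map i) => /coprimep_root/(_ fal).
    by rewrite -e eqxx.
  have : map_poly j f %| map_poly j P by rewrite dvdp_map.
  by case/dvdpP => q ->; apply/rootP; rewrite rootM fbe orbT.
pose PP X := X = set0 \/ (G0 `<=` X /\ partial_hom X)%classic.
have [A [PA Amax]] : exists A, PP A /\ forall B, (A `<` B)%classic -> ~ PP B.
  apply: Zorn_bigcup => FF FP Ftot.
  have [[X [FX X0]]|nX] := EM (exists X, FF X /\ X <> set0); last first.
    left; apply/seteqP; split=> // u [X FX Xu]; case: nX; exists X; split=> // X0.
    by rewrite X0 in Xu.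
  have XP Y : FF Y -> forall u, Y u -> (G0 `<=` Y /\ partial_hom Y)%classic.
    by move=> FY u Yu; case: (FP _ FY) => // Y0; rewrite Y0 in Yu.
  have XG : (G0 `<=` X /\ partial_hom X)%classic by case: (FP _ FX).
  right; split; first by move=> u /(XG.1) Xu; exists X.
  have two u v : (\bigcup_(Y in FF) Y)%classic u -> (\bigcup_(Y in FF) Y)%classic v ->
      exists Y, [/\ FF Y, Y u & Y v].
    move=> [Y FY Yu] [Z FZ Zv]; have [YZ|ZY] := Ftot _ _ FY FZ.
      by exists Z; split=> //; apply: YZ.
    by exists Y; split=> //; apply: ZY.
  split.
  - by move=> a; exists X => //; case: XG => _ [].
  - move=> a b a' b' u v; have [Y [FY Yu Yv]] := two _ _ u v; exists Y => //.
    by case: (XP _ FY _ Yu) => _ [_ h _ _]; apply: h.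
  - move=> a b a' b' u v; have [Y [FY Yu Yv]] := two _ _ u v; exists Y => //.
    by case: (XP _ FY _ Yu) => _ [_ _ h _]; apply: h.
  by move=> b [Y FY Yb]; case: (XP _ FY _ Yb) => _ [_ _ _]; apply.
have G00 : G0 (0, 0) by exists 0; rewrite !rmorph0 !horner0.
have [A0|[G0A Ahom]] := PA.
  exfalso; have h : (A `<` G0)%classic.
    by rewrite A0; split=> // sub; have := sub _ G00.
  by apply: (Amax _ h); right; split.
have tot := partial_hom_maximal Ahom
  (fun B AB Bhom => Amax B AB (or_intror (conj (subset_trans G0A AB.1) Bhom))).
pose phi a := projT1 (cid (tot a)).
have phiP a : A (a, phi a) by rewrite /phi; case: cid.
have phiE a b : A (a, b) -> phi a = b by apply: partial_hom_fun.
have [Ak AB AM _] := Ahom.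
have phiB : zmod_morphism phi by move=> a b; apply: phiE; apply: AB.
have phiM : monoid_morphism phi.
  split; first by apply: phiE; have := Ak 1; rewrite !rmorph1.
  by move=> a b; apply: phiE; apply: AM.
pose Phi : {rmorphism L -> K} := HB.pack phi
  (GRing.isZmodMorphism.Build L K phi phiB) (GRing.isMonoidMorphism.Build L K phi phiM).
exists Phi; split; first by move=> a; apply: phiE.
by apply: phiE; apply: G0A; exists 'X; rewrite !map_polyX !hornerX.
Qed.

End HomExtension.

(** * Conjugate elements and Galois descent *)

Section Conjugates.

Variables (k : fieldType) (K : closedFieldType) (iota : {rmorphism k -> K}).
Hypothesis alg : forall a : K, algebraicOver iota a.

Lemma min_poly_exists (F : fieldType) (j : {rmorphism F -> K}) z :
    algebraicOver j z ->
  exists f, [/\ irreducible_poly f, root (map_poly j f) z &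
    forall p, root (map_poly j p) z -> f %| p].
Proof.
move=> [p0 p00 p0z].
have ex : exists n, `[< exists f : {poly F}, [/\ f != 0, root (map_poly j f) z & size f = n] >].
  by exists (size p0); apply/asboolP; exists p0.
case: (ex_minnP ex) => n /asboolP[f [f0 fz szf]] nmin.
have fmin (g : {poly F}) : g != 0 -> root (map_poly j g) z -> (size f <= size g)%N.
  by move=> g0 gz; rewrite szf; apply: nmin; apply/asboolP; exists g.
exists f; split=> //; last first.
  move=> p pz; apply/negPn/negP => nfp.
  have : (size f <= size (p %% f)%R)%N.
    apply: fmin; first by rewrite /dvdp in nfp.
    move: pz; rewrite {1}(divp_eq p f) rmorphD rmorphM /= /root hornerD hornerM.
    by rewrite (eqP fz) mulr0 add0r.
  by rewrite leqNgt ltn_modp f0.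
split; first by rewrite -(size_map_poly j); apply: root_size_gt1 fz; rewrite map_poly_eq0.
move=> g sg gf; have [h fE] := dvdpP _ _ gf.
have /andP[h0 g0] : (h != 0) && (g != 0) by rewrite -negb_or -mulf_eq0 -fE.
rewrite -dvdp_size_eqp // eqn_leq dvdp_leq //=.
move: fz; rewrite fE rmorphM rootM => /orP[/(fmin _ h0)|/(fmin _ g0)]; rewrite -fE //.
rewrite {1}fE size_mul // leqNgt; case: (size g) sg (size_poly_gt0 g) => [|[|m]].
- by rewrite g0.
- by [].
by move=> _ _; rewrite addnS /= addnS ltnS leq_addr.
Qed.

(** An endomorphism over the base field permutes the finite set of roots of a
    polynomial with coefficients in the base field. *)
Lemma alg_endo_surj (phi : {rmorphism K -> K}) : (forall a, phi (iota a) = iota a) ->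
  forall z, exists w, phi w = z.
Proof.
move=> phik z; have [p p0 pz] := alg z.
have P0 : map_poly iota p != 0 by rewrite map_poly_eq0.
pose rs := undup (root_seq (map_poly iota p)).
have mem_rs w : (w \in rs) = root (map_poly iota p) w by rewrite mem_undup mem_root_seq.
have sub : {subset map phi rs <= rs}.
  move=> u /mapP[w]; rewrite !mem_rs => /eqP pw ->; apply/eqP.
  have <- : map_poly phi (map_poly iota p) = map_poly iota p.
    by rewrite -map_poly_comp; apply: eq_map_poly.
  by rewrite horner_map pw rmorph0.
have u : uniq (map phi rs) by rewrite map_inj_uniq ?undup_uniq //; apply: fmorph_inj.
have [_ e] := uniq_min_size u sub (eq_leq (esym (size_map _ _))).
have : z \in map phi rs by rewrite e mem_rs.
by case/mapP => w _ ->; exists w.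
Qed.

(** The homomorphism given by hom_extension is bijective, because it permutes
    the roots of each polynomial over k. *)
Lemma gal_transitive f a b : irreducible_poly f ->
  root (map_poly iota f) a -> root (map_poly iota f) b ->
  exists s : galois_aut iota, s a = b.
Proof.
move=> irr fa fb; have [phi [phik phia]] := hom_extension alg irr fa fb.
have sur := alg_endo_surj phik.
pose psi z := projT1 (cid (sur z)).
have psiK : cancel psi phi by move=> z; rewrite /psi; case: cid.
have Kpsi : cancel phi psi by move=> z; apply: (fmorph_inj phi); rewrite psiK.
have psiB : zmod_morphism psi.
  by move=> u v; apply: (fmorph_inj phi); rewrite rmorphB !psiK.
have psiM : monoid_morphism psi.
  split; first by apply: (fmorph_inj phi); rewrite psiK rmorph1.
  by move=> u v; apply: (fmorph_inj phi); rewrite rmorphM !psiK.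
pose Psi : {rmorphism K -> K} := HB.pack psi
  (GRing.isZmodMorphism.Build K K psi psiB) (GRing.isMonoidMorphism.Build K K psi psiM).
by exists (@GaloisAut k K iota phi Psi Kpsi psiK phik).
Qed.

Lemma gal_root (s : galois_aut iota) q z :
  root (map_poly iota q) (s z) = root (map_poly iota q) z.
Proof.
by rewrite /root -[map_poly iota q in LHS](gal_poly s) horner_map fmorph_eq0.
Qed.

(** Galois descent for the divisors of a separable polynomial, by induction
    on the degree: the minimal polynomial f of a root z of q has only
    conjugates of z as roots, so f divides q, and q / f is again invariant. *)
Lemma gal_invariant_dvd (p : {poly k}) (q : {poly K}) : separable_poly p ->
  q \is monic -> q %| map_poly iota p ->
  (forall (s : galois_aut iota) z, root q z -> root q (s z)) ->
  exists q0, q = map_poly iota q0.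
Proof.
move=> p_sep; have [n] := ubnP (size q).
elim: n q => // n IHn q szq qm qp qs.
have P_sep : separable_poly (map_poly iota p) by rewrite separable_map.
have [/size_poly1P[a _ qE]|nq] := boolP (size q == 1%N).
  by exists 1; rewrite rmorph1; move: qm; rewrite qE monicE lead_coefC => /eqP ->.
have [z qz] : exists z, root q z by apply/closed_rootP.
(* every other root of the minimal polynomial of z is conjugate to z *)
have [f [irr fz fmin]] := min_poly_exists (alg z).
have f0 : f != 0 by apply: irredp_neq0.
pose f1 := (lead_coef f)^-1 *: f; pose g := map_poly iota f1.
have lf : lead_coef f != 0 by rewrite lead_coef_eq0.
have g_root w : root g w = root (map_poly iota f) w.
  by rewrite /g /f1 map_polyZ rootZ // fmorph_eq0 invr_eq0.
have gm : g \is monic by rewrite monicE lead_coef_map /f1 lead_coefZ mulVf ?rmorph1.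
have fp : f %| p.
  by apply: fmin; case/dvdpP: qp => r ->; rewrite rootM qz orbT.
have gp : g %| map_poly iota p by rewrite dvdp_map dvdpZl ?invr_eq0.
have g_sep : separable_poly g by apply: dvdp_separable gp P_sep.
have gq : g %| q.
  have := root_seqE g; rewrite (monicP gm) scale1r => ->.
  apply: uniq_roots_dvdp; last by rewrite uniq_rootsE root_seq_uniq.
  apply/allP => w; rewrite mem_root_seq ?monic_neq0 // g_root => fw.
  by have [s <-] := gal_transitive irr fz fw; apply: qs.
have [h qE] := dvdpP _ _ gq.
have h0 : h != 0 by apply: contraTneq (monic_neq0 qm) => h0; rewrite qE h0 mul0r eqxx.
have hm : h \is monic by move: qm; rewrite qE monicMr.
have gh_cop : coprimep h g.
  have := dvdp_separable qp P_sep.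
  by rewrite qE separable_mul => /and3P[].
have [|||h1 h1E] := IHn h _ hm.
- apply: leq_trans (_ : (size q <= n)%N) => //; rewrite qE size_mul ?monic_neq0 //.
  rewrite -[X in (X < _)%N]addn0 -subn1 -addnBA ?ltn_add2l ?subn_gt0.
    by apply: (root_size_gt1 (monic_neq0 gm)); rewrite g_root; apply: fz.
  by rewrite size_poly_gt0 monic_neq0.
- by apply: dvdp_trans qp; rewrite qE dvdp_mulr.
- move=> s w hw; have : root q (s w) by apply: qs; rewrite qE rootM hw.
  rewrite qE rootM g_root gal_root -g_root => /orP[//|gw].
  by have /coprimep_root/(_ hw) := gh_cop; rewrite (eqP gw) eqxx.
by exists (h1 * f1); rewrite rmorphM /= -h1E.
Qed.

End Conjugates.

(** * Splitting fields *)

Section AdjoinInd.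

Variables (k : fieldType) (L : fieldExtType k).

(** The elements of a field generated by finitely many algebraic elements are
    polynomials in these. *)
Lemma adjoin_seq_ind (P : L -> Prop) (rs : seq L) : (forall a : k, P a%:A) ->
  (forall x y, P x -> P y -> P (x + y)) -> (forall x y, P x -> P y -> P (x * y)) ->
  (forall x, x \in rs -> P x) -> forall x, x \in <<1 & rs>>%VS -> P x.
Proof.
move=> Pk PD PM; elim/last_ind: rs => [|rs r IHr] Pr x.
  by rewrite Fadjoin_nil => /vlineP[a ->].
rewrite adjoin_rcons => /Fadjoin_polyP[p /polyOverP pU ->].
have {}IHr : forall x, x \in <<1 & rs>>%VS -> P x.
  by apply: IHr => y yr; apply: Pr; rewrite mem_rcons in_cons yr orbT.
have P0 : P 0 by have := Pk 0; rewrite scale0r.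
have P1 : P 1 by have := Pk 1; rewrite scale1r.
have Prr : P r by apply: Pr; rewrite mem_rcons mem_head.
rewrite horner_coef; elim/big_ind: _ => // i _; apply: (PM); first exact/IHr/pU.
by elim: (nat_of_ord i) => [|m IHm]; rewrite ?expr0 // exprS; apply: PM.
Qed.

End AdjoinInd.

Lemma algebraicOver_in_alg (k : fieldType) (L : fieldExtType k) (x : L) :
  algebraicOver (in_alg L) x.
Proof.
have [/polyOver1P[p Dp] m] := (minPolyOver 1 x, monic_minPoly 1 x).
exists p; last by rewrite -Dp root_minPoly.
by have := monic_neq0 m; rewrite Dp map_poly_eq0.
Qed.

Lemma splittingFieldFor_root (k : fieldType) (L : fieldExtType k) (p : {poly L}) :
  splittingFieldFor 1 p {:L} -> exists rs, (forall z, root p z = (z \in rs)) /\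
    p %= \prod_(z <- rs) ('X - z%:P) /\ <<1 & rs>>%VS = {:L}%VS.
Proof.
case=> rs prs full; exists rs; split=> // z.
by rewrite (eqp_root prs) root_prod_XsubC.
Qed.

Section SplittingFields.

Variables (k : fieldType) (K : closedFieldType) (iota : {rmorphism k -> K}).
Hypothesis alg : forall a : K, algebraicOver iota a.

Lemma algebraicOver_comp (F : fieldType) (j : {rmorphism k -> F})
    (phi : {rmorphism F -> K}) : (forall a, phi (j a) = iota a) ->
  forall a : K, algebraicOver phi a.
Proof.
move=> e a; have [p p0 pa] := alg a; exists (map_poly j p); first by rewrite map_poly_eq0.
by rewrite -map_poly_comp (eq_map_poly (g := iota)).
Qed.

Lemma embedding_exists (L : fieldExtType k) :
  exists phi : {rmorphism L -> K}, forall a, phi a%:A = iota a.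
Proof.
have irr : irreducible_poly ('X : {poly k}).
  by rewrite -['X]subr0 -polyC0; apply: irredp_XsubC.
have r0 (F : fieldType) (j : {rmorphism k -> F}) : root (map_poly j 'X) 0.
  by rewrite map_polyX rootX.
have [phi [h _]] := hom_extension (@algebraicOver_in_alg k L) irr (r0 _ _) (r0 _ iota).
by exists phi.
Qed.

End SplittingFields.

(** Adjoins the minimal polynomials of the elements one after the other. *)
Lemma adjoin_exists (F : fieldType) (K : closedFieldType) (j : {rmorphism F -> K})
    (zs : seq K) : (forall a, algebraicOver j a) ->
  exists (L : fieldExtType F) (phi : {rmorphism L -> K}) (rs : seq L),
    (forall a, phi a%:A = j a) /\ map phi rs = zs.
Proof.
elim: zs F j => [|z zs IHz] F j alg.
  have [phi phiE] := @embedding_exists F K j F^o.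
  by exists F^o, phi, [::].
have [f [irr fz _]] := min_poly_exists (alg z).
have [E _ [x xf _]] := irredp_FAdjoin irr.
have [psi [psiE psix]] := hom_extension (@algebraicOver_in_alg F E) irr xf fz.
have [L [phi [rs [phiE e]]]] := IHz E psi (algebraicOver_comp alg psiE).
pose L0 : fieldExtType F := baseFieldType L.
pose phi0 : {rmorphism L0 -> K} := phi.
exists L0, phi0, (x%:A :: rs : seq L); split.
  move=> a; transitivity (phi ((a%:A : E)%:A)); last by rewrite phiE; apply: psiE.
  by congr (phi _); apply: baseField_scaleE.
by rewrite /= -e; congr (_ :: _); rewrite -psix; apply: phiE.
Qed.

(** The subfield generated by the roots is a splitting field. *)
Lemma subvs_splitting (k : fieldType) (L : fieldExtType k) (f : {poly k}) (rs : seq L) :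
  map_poly (in_alg L) f %= \prod_(z <- rs) ('X - z%:P) ->
  exists M : fieldExtType k, is_splitting_field f M.
Proof.
move=> frs; pose M := subvs_of <<1 & rs>>; pose toL := linfun (vsval : M -> L).
have toLE (u : M) : toL u = vsval u by rewrite lfunE.
pose ts : seq M := map (vsproj _) rs.
have ets : map vsval ts = rs.
  by rewrite -map_comp map_id_in // => y ry /=; rewrite vsprojK ?seqv_sub_adjoin.
exists M, ts.
  rewrite -(eqp_map (@vsval _ _ <<1 & rs>>%VS)) rmorph_prod /= -map_poly_comp.
  under eq_bigr do rewrite rmorphB /= map_polyX map_polyC.
  rewrite -(big_map vsval xpredT (fun z => 'X - z%:P)) ets.
  by rewrite (eq_map_poly (g := in_alg L)) // => a; apply: rmorph_alg.
apply/vspaceP => u; rewrite memvf.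
have : vsval u \in (toL @: <<1 & ts>>)%VS.
  rewrite aimg_adjoin_seq aimg1; have -> : map toL ts = rs by apply: etrans ets; apply: eq_map.
  exact: (valP u).
by case/memv_imgP => v vt; rewrite toLE => /val_inj ->.
Qed.

Section SplittingCriterion.

Variables (k : fieldType) (K : closedFieldType) (iota : {rmorphism k -> K}).
Hypothesis alg : forall a : K, algebraicOver iota a.

Definition fixes_roots (f : {poly k}) (s : galois_aut iota) : Prop :=
  forall z, root (map_poly iota f) z -> s z = z.

Lemma splitting_exists (f : {poly k}) : f != 0 ->
  exists L : fieldExtType k, is_splitting_field f L.
Proof.
move=> f0; pose zs := root_seq (map_poly iota f).
have [L [phi [rs [phiE e]]]] := adjoin_exists zs alg.
apply: (@subvs_splitting _ L f rs).
rewrite -(eqp_map phi) rmorph_prod /= -map_poly_comp.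
under eq_bigr do rewrite rmorphB /= map_polyX map_polyC.
rewrite -(big_map phi xpredT (fun z => 'X - z%:P)) e.
rewrite (eq_map_poly (g := iota)) // {1}[map_poly iota f]root_seqE.
by apply: eqp_scale; rewrite lead_coef_eq0 map_poly_eq0.
Qed.

Section Embedded.

Variables (f : {poly k}) (L : fieldExtType k) (phi : {rmorphism L -> K}).
Hypotheses (f_L : is_splitting_field f L) (phiE : forall a, phi a%:A = iota a).

Lemma map_embedding : map_poly phi (map_poly (in_alg L) f) = map_poly iota f.
Proof. by rewrite -map_poly_comp; apply: eq_map_poly. Qed.

Lemma splitting_root (z : K) : root (map_poly iota f) z ->
  exists2 w, root (map_poly (in_alg L) f) w & z = phi w.
Proof.
have [rs [rsE [prs _]]] := splittingFieldFor_root f_L.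
rewrite -map_embedding (eqp_root (q := map_poly phi (\prod_(z <- rs) ('X - z%:P)))).
  rewrite rmorph_prod /=; under eq_bigr do rewrite rmorphB /= map_polyX map_polyC.
  rewrite -(big_map phi xpredT (fun z => 'X - z%:P)) root_prod_XsubC.
  by case/mapP => w wrs ->; exists w; rewrite ?rsE.
by rewrite eqp_map.
Qed.

Lemma root_embedding (w : L) : root (map_poly (in_alg L) f) w ->
  root (map_poly iota f) (phi w).
Proof. by rewrite -map_embedding /root horner_map => /eqP ->; rewrite rmorph0. Qed.

Lemma splitting_ind (P : L -> Prop) : (forall a : k, P a%:A) ->
  (forall x y, P x -> P y -> P (x + y)) -> (forall x y, P x -> P y -> P (x * y)) ->
  (forall x, root (map_poly (in_alg L) f) x -> P x) -> forall x, P x.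
Proof.
move=> Pk PD PM Pr x; have [rs [rsE [_ full]]] := splittingFieldFor_root f_L.
apply: (adjoin_seq_ind Pk PD PM (rs := rs)) => [y yrs|]; first by apply: Pr; rewrite rsE.
by rewrite full memvf.
Qed.

(** The roots generate L. *)
Lemma fixes_rootsP (s : galois_aut iota) :
  fixes_roots f s <-> forall x : L, s (phi x) = phi x.
Proof.
split=> [h|h z /splitting_root[w _ ->]]; last exact: h.
apply: splitting_ind => [a|x y hx hy|x y hx hy|x fx].
- by rewrite phiE gal_fix.
- by rewrite !rmorphD hx hy.
- by rewrite !rmorphM hx hy.
by apply: h; apply: root_embedding.
Qed.

(** The automorphisms over phi(L) fix z, so the divisor X - z of g is defined
    over L by Galois descent. *)
Lemma fixed_in_splitting (g : {poly k}) z : separable_poly g ->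
  root (map_poly iota g) z -> (forall s, fixes_roots f s -> s z = z) ->
  exists x, z = phi x.
Proof.
move=> g_sep gz zfix; pose gL := map_poly (in_alg L) g.
have gLE : map_poly phi gL = map_poly iota g.
  by rewrite -map_poly_comp; apply: eq_map_poly.
have gL_sep : separable_poly gL by rewrite separable_map.
have algL : forall a : K, algebraicOver phi a.
  by apply: (algebraicOver_comp (j := in_alg L) alg) => a; apply: phiE.
have [|||q0 qE] := gal_invariant_dvd algL gL_sep (q := 'X - z%:P).
- exact: monicXsubC.
- by rewrite gLE dvdp_XsubCl.
- move=> s w; rewrite !root_XsubC => /eqP ->; apply/eqP.
  have sk a : s (iota a) = iota a by rewrite -phiE gal_fix.
  pose s1 := @GaloisAut k K iota s (Defs.gal_inv s) (Defs.galK s) (gal_invK s) sk.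
  by apply: (zfix s1); apply/fixes_rootsP => x; apply: gal_fix.
exists (- q0`_0); rewrite rmorphN -coef_map -qE coefB coefX coefC sub0r opprK.
by [].
Qed.

End Embedded.

(** Embed both splitting fields in K. If the same automorphisms fix them,
    each contains the roots of the other polynomial, so the images coincide.
    Conversely, isomorphic splitting fields embed in K with the same image. *)
Lemma isomorphic_splittingP (f g : {poly k}) : separable_poly f -> separable_poly g ->
  isomorphic_splitting_fields f g <->
  forall s : galois_aut iota, fixes_roots f s <-> fixes_roots g s.
Proof.
move=> f_sep g_sep; split=> [[L [M [fL gM [h [h' hK h'K]]]]] s|same].
  have [psi psiE] := embedding_exists iota M.
  have phiE a : (psi \o h) a%:A = iota a.
    by rewrite /= linearZ /= rmorph1 psiE.
  rewrite (fixes_rootsP fL (phi := psi \o h) phiE) (fixes_rootsP gM psiE).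
  by split=> e x; [have := e (h' x); rewrite /= h'K | exact: e].
have [L fL] := splitting_exists (separable_poly_neq0 f_sep).
have [M gM] := splitting_exists (separable_poly_neq0 g_sep).
have [phi phiE] := embedding_exists iota L.
have [psi psiE] := embedding_exists iota M.
have sub1 x : exists y, phi x = psi y.
  apply: (splitting_ind fL (P := fun x => exists y, phi x = psi y)) => [a|u v|u v|u fu].
  - by exists a%:A; rewrite phiE psiE.
  - by move=> [y e] [y' e']; exists (y + y'); rewrite !rmorphD e e'.
  - by move=> [y e] [y' e']; exists (y * y'); rewrite !rmorphM e e'.
  have fu' := root_embedding phiE fu.
  apply: (fixed_in_splitting gM psiE f_sep fu') => s /same; exact.
have sub2 y : exists x, psi y = phi x.
  apply: (splitting_ind gM (P := fun y => exists x, psi y = phi x)) => [a|u v|u v|u gu].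
  - by exists a%:A; rewrite phiE psiE.
  - by move=> [x e] [x' e']; exists (x + x'); rewrite !rmorphD e e'.
  - by move=> [x e] [x' e']; exists (x * x'); rewrite !rmorphM e e'.
  have gu' := root_embedding psiE gu.
  apply: (fixed_in_splitting fL phiE g_sep gu') => s /same; exact.
exists L, M; split=> //.
pose h x := projT1 (cid (sub1 x)); pose h' y := projT1 (cid (sub2 y)).
have hE x : psi (h x) = phi x by rewrite /h; case: cid.
have h'E y : phi (h' y) = psi y by rewrite /h'; case: cid.
have hB : zmod_morphism h.
  by move=> u v; apply: (fmorph_inj psi); rewrite rmorphB !hE rmorphB.
have hM : monoid_morphism h.
  split; first by apply: (fmorph_inj psi); rewrite hE !rmorph1.
  by move=> u v; apply: (fmorph_inj psi); rewrite rmorphM !hE rmorphM.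
have hZ : scalable h.
  move=> a u; apply: (fmorph_inj psi); rewrite -mulr_algl -[a *: h u]mulr_algl.
  by rewrite hE !rmorphM hE phiE psiE.
pose H : {lrmorphism L -> M} := HB.pack h (GRing.isZmodMorphism.Build L M h hB)
  (GRing.isMonoidMorphism.Build L M h hM) (GRing.isScalable.Build k L M *:%R h hZ).
exists H, h' => x; first by apply: (fmorph_inj phi); rewrite h'E; apply: hE.
by apply: (fmorph_inj psi); apply: etrans (hE _) (h'E x).
Qed.

End SplittingCriterion.

(** * Pairings of differences of branch points *)

Lemma exists_notin (T : eqType) (s t : seq T) : uniq s -> (size t < size s)%N ->
  exists2 x, x \in s & x \notin t.
Proof.
move=> us st; have [/hasP[x xs xt]|] := boolP (has (fun x => x \notin t) s).
  by exists x.
rewrite -all_predC => /allP h; have sub : {subset s <= t}.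
  by move=> x /h /=; rewrite negbK.
by have := uniq_leq_size us sub; rewrite leqNgt st.
Qed.

Section TwoTorsionTheory.

Variables (K : fieldType) (A : zmodType) (T : eqType) (V : set A).
Variables (e : A -> A -> K) (bs : seq T) (d : T -> T -> A).
Hypothesis X : two_torsion V e bs d.
Hypothesis two_neq0 : 2%:R != 0 :> K.
Hypothesis size_bs : (3 < size bs)%N.

Lemma neq_N11 : (-1 == 1 :> K) = false.
Proof. by rewrite eq_sym -addr_eq0 (negPf two_neq0). Qed.

Lemma tt_N a : V a -> - a = a.
Proof. by move=> Va; apply/esym/eqP; rewrite -addr_eq0 (tt_2 X). Qed.

Lemma tt_B a b : V a -> V b -> V (a - b).
Proof. by move=> Va Vb; rewrite tt_N //; apply: (tt_D X). Qed.

Lemma tt_neq0 a b : V a -> V b -> e a b != 0.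
Proof. by move=> Va Vb; rewrite -[_ == 0]andTb -(expf_eq0 _ 2) (tt_sqr X) ?oner_eq0. Qed.

Lemma tt_e0l a : V a -> e 0 a = 1.
Proof.
move=> Va; have V0 := tt_0 X; apply: (mulfI (tt_neq0 V0 Va)).
by rewrite -(tt_M X) // addr0 mulr1.
Qed.

Lemma tt_e0r a : V a -> e a 0 = 1.
Proof. by move=> Va; rewrite (tt_sym X) ?tt_e0l //; apply: (tt_0 X). Qed.

Lemma tt_Mr a b j : V a -> V b -> V j -> e j (a + b) = e j a * e j b.
Proof.
move=> Va Vb Vj; rewrite (tt_sym X) //; last exact: (tt_D X).
by rewrite (tt_M X) // !(tt_sym X Vj).
Qed.

Lemma tt_dC i j : i \in bs -> j \in bs -> d i j = d j i.
Proof.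
move=> ib jb; rewrite -[RHS]tt_N; last exact: (tt_d X).
by apply/eqP; rewrite -addr_eq0 (tt_dD X) (tt_dii X).
Qed.

Lemma tt_dl i j k : i \in bs -> j \in bs -> k \in bs -> d i j + d i k = d j k.
Proof. by move=> ib jb kb; rewrite (tt_dC ib jb) (tt_dD X). Qed.

(** d k l is d i k + d i l, and both terms pair with d i j to -1. *)
Lemma tt_disj i j k l : i \in bs -> j \in bs -> k \in bs -> l \in bs ->
  uniq [:: i; j; k; l] -> e (d i j) (d k l) = 1.
Proof.
move=> ib jb kb lb /=; rewrite !in_cons !in_nil !orbF !negb_or !andbT.
move=> /and3P[/and3P[ij ik il] /andP[jk jl] kl].
rewrite -(tt_dl ib kb lb) tt_Mr; try exact: (tt_d X).
rewrite !(tt_pair X) ?mulrNN ?mulr1 //=;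
  by rewrite !in_cons !in_nil !orbF !negb_or ?ij ?ik ?il ?jk ?jl.
Qed.

Lemma tt_third i j : i \in bs -> j \in bs -> i != j ->
  exists2 k, k \in bs & uniq [:: i; j; k].
Proof.
move=> ib jb ij; have [|k kb] := @exists_notin _ bs [:: i; j] (tt_uniq X).
  exact: ltn_trans size_bs.
rewrite !in_cons in_nil orbF negb_or => /andP[ki kj]; exists k => //=.
by rewrite !in_cons !in_nil !orbF !negb_or ij eq_sym ki eq_sym kj.
Qed.

Lemma tt_dneq0 i j : i \in bs -> j \in bs -> i != j -> d i j != 0.
Proof.
move=> ib jb ij; have [k kb u] := tt_third ib jb ij.
apply/eqP => d0; have := tt_pair X ib jb kb u.
by rewrite d0 tt_e0l; [move/eqP; rewrite eq_sym neq_N11 | apply: (tt_d X)].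
Qed.

Lemma tt_nondeg a : V a -> (forall b, V b -> e a b = 1) -> a = 0.
Proof.
move=> Va h; have [//|[i [j [ib jb ij aE]]]] := tt_gen X Va.
have [k kb u] := tt_third ib jb ij; have := tt_pair X ib jb kb u.
by rewrite -aE h; [move/eqP; rewrite eq_sym neq_N11 | apply: (tt_d X)].
Qed.

End TwoTorsionTheory.

(** * Splittings of four points and Klein four-groups *)

Lemma F3P (x : 'F_3) : [\/ x = 0, x = 1 | x = -1].
Proof.
case: x => [[|[|[|m]]] h]; [constructor 1|constructor 2|constructor 3|by []];
  exact: val_inj.
Qed.

(** The three ways to split four points into two pairs, indexed by 'F_3 so that
    the indices of three distinct splittings add up to 0. *)
Definition splitting (T R : Type) (w0 w1 w2 w3 : T) (f : T -> T -> T -> T -> R)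
    (x : 'F_3) : R :=
  if x == 0 then f w0 w1 w2 w3 else if x == 1 then f w0 w2 w1 w3 else f w0 w3 w1 w2.

Section FourPoints.

Variables (T : eqType) (w0 w1 w2 w3 : T).
Local Notation ws := [:: w0; w1; w2; w3].
Local Notation split := (splitting w0 w1 w2 w3).

Lemma splitting_all (P : T -> T -> T -> T -> Prop) :
  P w0 w1 w2 w3 -> P w0 w2 w1 w3 -> P w0 w3 w1 w2 -> forall x, split P x.
Proof. by move=> p0 p1 p2 x; rewrite /splitting; case: eqP => // _; case: eqP. Qed.

(** A property of ordered splittings that is invariant under exchanging the
    points of the first pair, and the two pairs, has to be checked only on
    the three representatives. *)
Lemma splitting_cases (P : T -> T -> T -> T -> Prop) :
  (forall u v k l, u \in ws -> v \in ws -> k \in ws -> l \in ws ->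
    P u v k l -> P v u k l) ->
  (forall u v k l, u \in ws -> v \in ws -> k \in ws -> l \in ws ->
    P u v k l -> P k l u v) ->
  (forall x, split P x) ->
  forall u v k l, u \in ws -> v \in ws -> k \in ws -> l \in ws ->
    uniq [:: u; v; k; l] -> P u v k l.
Proof.
move=> H1 H2 Px.
have eight u v k l : u \in ws -> v \in ws -> k \in ws -> l \in ws -> P u v k l ->
    [/\ P u v k l, P v u k l, P u v l k & P v u l k] /\
    [/\ P k l u v, P k l v u, P l k u v & P l k v u].
  by move=> uw vw kw lw p; split; split; auto.
have wP0 : w0 \in ws by rewrite !in_cons eqxx ?orbT.
have wP1 : w1 \in ws by rewrite !in_cons eqxx ?orbT.
have wP2 : w2 \in ws by rewrite !in_cons eqxx ?orbT.
have wP3 : w3 \in ws by rewrite !in_cons eqxx ?orbT.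
have [[? ? ? ?] [? ? ? ?]] := eight _ _ _ _ wP0 wP1 wP2 wP3 (Px 0).
have [[? ? ? ?] [? ? ? ?]] := eight _ _ _ _ wP0 wP2 wP1 wP3 (Px 1).
have [[? ? ? ?] [? ? ? ?]] := eight _ _ _ _ wP0 wP3 wP1 wP2 (Px (-1)).
move=> u v k l; rewrite !in_cons !in_nil !orbF.
move=> /or4P[] /eqP -> /or4P[] /eqP ->;
  try (by move=> _ _; rewrite /= !in_cons eqxx).
all: move=> /or4P[] /eqP ->; try (by move=> _; rewrite /= !in_cons eqxx ?orbT ?andbF).
all: move=> /or4P[] /eqP -> //; by rewrite /= !in_cons eqxx ?orbT ?andbF.
Qed.

Lemma two_more u v : uniq ws -> u \in ws -> v \in ws -> u != v ->
  exists k l, [/\ k \in ws, l \in ws & uniq [:: u; v; k; l]].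
Proof.
move=> uw uws vws uv.
have [//|k kw ku] := @exists_notin _ ws [:: u; v] uw.
have [//|l lw lu] := @exists_notin _ ws [:: u; v; k] uw.
exists k, l; split=> //; move: ku lu; rewrite /= !in_cons !in_nil !orbF !negb_or uv.
by move=> /andP[ku kv] /and3P[lu lv lk]; rewrite ![_ == k]eq_sym ![_ == l]eq_sym ku kv lu lv lk.
Qed.

End FourPoints.

(** A subgroup U containing v in which U / <v> is a Klein four-group with
    nonzero elements the classes of the a x, and where e induces the
    nondegenerate alternating pairing on U / <v>. *)
Record klein (K : fieldType) (A : zmodType) (U : set A) (e : A -> A -> K) (v : A)
    (a : 'F_3 -> A) : Prop := Klein {
  kl_in : forall x, U (a x);
  kl_v : U v;
  kl_gen : forall b, U b -> [\/ b = 0, b = v | exists x, b = a x \/ b = a x + v];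
  kl_add : forall x y, x != y -> a x + a y + a (- (x + y)) = v;
  kl_neq0 : forall x, a x != 0;
  kl_neqv : forall x, a x != v;
  kl_pair : forall x y, x != y -> e (a x) (a y) = -1
}.

Section FourPointsKlein.

Variables (K : fieldType) (A : zmodType) (T : eqType) (V : set A).
Variables (e : A -> A -> K) (bs : seq T) (d : T -> T -> A).
Hypothesis X : two_torsion V e bs d.
Hypothesis two_neq0 : 2%:R != 0 :> K.
Hypothesis size_bs : (3 < size bs)%N.
Variables (w0 w1 w2 w3 : T) (v : A).
Local Notation ws := [:: w0; w1; w2; w3].
Hypothesis uw : uniq ws.
Hypothesis wb : {subset ws <= bs}.
Hypothesis dv : forall i j k l, i \in ws -> j \in ws -> k \in ws -> l \in ws ->
  uniq [:: i; j; k; l] -> d i j + d k l = v.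

Local Notation dsplit := (splitting w0 w1 w2 w3 (fun u v _ _ => d u v)).

Let wP0 : w0 \in ws. Proof. by rewrite !in_cons eqxx ?orbT. Qed.
Let wP1 : w1 \in ws. Proof. by rewrite !in_cons eqxx ?orbT. Qed.
Let wP2 : w2 \in ws. Proof. by rewrite !in_cons eqxx ?orbT. Qed.
Let wP3 : w3 \in ws. Proof. by rewrite !in_cons eqxx ?orbT. Qed.

Lemma dsplit_compl i j k l : i \in ws -> j \in ws -> k \in ws -> l \in ws ->
  uniq [:: i; j; k; l] -> d k l = d i j + v.
Proof.
move=> iw jw kw lw u; rewrite -(dv iw jw kw lw u) addrA (tt_2 X) ?add0r //.
by apply: (tt_d X); apply: wb.
Qed.

(** The companion r is meant to be the root of the resolvent attached to a
    splitting. It gets the same index as the element d i j. *)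
Lemma splitting_index (R : Type) (r : T -> T -> T -> T -> R) :
  (forall i j k l, r i j k l = r j i k l) -> (forall i j k l, r i j k l = r k l i j) ->
  forall i j k l, i \in ws -> j \in ws -> k \in ws -> l \in ws ->
  uniq [:: i; j; k; l] -> exists x, r i j k l = splitting w0 w1 w2 w3 r x /\
    (d i j = dsplit x \/ d i j = dsplit x + v).
Proof.
move=> r1 r2 i j k l iw jw kw lw u.
have v2 : v + v = 0.
  rewrite -(dv iw jw kw lw u).
  by apply: (tt_2 X); apply: (tt_D X); apply: (tt_d X); apply: wb.
pose P i j k l := uniq [:: i; j; k; l] ->
  exists x, r i j k l = splitting w0 w1 w2 w3 r x /\
    (d i j = dsplit x \/ d i j = dsplit x + v).
suff : P i j k l by apply.
move: i j k l iw jw kw lw u; apply: (@splitting_cases T w0 w1 w2 w3 P).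
- move=> i j k l iw jw kw lw p u; rewrite r1 (tt_dC X) ?wb //; apply: p.
  rewrite (perm_uniq (s2 := [:: j; i; k; l])) //.
  exact/permPl/(perm_catCA [:: i] [:: j]).
- move=> i j k l iw jw kw lw p u; rewrite r2.
  have u' : uniq [:: i; j; k; l].
    rewrite (perm_uniq (s2 := [:: k; l; i; j])) //.
    exact/permPl/(perm_catC [:: i; j]).
  rewrite (dsplit_compl iw jw kw lw u'); have [x [rE dE]] := p u'; exists x.
  by split=> //; case: dE => ->; [right | left; rewrite -addrA v2 addr0].
by apply: splitting_all => _; [exists 0 | exists 1 | exists (-1)]; split=> //; left.
Qed.

(** If g permutes the four points, its actions on the elements d i j and on
    the values of r induce the same permutation of the indices of the
    splittings. *)
Lemma splitting_action (R : Type) (r : T -> T -> T -> T -> R) (g : T -> T) (gA : A -> A)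
    (gR : R -> R) :
  (forall i j k l, r i j k l = r j i k l) -> (forall i j k l, r i j k l = r k l i j) ->
  injective g -> (forall w, w \in ws -> g w \in ws) ->
  (forall i j, i \in ws -> j \in ws -> gA (d i j) = d (g i) (g j)) ->
  (forall i j k l, gR (r i j k l) = r (g i) (g j) (g k) (g l)) ->
  forall x, exists y, gR (splitting w0 w1 w2 w3 r x) = splitting w0 w1 w2 w3 r y /\
    (gA (dsplit x) = dsplit y \/ gA (dsplit x) = dsplit y + v).
Proof.
move=> r1 r2 gI gw gd gr.
have key i j k l : i \in ws -> j \in ws -> k \in ws -> l \in ws ->
    uniq [:: i; j; k; l] -> exists y,
    gR (r i j k l) = splitting w0 w1 w2 w3 r y /\
    (gA (d i j) = dsplit y \/ gA (d i j) = dsplit y + v).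
  move=> iw jw kw lw u; rewrite gr gd //.
  apply: splitting_index => //; try exact: gw.
  by rewrite (map_inj_uniq gI [:: i; j; k; l]).
have u1 : uniq [:: w0; w2; w1; w3].
  rewrite (perm_uniq (s2 := ws)) // perm_cons.
  exact/permPl/(perm_catCA [:: w2] [:: w1]).
have u2 : uniq [:: w0; w3; w1; w2].
  rewrite (perm_uniq (s2 := ws)) // perm_cons.
  exact/permPl/(perm_catC [:: w3] [:: w1; w2]).
by move=> x; have [->|->|->] := F3P x; apply: key.
Qed.

Lemma splitting_klein (U : set A) : U v -> (forall i j, i \in ws -> j \in ws -> U (d i j)) ->
  (forall b, U b -> [\/ b = 0, b = v |
     exists i j, [/\ i \in ws, j \in ws, i != j & b = d i j]]) ->
  klein U e v dsplit.
Proof.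
move=> Uv Ud Ugen; have u4 : uniq [:: w0; w1; w2; w3] := uw.
have d_neq i j : i \in ws -> j \in ws -> i != j -> d i j != 0 /\ d i j != v.
  move=> iw jw ij; have d0 := @tt_dneq0 _ _ _ _ _ _ _ X two_neq0 size_bs.
  split; first by apply: d0; rewrite ?wb.
  have [k [l [kw lw u]]] := two_more uw iw jw ij.
  apply/eqP => dE; have := dv iw jw kw lw u; rewrite dE -[RHS]addr0 => /addrI/eqP.
  apply/negP; apply: d0; rewrite ?wb //.
  by move: u => /= /and4P[_ _]; rewrite in_cons in_nil orbF.
have /and4P[] := u4; rewrite !in_cons !in_nil !orbF !negb_or.
move=> /and3P[n01 n02 n03] /andP[n12 n13] n23 _.
have neq x : dsplit x != 0 /\ dsplit x != v.
  by have [->|->|->] := F3P x; apply: d_neq.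
have pr i j : i \in ws -> j \in ws -> uniq [:: w0; i; j] -> e (d w0 i) (d w0 j) = -1.
  by move=> iw jw; apply: (tt_pair X); rewrite wb.
split=> //.
- by move=> x; have [->|->|->] := F3P x; apply: Ud.
- move=> b /Ugen[->|->|[i [j [iw jw ij ->]]]]; [by constructor 1|by constructor 2|].
  constructor 3; have [k [l [kw lw u]]] := two_more uw iw jw ij.
  have [x [_ h]] := splitting_index (r := fun _ _ _ _ => tt)
    (fun _ _ _ _ => erefl) (fun _ _ _ _ => erefl) iw jw kw lw u.
  by exists x.
- have V2 i j : i \in ws -> j \in ws -> d w0 i + d w0 j = d i j.
    by move=> iw jw; apply: (tt_dl X); apply: wb.
  have sum : d w0 w1 + d w0 w2 + d w0 w3 = v by rewrite -addrA V2 // dv.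
  move=> x y; have [->|->|->] := F3P x; have [->|->|->] := F3P y => // _;
    rewrite -sum /splitting /=.
  + by rewrite addrAC.
  + by rewrite [d w0 w2 + _]addrC.
  + by rewrite addrC addrA.
  + by rewrite -addrA addrC.
  + by rewrite addrC [d w0 w3 + _]addrC addrA.
- by move=> x; case: (neq x).
- by move=> x; case: (neq x).
move=> x y; have [->|->|->] := F3P x; have [->|->|->] := F3P y => // _;
  apply: pr => //=; rewrite !in_cons !in_nil !orbF !negb_or ?n01 ?n02 ?n03 ?n12 ?n13 ?n23 //;
  by rewrite eq_sym ?n12 ?n13 ?n23.
Qed.

End FourPointsKlein.

Section KleinInstances.

Variables (K : fieldType) (A : zmodType) (T : eqType) (V : set A).
Variables (e : A -> A -> K) (bs : seq T) (d : T -> T -> A).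
Hypothesis X : two_torsion V e bs d.
Hypothesis two_neq0 : 2%:R != 0 :> K.
Variables (w0 w1 w2 w3 : T).
Local Notation ws := [:: w0; w1; w2; w3].
Local Notation dsplit := (splitting w0 w1 w2 w3 (fun u v _ _ => d u v)).

Lemma tt_d2 i j m : i \in bs -> j \in bs -> m \in bs -> d i m + d j m = d i j.
Proof. by move=> ib jb mb; rewrite (tt_dC X jb mb) (tt_dD X). Qed.

Lemma perm_quad i j k l : i \in ws -> j \in ws -> k \in ws -> l \in ws ->
  uniq [:: i; j; k; l] -> perm_eq ws [:: i; j; k; l].
Proof.
move=> iw jw kw lw u; rewrite perm_sym; apply: uniq_perm => //.
  apply: leq_size_uniq u _ _ => // x; rewrite !in_cons in_nil orbF.
  by move=> /or4P[] /eqP ->.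
have sub : {subset [:: i; j; k; l] <= ws}.
  by move=> x; rewrite [x \in [:: i; _ ;_ ; _]]in_cons !in_cons in_nil orbF => /or4P[] /eqP ->.
by have [] := uniq_min_size u sub (leqnn 4).
Qed.

(** The sum of all d j m is 0, and in pairs it is d i j + d k l. *)
Lemma genus1_dv : perm_eq bs ws ->
  forall i j k l, i \in ws -> j \in ws -> k \in ws -> l \in ws ->
  uniq [:: i; j; k; l] -> d i j + d k l = 0.
Proof.
move=> bw i j k l iw jw kw lw u; have [m mb] := tt_rel X.
have wb x : x \in ws -> x \in bs by rewrite (perm_mem bw).
rewrite (perm_big ws bw) (perm_big [:: i; j; k; l] (perm_quad iw jw kw lw u)) /=.
by rewrite !big_cons big_nil addr0 addrA !tt_d2 // ?wb.
Qed.

Lemma genus1_klein : perm_eq bs ws -> klein V e 0 dsplit.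
Proof.
move=> bw; have wb x : x \in ws -> x \in bs by rewrite (perm_mem bw).
apply: (splitting_klein X two_neq0 _ _ wb (genus1_dv bw)).
- by rewrite (perm_size bw).
- by rewrite -(perm_uniq bw) (tt_uniq X).
- exact: (tt_0 X).
- by move=> i j iw jw; apply: (tt_d X); apply: wb.
move=> b /(tt_gen X)[->|[i [j [ib jb ij ->]]]]; first by constructor 1.
by constructor 3; exists i, j; rewrite -!(perm_mem bw).
Qed.

Section Genus2.

Variables (i0 j0 : T).
Hypothesis bw : perm_eq bs (i0 :: j0 :: ws).
Local Notation v := (d i0 j0).
Local Notation perp := [set b | V b /\ e b v = 1]%classic.

Let wb x : x \in ws -> x \in bs.
Proof. by rewrite (perm_mem bw) => xw; rewrite in_cons (in_cons j0) xw !orbT. Qed.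
Let ib : i0 \in bs. Proof. by rewrite (perm_mem bw) mem_head. Qed.
Let jb : j0 \in bs. Proof. by rewrite (perm_mem bw) !in_cons eqxx orbT. Qed.
Let ub : uniq (i0 :: j0 :: ws). Proof. by rewrite -(perm_uniq bw) (tt_uniq X). Qed.
Let size_bs : (3 < size bs)%N. Proof. by rewrite (perm_size bw). Qed.

Let ij0 : i0 != j0.
Proof. by move: ub; rewrite /= in_cons negb_or => /andP[/andP[]]. Qed.

Let wi x : x \in ws -> i0 != x.
Proof.
by move: ub; rewrite cons_uniq (in_cons j0) negb_or => /andP[/andP[_ h] _] xw;
  apply: contraNneq h => ->.
Qed.

Let wj x : x \in ws -> j0 != x.
Proof. by move: ub; rewrite !cons_uniq => /and3P[_ h _] xw; apply: contraNneq h => ->. Qed.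

Lemma genus2_dv i j k l : i \in ws -> j \in ws -> k \in ws -> l \in ws ->
  uniq [:: i; j; k; l] -> d i j + d k l = v.
Proof.
move=> iw jw kw lw u; have [m mb] := tt_rel X.
rewrite (perm_big _ bw) !(big_cons _ _ i0) !(big_cons _ _ j0) /=.
rewrite (perm_big [:: i; j; k; l] (perm_quad iw jw kw lw u)) /=.
rewrite !big_cons big_nil addr0 !addrA tt_d2 // -addrA -addrA.
rewrite -addrA [d i m + _]addrA !tt_d2 // ?wb // => /eqP; rewrite addr_eq0 => /eqP ->.
by rewrite (tt_N X) //; apply: (tt_D X); apply: (tt_d X); apply: wb.
Qed.

(** A difference d m n is orthogonal to d i0 j0 exactly when the two pairs
    are equal or disjoint, and the splittings of the other four points give
    the three classes modulo d i0 j0. *)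
Lemma genus2_klein : klein perp e v dsplit.
Proof.
have Vd i j : i \in bs -> j \in bs -> V (d i j) by apply: (tt_d X).
have dC := tt_dC X.
apply: (splitting_klein X two_neq0 size_bs _ wb genus2_dv).
- by move: ub; rewrite !cons_uniq => /and3P[].
- by split; [exact: Vd | rewrite (tt_self X) //; apply: Vd].
- move=> i j iw jw; split; first by apply: Vd; apply: wb.
  have [->|ij] := eqVneq i j; first by rewrite (tt_dii X) (tt_e0l X) //; apply: Vd.
  rewrite (tt_disj X (wb iw) (wb jw) ib jb) //= !in_cons !in_nil !orbF !negb_or ij ij0.
  by rewrite ![_ == i0]eq_sym ![_ == j0]eq_sym !wi ?wj.
have bad m n : m \in bs -> n \in ws -> m = i0 \/ m = j0 -> e (d m n) v = 1 -> False.
  move=> mb nw mij; have [o [ob om vE]] : exists o, [/\ o \in bs, uniq [:: m; n; o] & v = d m o].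
    have u m' o' : m' != n -> n != o' -> m' != o' -> uniq [:: m'; n; o'].
      by move=> mn no mo; rewrite /= !in_cons !in_nil !orbF !negb_or mn mo no.
    case: mij => ->; [exists j0 | exists i0]; split=> //; rewrite 1?(dC i0) //.
      by apply: u => //; [apply: wi | rewrite eq_sym; apply: wj].
    by apply: u; [apply: wj | rewrite eq_sym; apply: wi | rewrite eq_sym].
  rewrite vE (tt_pair X mb (wb nw) ob om) => /eqP; apply/negP.
  by rewrite (neq_N11 two_neq0).
move=> b [/(tt_gen X)[->|[i [j [ii jj ij ->]]]]]; first by constructor 1.
have mem_b x : x \in bs -> [\/ x = i0, x = j0 | x \in ws].
  rewrite (perm_mem bw) in_cons (in_cons j0) => /or3P[/eqP|/eqP|]; by
    [constructor 1|constructor 2|constructor 3].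
case: (mem_b _ ii) (mem_b _ jj) => [iE|iE|iw] [jE|jE|jw] h.
- by move: ij; rewrite iE jE eqxx.
- by constructor 2; rewrite iE jE.
- by case: (@bad i j ii jw) => //; left.
- by constructor 2; rewrite iE jE dC.
- by move: ij; rewrite iE jE eqxx.
- by case: (@bad i j ii jw) => //; right.
- by case: (@bad j i jj iw); [left | rewrite dC].
- by case: (@bad j i jj iw); [right | rewrite dC].
by constructor 3; exists i, j.
Qed.

End Genus2.

End KleinInstances.

(** * Gluing along a Klein four-group *)

Section Glue.

Variables (K : fieldType) (A B : zmodType) (T : eqType).
Variables (VA : set A) (eA : A -> A -> K) (bA : seq T) (dA : T -> T -> A).
Variables (VB : set B) (eB : B -> B -> K) (bB : seq T) (dB : T -> T -> B).
Hypothesis X : two_torsion VA eA bA dA.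
Hypothesis Y : two_torsion VB eB bB dB.
Hypothesis two_neq0 : 2%:R != 0 :> K.
Hypotheses (size_bA : (3 < size bA)%N) (size_bB : (3 < size bB)%N).

Definition pair_prod (u w : A * B) : K := eA u.1 w.1 * eB u.2 w.2.
Local Notation V := (VA `*` VB)%classic.
Local Notation e := pair_prod.

Lemma pair_prod_self u : V u -> e u u = 1.
Proof. by case=> u1 u2; rewrite /e (tt_self X u1) (tt_self Y u2) mulr1. Qed.

Lemma pair_prod_sym u w : V u -> V w -> e u w = e w u.
Proof. by move=> [u1 u2] [w1 w2]; rewrite /e (tt_sym X u1 w1) (tt_sym Y u2 w2). Qed.

Lemma pair_prodD u w t : V u -> V w -> V t -> e (u + w) t = e u t * e w t.
Proof.
move=> [u1 u2] [w1 w2] [t1 t2].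
by rewrite /e /= (tt_M X u1 w1 t1) (tt_M Y u2 w2 t2) mulrACA.
Qed.

Lemma pair_prodDr u w t : V u -> V w -> V t -> e t (u + w) = e t u * e t w.
Proof.
move=> [u1 u2] [w1 w2] [t1 t2].
by rewrite /e /= (tt_Mr X u1 w1 t1) (tt_Mr Y u2 w2 t2) mulrACA.
Qed.

Lemma pairs_N u : V u -> - u = u.
Proof.
by case: u => x y [/= u1 u2]; rewrite -[LHS]/(- x, - y) (tt_N X u1) (tt_N Y u2).
Qed.

(** A self-orthogonal element u that is orthogonal to G can be added to G,
    and in these groups all elements are self-orthogonal. *)
Lemma maximal_isotropic_orth (G : set (A * B)) : maximal_isotropic V e G ->
  forall u, V u -> (forall w, G w -> e u w = 1) -> G u.
Proof.
move=> [[[G0 GB] GV Giso] Gmax] u Vu ort.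
pose H := [set w | G w \/ G (w - u)]%classic.
have VD w w' : V w -> V w' -> V (w + w').
  by move=> [w1 w2] [w'1 w'2]; split; [apply: (tt_D X) | apply: (tt_D Y)].
have Nu := pairs_N Vu.
have u2 : u + u = 0 by rewrite -{1}Nu addNr.
have HE w : H w -> exists2 g, G g & w = g \/ w = g + u.
  case=> h; first by exists w; auto.
  by exists (w - u) => //; right; rewrite subrK.
suff <- : H = G by right; rewrite subrr.
apply: Gmax; last by move=> w Gw; left.
split.
- split; first by left.
  move=> w w' /HE[g Gg wE] /HE[g' Gg' w'E]; have Gd := GB _ _ Gg Gg'.
  case: wE w'E => -> [] ->; rewrite /H /=.
  + by left.
  + by right; rewrite opprD !Nu -addrA -addrA u2 addr0.
  + by right; rewrite addrAC addrK.
  + by left; rewrite opprD addrACA subrr addr0.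
- by move=> w /HE[g Gg [->|->]]; [exact: GV | apply: VD => //; exact: GV].
move=> w w' /HE[g Gg wE] /HE[g' Gg' w'E].
have Vg := GV _ Gg; have Vg' := GV _ Gg'; have VuD := VD _ _ _ Vu.
have ort' z : G z -> e z u = 1 by move=> Gz; rewrite pair_prod_sym ?ort //; apply: GV.
have giso : e g g' = 1 by apply: Giso.
case: wE w'E => -> [] ->.
- by [].
- by rewrite pair_prodDr // giso ort' // mulr1.
- by rewrite pair_prodD // giso mul1r ort.
rewrite pair_prodD // ?pair_prodDr //; last exact: VuD.
by rewrite giso ort' // ort // pair_prod_self // !mulr1.
Qed.

Variables (v : B) (a : 'F_3 -> A) (b : 'F_3 -> B).
Hypothesis Vv : VB v.
Hypothesis v0 : v != 0.
Local Notation perp := [set y | VB y /\ eB y v = 1]%classic.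
Hypothesis kA : klein VA eA 0 a.
Hypothesis kB : klein perp eB v b.

(** The inverse image in the product of the graph of the isomorphism sending
    a x to the class of b x modulo v; the first alternative is the part over
    0. *)
Definition glue : set (A * B) := [set u | u.1 = 0 /\ (u.2 = 0 \/ u.2 = v) \/
  exists x, u.1 = a x /\ (u.2 - b x = 0 \/ u.2 - b x = v)]%classic.

Let S (y : B) := y = 0 \/ y = v.
Let v2 : v + v = 0. Proof. exact: (tt_2 Y Vv). Qed.
Let SD y z : S y -> S z -> S (y + z).
Proof. by case=> -> [] ->; rewrite ?addr0 ?add0r ?v2; [left|right|right|left]. Qed.
Let VS y : S y -> VB y. Proof. by case=> -> //; apply: (tt_0 Y). Qed.
Let Va x : VA (a x). Proof. exact: (kl_in kA). Qed.
Let Vb x : VB (b x). Proof. by case: (kl_in kB x). Qed.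
Let b2 x : b x + b x = 0. Proof. exact: (tt_2 Y (Vb x)). Qed.
Let a2 x : a x + a x = 0. Proof. exact: (tt_2 X (Va x)). Qed.
Let bN x : - b x = b x. Proof. exact: (tt_N Y (Vb x)). Qed.

Let aD x y : x != y -> a x + a y = a (- (x + y)).
Proof.
by move=> xy; apply/eqP; rewrite -(tt_N X (Va (- (x + y)))) -addr_eq0 (kl_add kA).
Qed.

Let bD x y : x != y -> S (b x + b y - b (- (x + y))).
Proof. by move=> xy; right; rewrite bN (kl_add kB). Qed.

Lemma glueV u : glue u -> V u.
Proof.
case: u => x y; case=> [[/= -> /VS yV]|[z [/= -> /VS yV]]].
  by split=> //=; apply: (tt_0 X).
by split=> //=; rewrite -[y](subrK (b z)); apply: (tt_D Y).
Qed.

Lemma glue0v : glue (0, v). Proof. by left; split=> //; right. Qed.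
Lemma glue_ab x : glue (a x, b x).
Proof. by right; exists x; split=> //; left; rewrite subrr. Qed.

Lemma glueD u w : glue u -> glue w -> glue (u + w).
Proof.
case: u w => x y [x' y'] [[/= -> Sy]|[z [/= -> Sy]]] [[/= -> Sy']|[z' [/= -> Sy']]].
- by left; rewrite /= addr0; split=> //; apply: SD.
- right; exists z'; rewrite /= add0r; split=> //; rewrite -addrA; exact: SD.
- right; exists z; rewrite /= addr0; split=> //; rewrite addrAC; exact: SD.
have := SD Sy Sy'; rewrite addrACA; have [->|zz] := eqVneq z z'.
  by rewrite -opprD b2 subr0 => h; left; rewrite /= a2.
move=> h; right; exists (- (z + z')); rewrite /= aD //; split=> //.
rewrite -[_ + _ - _](_ : y + y' + (- b z - b z') + (b z + b z' - b (- (z + z'))) = _).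
  exact: SD h (bD zz).
by rewrite -opprD addrA subrK.
Qed.

Lemma glue_subgroup : is_subgroup glue.
Proof.
split; first by left; split=> //; left.
by move=> u w Gu Gw; rewrite (pairs_N (glueV Gw)); apply: glueD.
Qed.

Lemma S_pair y z : S y -> VB z -> eB z v = 1 -> eB y z = 1.
Proof.
case=> -> Vz zv; first exact: (tt_e0l Y).
by rewrite (tt_sym Y).
Qed.

Lemma glue_perp u : glue u -> eB u.2 v = 1.
Proof.
case=> [[_ Sy]|[x [_ Sy]]].
  by apply: S_pair => //; apply: (tt_self Y).
have VSy := VS Sy; rewrite -[u.2](subrK (b x)) (tt_M Y) // (S_pair Sy Vv (tt_self Y Vv)) mul1r.
by case: (kl_in kB x).
Qed.

Lemma glue_isotropic : isotropic e glue.
Proof.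
move=> u w Gu Gw; have [u1 u2] := glueV Gu; have [w1 w2] := glueV Gw.
have pu := glue_perp Gu; have pw := glue_perp Gw; rewrite /e /pair_prod.
case: Gu => [[-> Su]|[x [u1E Su]]].
  by rewrite (tt_e0l X) // mul1r; apply: S_pair.
case: Gw => [[-> Sw]|[y [w1E Sw]]].
  by rewrite (tt_e0r X) // mul1r (tt_sym Y) //; apply: S_pair.
have VSu := VS Su; have VSw := VS Sw.
have -> : eB u.2 w.2 = eB (b x) (b y).
  rewrite -{1}[u.2](subrK (b x)) (tt_M Y) // (S_pair Su) // mul1r.
  rewrite -{1}[w.2](subrK (b y)) (tt_Mr Y) // (tt_sym Y) //.
  by rewrite (S_pair Sw) ?mul1r //; case: (kl_in kB x).
rewrite u1E w1E; have [->|xy] := eqVneq x y.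
  by rewrite (tt_self X) // (tt_self Y) // mulr1.
by rewrite (kl_pair kA) // (kl_pair kB) // mulrNN mulr1.
Qed.

(** If u is orthogonal to (0, v), its second component is that of an element
    of the graph. Their difference lies in A and is orthogonal to all a z, so
    it vanishes. *)
Lemma glue_maximal : maximal_isotropic V e glue.
Proof.
split; first by split; [exact: glue_subgroup | exact: glueV | exact: glue_isotropic].
move=> H [[H0 HB] HV Hiso] GH; apply/seteqP; split=> // u Hu; have [u1 u2] := HV _ Hu.
have uv : eB u.2 v = 1.
  by have := Hiso _ _ Hu (GH _ glue0v); rewrite /e /pair_prod /= (tt_e0r X) // mul1r.
have [x Gx] : exists x, glue (x, u.2).
  case: (kl_gen kB (conj u2 uv)) => [->|->|[z h]].
  - by exists 0; left; split=> //; left.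
  - by exists 0; exact: glue0v.
  exists (a z); right; exists z; split=> //=.
  by case: h => ->; [left; rewrite subrr | right; rewrite addrAC subrr add0r].
have [Vx _] := glueV Gx; rewrite /= in Vx.
have Hd : H (u.1 - x, 0).
  by have := HB _ _ Hu (GH _ Gx); case: (u) => ? ? /=; congr H; congr (_, _); rewrite subrr.
have dV := tt_B X u1 Vx.
suff d0 : u.1 - x = 0 by case: (u) d0 Gx => ? ? /= /eqP; rewrite subr_eq0 => /eqP ->.
apply: (tt_nondeg X two_neq0 size_bA dV) => c Vc.
have pa z : eA (u.1 - x) (a z) = 1.
  by have := Hiso _ _ Hd (GH _ (glue_ab z)); rewrite /e /pair_prod /= (tt_e0l Y) // mulr1.
have [->|->|[z [->|->]]] := kl_gen kA Vc; rewrite ?addr0 //; exact: (tt_e0r X).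
Qed.

(** A product would contain (a 0, 0) together with (a 0, b 0). *)
Lemma glue_indecomposable :
  ~ exists GX GY, [/\ maximal_isotropic VA eA GX, maximal_isotropic VB eB GY
      & glue = (GX `*` GY)%classic].
Proof.
move=> [GX [GY [_ [[[GY0 _] _ _] _] gE]]].
have : glue (a 0, 0).
  by move: (glue_ab 0); rewrite gE => -[].
case=> [[/= /eqP]|[x [_ /=]]]; first by rewrite (negPf (kl_neq0 kA 0)).
rewrite sub0r bN => -[] /eqP.
  by rewrite (negPf (kl_neq0 kB x)).
by rewrite (negPf (kl_neqv kB x)).
Qed.

End Glue.

(** * Indecomposable maximal isotropic subgroups *)

(** The subgroup generated by v when v + v = 0. *)
Definition two_span (A : zmodType) (v y : A) : Prop := y = 0 \/ y = v.

Section KleinSpan.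

Variables (K : fieldType) (A : zmodType) (U : set A) (e : A -> A -> K) (v : A).
Variable a : 'F_3 -> A.
Hypothesis kA : klein U e v a.
Hypothesis U2 : forall y, U y -> y + y = 0.
Local Notation S := (two_span v).

Let v2 : v + v = 0. Proof. exact: U2 (kl_v kA). Qed.
Let SD y z : S y -> S z -> S (y + z).
Proof. by case=> -> [] ->; rewrite ?addr0 ?add0r ?v2; [left|right|right|left]. Qed.
Let SN y : S y -> S (- y).
Proof.
by case=> ->; [left; rewrite oppr0 | right; apply/esym/eqP; rewrite -addr_eq0 v2].
Qed.

Lemma kl_class y : U y -> S y \/ exists x, S (y - a x).
Proof.
move=> /(kl_gen kA)[->|->|[x [->|->]]]; [by left; left | by left; right | |].
  by right; exists x; left; rewrite subrr.
by right; exists x; right; rewrite addrAC subrr add0r.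
Qed.

Lemma F3_span (x y z : 'F_3) : x != y -> [|| z == x, z == y | z == - (x + y)].
Proof.
by have [->|->|->] := F3P x; have [->|->|->] := F3P y; have [->|->|->] := F3P z.
Qed.

(** Two distinct nontrivial classes of a Klein four-group generate it. *)
Lemma kl_span y1 y2 y : U y1 -> U y2 -> U y -> ~ S y1 -> ~ S y2 -> ~ S (y1 - y2) ->
  [\/ S y, S (y - y1), S (y - y2) | S (y - (y1 + y2))].
Proof.
move=> /kl_class[//|[x1 s1]] /kl_class[//|[x2 s2]] /kl_class[|[x s]] n1 n2 n12.
  by constructor 1.
have x12 : x1 != x2.
  apply/eqP => x12; apply: n12; rewrite -[y1 - y2](_ : (y1 - a x1) - (y2 - a x1) = _).
    by rewrite {2}x12; apply: SD => //; apply: SN.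
  by rewrite opprD opprK addrACA addNr addr0.
have /or3P[] := F3_span x x12 => /eqP xE.
- constructor 2; rewrite -[y - y1](_ : (y - a x) - (y1 - a x1) = _).
    by apply: SD => //; apply: SN.
  by rewrite xE opprD opprK addrACA addNr addr0.
- constructor 3; rewrite -[y - y2](_ : (y - a x) - (y2 - a x2) = _).
    by apply: SD => //; apply: SN.
  by rewrite xE opprD opprK addrACA addNr addr0.
constructor 4; have s3 : S (a x1 + a x2 - a x).
  right; rewrite xE; have -> : - a (- (x1 + x2)) = a (- (x1 + x2)).
    by apply/esym/eqP; rewrite -addr_eq0 (U2 (kl_in kA _)).
  exact: (kl_add kA).
have := SD (SD (SD s (SN s1)) (SN s2)) (SN s3).
rewrite -[y - a x - (y1 - a x1) - (y2 - a x2)]addrA -opprD [y1 - _ + _]addrACA -opprD.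
by rewrite (opprD (y1 + y2)) opprK addrACA [- a x + _]addrC addrK.
Qed.

End KleinSpan.

Section TwoTorsion6.

Variables (K : fieldType) (A : zmodType) (T : eqType) (V : set A).
Variables (e : A -> A -> K) (bs : seq T) (d : T -> T -> A).
Hypothesis Y : two_torsion V e bs d.
Hypothesis two_neq0 : 2%:R != 0 :> K.
Hypothesis size_bs : size bs = 6%N.

Lemma tt_avoid a : V a -> exists i j, [/\ i \in bs, j \in bs &
  forall m n, m \in bs -> n \in bs -> m != n -> m \notin [:: i; j] ->
    n \notin [:: i; j] -> e (d m n) a = 1].
Proof.
move=> Va; have [a0|[i [j [ib jb ij aE]]]] := tt_gen Y Va.
  have [|i ib _] := exists_notin (t := [::]) (tt_uniq Y); first by rewrite size_bs.
  by exists i, i; split=> // m n mb nb *; rewrite a0 (tt_e0r Y) //; apply: (tt_d Y).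
exists i, j; split=> // m n mb nb mn; rewrite !in_cons !in_nil !orbF !negb_or.
move=> /andP[mi mj] /andP[ni nj]; rewrite aE; apply: (tt_disj Y) => //=.
by rewrite !in_cons !in_nil !orbF !negb_or mn mi mj ni nj ij.
Qed.

(** The elements a and b involve at most four of the six points; the
    difference of two other points is orthogonal to both. *)
Lemma common_orth a b : V a -> V b ->
  exists y, [/\ V y, y != 0, e y a = 1 & e y b = 1].
Proof.
move=> /tt_avoid[i [j [ib jb ha]]] /tt_avoid[k [l [kb lb hb]]].
have [|m mb] := exists_notin (t := [:: i; j; k; l]) (tt_uniq Y); first by rewrite size_bs.
have [|n nb] := exists_notin (t := [:: m; i; j; k; l]) (tt_uniq Y); first by rewrite size_bs.
rewrite !in_cons !in_nil !orbF !negb_or.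
move=> /andP[nm /and4P[ni nj nk nl]] /and4P[mi mj mk ml].
have mn : m != n by rewrite eq_sym.
exists (d m n); split; first exact: (tt_d Y).
- by apply: (tt_dneq0 Y) => //; rewrite size_bs.
- by apply: ha => //; rewrite !in_cons !in_nil !orbF !negb_or ?ni ?nj ?mi ?mj.
by apply: hb => //; rewrite !in_cons !in_nil !orbF !negb_or ?nk ?nl ?mk ?ml.
Qed.

(** If k is not i or j, the element d k m, with m a further point, pairs to 1
    with d i j and to -1 with d k l. *)
Lemma tt_d_inj i j k l : i \in bs -> j \in bs -> k \in bs -> l \in bs ->
  i != j -> k != l -> d i j = d k l -> k \in [:: i; j].
Proof.
move=> ib jb kb lb ij kl dE; apply/negPn/negP; rewrite !in_cons in_nil orbF negb_or.
move=> /andP[ki kj].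
have [|m mb] := exists_notin (t := [:: i; j; k; l]) (tt_uniq Y); first by rewrite size_bs.
rewrite !in_cons !in_nil !orbF !negb_or => /and4P[mi mj mk ml].
have : e (d k l) (d k m) = -1.
  by apply: (tt_pair Y) => //=; rewrite !in_cons !in_nil !orbF !negb_or kl ![_ == m]eq_sym mk ml.
rewrite -dE (tt_disj Y) //=.
  by move/eqP; rewrite eq_sym (neq_N11 two_neq0).
by rewrite !in_cons !in_nil !orbF !negb_or ij ![_ == m]eq_sym mi mj mk ![_ == k]eq_sym ki kj.
Qed.

Lemma perm_pair i j : i \in bs -> j \in bs -> i != j ->
  exists w0 w1 w2 w3, perm_eq bs [:: i, j, w0, w1, w2 & [:: w3]].
Proof.
move=> ib jb ij; have p1 := perm_to_rem ib.
have jr : j \in rem i bs by rewrite (mem_rem_uniq _ (tt_uniq Y)) inE /= eq_sym ij.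
have p2 := perm_to_rem jr.
have p : perm_eq bs (i :: j :: rem j (rem i bs)).
  by apply: perm_trans p1 _; rewrite perm_cons.
have := perm_size p; rewrite size_bs.
case: (rem j (rem i bs)) p => [|w0 [|w1 [|w2 [|w3 [|]]]]] //= p _.
by exists w0, w1, w2, w3.
Qed.

End TwoTorsion6.

Section GlueStructure.

Variables (K : fieldType) (A B : zmodType) (T : eqType).
Variables (VA : set A) (eA : A -> A -> K) (bA : seq T) (dA : T -> T -> A).
Variables (VB : set B) (eB : B -> B -> K) (bB : seq T) (dB : T -> T -> B).
Hypothesis X : two_torsion VA eA bA dA.
Hypothesis Y : two_torsion VB eB bB dB.
Hypothesis two_neq0 : 2%:R != 0 :> K.
Hypotheses (size_bA : (3 < size bA)%N) (size_bB : size bB = 6%N).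
Variable a : 'F_3 -> A.
Hypothesis kA : klein VA eA 0 a.
Local Notation V := (VA `*` VB)%classic.
Local Notation e := (pair_prod eA eB).

Variable G : set (A * B).
Hypothesis Gmax : maximal_isotropic V e G.
Hypothesis Gindec : ~ exists GX GY, [/\ maximal_isotropic VA eA GX,
  maximal_isotropic VB eB GY & G = (GX `*` GY)%classic].

Let G0 : G (0, 0). Proof. by case: Gmax => [[[]]]. Qed.
Let GB u w : G u -> G w -> G (u - w). Proof. by case: Gmax => [[[_ h] _ _] _]; apply: h. Qed.
Let GV u : G u -> V u. Proof. by case: Gmax => [[_ h _] _]; apply: h. Qed.
Let GN u : G u -> G (- u). Proof. by move=> Gu; rewrite -sub0r; apply: GB. Qed.
Let GD u w : G u -> G w -> G (u + w).
Proof. by move=> Gu Gw; rewrite -[w]opprK; apply: GB => //; apply: GN. Qed.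
Let Giso u w : G u -> G w -> e u w = 1. Proof. by case: Gmax => [[_ _ h] _]; apply: h. Qed.
Let Gorth u : V u -> (forall w, G w -> e u w = 1) -> G u.
Proof. exact: (maximal_isotropic_orth X Y Gmax). Qed.
Let A0 : VA 0. Proof. exact: (tt_0 X). Qed.
Let B0 : VB 0. Proof. exact: (tt_0 Y). Qed.

Let orthA x : VA x -> (forall x' y', G (x', y') -> eA x x' = 1) -> G (x, 0).
Proof.
move=> Vx h; apply: Gorth => // -[x' y'] Gw; rewrite /pair_prod /= (h _ _ Gw).
by rewrite (tt_e0l Y) ?mulr1 //; case: (GV Gw).
Qed.

Let orthB y : VB y -> (forall x' y', G (x', y') -> eB y y' = 1) -> G (0, y).
Proof.
move=> Vy h; apply: Gorth => // -[x' y'] Gw; rewrite /pair_prod /= (h _ _ Gw).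
by rewrite (tt_e0l X) ?mulr1 //; case: (GV Gw).
Qed.

Let isoA x x' y' : G (x, 0) -> G (x', y') -> eA x x' = 1.
Proof.
move=> Gx Gw; have := Giso Gx Gw; rewrite /pair_prod /= (tt_e0l Y) ?mulr1 //.
by case: (GV Gw).
Qed.

Let isoB y x' y' : G (0, y) -> G (x', y') -> eB y y' = 1.
Proof.
move=> Gy Gw; have := Giso Gy Gw; rewrite /pair_prod /= (tt_e0l X) ?mul1r //.
by case: (GV Gw).
Qed.

Let splitG x y : G (x, y) -> G (x, 0) -> G (0, y).
Proof. by move=> h h'; have := GB h h'; congr G; congr (_, _); rewrite ?subrr ?subr0. Qed.
Let splitG' x y : G (x, y) -> G (0, y) -> G (x, 0).
Proof. by move=> h h'; have := GB h h'; congr G; congr (_, _); rewrite ?subrr ?subr0. Qed.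

Let spanA x1 x2 x : VA x1 -> VA x2 -> VA x -> x1 != 0 -> x2 != 0 -> x1 != x2 ->
  [\/ x = 0, x = x1, x = x2 | x = x1 + x2].
Proof.
move=> V1 V2 V3 n1 n2 n12; have S0 (z : A) : two_span 0 z -> z = 0 by case.
have nS (z : A) : z != 0 -> ~ two_span 0 z by move=> /eqP nz /S0.
have [] := kl_span kA (@tt_2 _ _ _ _ _ _ _ X) V1 V2 V3 (nS _ n1) (nS _ n2).
- by apply: nS; rewrite subr_eq0.
- by move/S0; constructor 1.
- by move=> /S0/eqP; rewrite subr_eq0 => /eqP; constructor 2.
- by move=> /S0/eqP; rewrite subr_eq0 => /eqP; constructor 3.
by move=> /S0/eqP; rewrite subr_eq0 => /eqP; constructor 4.
Qed.

(** If G contained (x, 0) with x nonzero, then x would span a maximal isotropic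
    subgroup, and G would be a product. *)
Lemma glue_kerA x : G (x, 0) -> x = 0.
Proof.
move=> Gx; apply/eqP/negPn/negP => x0; apply: Gindec.
have [Vx _] := GV Gx; rewrite /= in Vx.
have perpx x' : VA x' -> eA x x' = 1 -> two_span x x'.
  move=> Vx' xx'; have [->|x'0] := eqVneq x' 0; first by left.
  have [->|nxx'] := eqVneq x' x; first by right.
  case/eqP: (x0); apply: (tt_nondeg X two_neq0 size_bA Vx) => z Vz.
  rewrite eq_sym in nxx'; have [->|->|->|->] := spanA Vx Vx' Vz x0 x'0 nxx' => //.
  - exact: (tt_e0r X).
  - exact: (tt_self X).
  by rewrite (tt_Mr X) // (tt_self X) // xx' mulr1.
exists (two_span x), [set y | G (0, y)]%classic; split.
- have x2 := tt_2 X Vx; split; first split.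
  + split; first by left.
    by move=> u w [] -> [] ->; rewrite ?subr0 ?sub0r ?subrr ?(tt_N X Vx); [left|right|right|left].
  + by move=> u [] ->.
  + by move=> u w [] -> [] ->; rewrite ?(tt_self X) ?(tt_e0l X) ?(tt_e0r X).
  move=> H [_ HV Hiso] sub; apply/seteqP; split=> // u Hu; apply: perpx; first exact: HV.
  by apply: Hiso => //; apply: sub; right.
- split; first split.
  + split=> // y y' Gy Gy'; rewrite /= -[0](subrr 0); exact: (GB Gy Gy').
  + by move=> y /GV[].
  + by move=> y y' Gy Gy'; apply: isoB Gy Gy'.
  move=> H [_ HV Hiso] sub; apply/seteqP; split=> // y Hy; apply: orthB; first exact: HV.
  move=> x' y' Gw; apply: Hiso => //; apply: sub.
  have [/= Vx' _] := GV Gw; apply: splitG (Gw) _.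
  by case: (perpx _ Vx' (isoA Gx Gw)) => ->.
apply/seteqP; split=> [[x' y'] Gw|[x' y'] [/= Sx' Gy']].
  have [/= Vx' _] := GV Gw; have Sx' := perpx _ Vx' (isoA Gx Gw).
  by split=> //=; apply: splitG (Gw) _; case: Sx' => ->.
have Gx' : G (x', 0) by case: Sx' => ->.
by have := GD Gx' Gy'; congr G; congr (_, _); rewrite ?addr0 ?add0r.
Qed.

(** The projection of G to A has order at most 4 and is injective when G meets B
    trivially; the four-dimensional B then has a nonzero element orthogonal
    to the image of G. *)
Lemma glue_kerB_nontrivial : exists y, y != 0 /\ G (0, y).
Proof.
apply: contrapT => nex; have kerB y : G (0, y) -> y = 0.
  by move=> Gy; apply/eqP/negPn/negP => y0; apply: nex; exists y.
have inj x y y' : G (x, y) -> G (x, y') -> y = y'.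
  move=> h h'; apply/eqP; rewrite -subr_eq0; apply/eqP/kerB.
  by have := GB h h'; congr G; congr (_, _); rewrite subrr.
have [y1 [y2 [V1 V2 gen]]] : exists y1 y2, [/\ VB y1, VB y2 &
    forall x y, G (x, y) -> [\/ y = 0, y = y1, y = y2 | y = y1 + y2]].
  have [[[x1 y1] [G1 n1]]|h1] := EM (exists u, G u /\ u.1 != 0); last first.
    exists 0, 0; split=> // x y Gxy; constructor 1; apply: kerB.
    have [x0|x0] := eqVneq x 0; first by rewrite -x0.
    by case: h1; exists (x, y).
  have [[[x2 y2] [G2 [n2 n12]]]|h2] := EM (exists u, G u /\ (u.1 != 0 /\ x1 != u.1)).
    have [W1 V1] := GV G1; have [W2 V2] := GV G2; exists y1, y2; split=> // x y Gxy.
    have [Wx _] := GV Gxy; rewrite /= in n1 n2 n12 W1 W2 Wx.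
    have [x0|xE|xE|xE] := spanA W1 W2 Wx n1 n2 n12.
    + by constructor 1; apply: kerB; rewrite -x0.
    + by constructor 2; apply: inj Gxy _; rewrite xE.
    + by constructor 3; apply: inj Gxy _; rewrite xE.
    by constructor 4; apply: inj Gxy _; rewrite xE; apply: (GD G1 G2).
  have [_ V1] := GV G1; exists y1, 0; split=> // x y Gxy.
  have [x0|x0] := eqVneq x 0; first by constructor 1; apply: kerB; rewrite -x0.
  have [xE|xE] := eqVneq x1 x; first by constructor 2; apply: inj Gxy _; rewrite -xE.
  by case: h2; exists (x, y).
have [y [Vy y0 o1 o2]] := common_orth Y two_neq0 size_bB V1 V2.
apply: nex; exists y; split=> //; apply: orthB => // x' y' /gen[] ->.
- exact: (tt_e0r Y).
- by [].
- by [].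
by rewrite (tt_Mr Y) // o1 o2 mulr1.
Qed.

Let a0 : exists x, VA x /\ x <> 0.
Proof. by exists (a 0); split; [exact: (kl_in kA) | apply/eqP/(kl_neq0 kA)]. Qed.

(** If G contained a further element y of B, the span of v and y would be its own
    orthogonal. The second components of G would lie in it, hence in G, and the
    first components would vanish; all of A would then be orthogonal to G. *)
Lemma glue_kerB (v : B) (b : 'F_3 -> B) : v != 0 -> G (0, v) ->
  klein [set y | VB y /\ eB y v = 1]%classic eB v b ->
  forall y, G (0, y) -> two_span v y.
Proof.
move=> v0 Gv kB y Gy; apply: contrapT => nS; have [_ /= Vv] := GV Gv.
have [x0 [Vx0 nx0]] := a0; apply: nx0; apply: glue_kerA; apply: orthA => // x' y' Gw.
suff x'0 : x' = 0 by rewrite x'0 (tt_e0r X).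
apply: glue_kerA; apply: splitG' (Gw) _; have [_ /= Vy'] := GV Gw; have [_ /= Vy] := GV Gy.
have perp z : VB z -> eB v z = 1 -> VB z /\ eB z v = 1 by move=> Vz; rewrite (tt_sym Y).
have [S'|[x S'x]] := kl_class kB (perp _ Vy' (isoB Gv Gw)); first by case: S' => ->.
have [//|[z Sz]] := kl_class kB (perp _ Vy (isoB Gv Gy)).
have VS t : two_span v t -> VB t by case=> ->.
have Se t t' : two_span v t -> VB t' -> eB t' v = 1 -> eB t t' = 1.
  by case=> -> Vt' tv; [exact: (tt_e0l Y) | rewrite (tt_sym Y)].
have [Vbx ebx] := kl_in kB x; have [Vbz ebz] := kl_in kB z.
have zx : z = x.
  apply/eqP/negPn/negP => zx; have := isoB Gy Gw.
  have VSx := VS _ S'x; have VSz := VS _ Sz; have evy' : eB y' v = 1.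
    by rewrite (tt_sym Y) // (isoB Gv Gw).
  rewrite -[y](subrK (b z)) (tt_M Y) // (Se _ _ Sz) // mul1r.
  rewrite -[y'](subrK (b x)) (tt_Mr Y) // (tt_sym Y Vbz) // (Se _ _ S'x) // mul1r.
  by rewrite (kl_pair kB) // => /eqP; rewrite (neq_N11 two_neq0).
have v2 : v + v = 0 := tt_2 Y Vv.
have Syy' : two_span v (y' - y).
  have -> : y' - y = (y' - b x) - (y - b x) by rewrite opprD opprK addrACA addNr addr0.
  rewrite -zx in S'x *; case: S'x Sz => -> [] ->; rewrite ?subr0 ?sub0r ?subrr.
  - by left.
  - by right; rewrite (tt_N Y Vv).
  - by right.
  by left.
have GS t : two_span v t -> G (0, t) by case=> ->.
have := GD (GS _ Syy') Gy; congr G; congr (_, _); rewrite ?addr0 //=.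
by rewrite subrK.
Qed.

(** If x is missed, the projection of G to A is a proper subgroup of the
    Klein four-group, hence isotropic of order at most 2, and some nonzero
    element is orthogonal to it; that element would lie in G. *)
Lemma glue_projA x : VA x -> exists y, G (x, y).
Proof.
move=> Vx; apply: contrapT => nex.
have no y : ~ G (x, y) by move=> h; apply: nex; exists y.
have [[[x1 y1] [G1 n1]]|h1] := EM (exists u, G u /\ u.1 != 0); last first.
  apply: (no 0); apply: orthA => // x' y' Gw; have [->|x0] := eqVneq x' 0.
    exact: (tt_e0r X).
  by case: h1; exists (x', y').
have [/= V1 _] := GV G1; rewrite /= in n1.
suff : G (x1, 0) by move/glue_kerA/eqP; rewrite (negPf n1).
apply: orthA => // x' y' Gw; have [/= V' _] := GV Gw.
have [->|x'0] := eqVneq x' 0; first exact: (tt_e0r X).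
have [->|xx'] := eqVneq x1 x'; first exact: (tt_self X).
have [xE|xE|xE|xE] := spanA V1 V' Vx n1 x'0 xx'.
- by case: (no 0); rewrite xE.
- by case: (no y1); rewrite xE.
- by case: (no y'); rewrite xE.
by case: (no (y1 + y')); rewrite xE; apply: (GD G1 Gw).
Qed.

(** Two distinct nonzero elements of A lift to elements of G whose second
    components are distinct and nontrivial modulo v, and these generate the
    orthogonal of v. *)
Lemma glue_projB (v : B) (b : 'F_3 -> B) : v != 0 -> G (0, v) ->
  klein [set y | VB y /\ eB y v = 1]%classic eB v b ->
  forall y, VB y -> eB y v = 1 -> exists x, G (x, y).
Proof.
move=> v0 Gv kB y Vy yv; have kerB := glue_kerB v0 Gv kB; have [_ /= Vv] := GV Gv.
have [y1 G1] := glue_projA (kl_in kA 0); have [y2 G2] := glue_projA (kl_in kA 1).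
have GS t : two_span v t -> G (0, t) by case=> ->.
have nS x z : G (x, z) -> x != 0 -> ~ two_span v z.
  by move=> Gz x0 /GS/(splitG' Gz)/glue_kerA/eqP; rewrite (negPf x0).
have perp x z : G (x, z) -> VB z /\ eB z v = 1.
  by move=> Gz; have [_ Vz] := GV Gz; rewrite (tt_sym Y) // (isoB Gv Gz).
have n12 : a 0 - a 1 != 0.
  rewrite subr_eq0; apply/eqP => e01; have := kl_add kA (isT : (0 : 'F_3) != 1).
  rewrite e01 (tt_2 X (kl_in kA 1)) add0r => /eqP; apply/negP; exact: (kl_neq0 kA).
have V2 z : VB z /\ eB z v = 1 -> z + z = 0 by case=> Vz _; apply: (tt_2 Y).
have := kl_span kB V2 (perp _ _ G1) (perp _ _ G2) (conj Vy yv)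
  (nS _ _ G1 (kl_neq0 kA 0)) (nS _ _ G2 (kl_neq0 kA 1)) (nS _ _ (GB G1 G2) n12).
case=> /GS h.
- by exists 0.
- by exists (a 0); have := GD h G1; congr G; congr (_, _); rewrite ?add0r ?subrK.
- by exists (a 1); have := GD h G2; congr G; congr (_, _); rewrite ?add0r ?subrK.
by exists (a 0 + a 1); have := GD h (GD G1 G2); congr G; congr (_, _); rewrite ?add0r ?subrK.
Qed.

End GlueStructure.

(** * Actions on three points *)

Section F3Actions.

Lemma F3_affine (f : 'F_3 -> 'F_3) : injective f -> forall x, f x = (f 1 - f 0) * x + f 0.
Proof.
move=> fI; have n01 : f 0 != f 1 by rewrite (inj_eq fI).
have nN0 : f (-1) != f 0 by rewrite (inj_eq fI).
have nN1 : f (-1) != f 1 by rewrite (inj_eq fI).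
move=> x; have [->|->|->] := F3P x; first by rewrite mulr0 add0r.
  by rewrite mulr1 subrK.
rewrite mulrN1; apply/eqP; move: n01 nN0 nN1.
by have [->|->|->] := F3P (f 0); have [->|->|->] := F3P (f 1);
  have [->|->|->] := F3P (f (-1)).
Qed.

Variables (Gam : Type) (comp : Gam -> Gam -> Gam).

Definition F3_action (P : Gam -> 'F_3 -> 'F_3) : Prop :=
  (forall s, injective (P s)) /\ forall s t x, P (comp s t) x = P s (P t x).

(** The linear part of P s as an affine map of the line over the field with
    three elements. *)
Definition slope (P : Gam -> 'F_3 -> 'F_3) s := P s 1 - P s 0.

Lemma slopeP P s : F3_action P -> slope P s = 1 \/ slope P s = -1.
Proof.
move=> [PI _]; have : slope P s != 0 by rewrite subr_eq0 (inj_eq (PI s)).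
by have [->|->|->] := F3P (slope P s); auto.
Qed.

Lemma action_affine P s x : F3_action P -> P s x = slope P s * x + P s 0.
Proof. by move=> [PI _]; apply: F3_affine. Qed.

Lemma shift_comp P s t : F3_action P -> P (comp s t) 0 = slope P s * P t 0 + P s 0.
Proof. by move=> h; have [_ ->] := h; apply: action_affine. Qed.

Lemma slope_comp P s t : F3_action P -> slope P (comp s t) = slope P s * slope P t.
Proof.
move=> h; rewrite {1}/slope; have [_ c] := h.
by rewrite !c (action_affine s (P t 1) h) (action_affine s (P t 0) h) opprD addrACA subrr addr0 -mulrBr.
Qed.

Lemma trivialP P s : F3_action P -> (forall x, P s x = x) <-> slope P s = 1 /\ P s 0 = 0.
Proof.
move=> h; split=> [e|[e1 e0] x]; first by rewrite /slope !e subr0.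
by rewrite (action_affine s x h) e1 e0 mul1r addr0.
Qed.

(** A reflection has order 2, and its image under the other action is a
    nontrivial element of order 2, hence a reflection. *)
Lemma same_slope_half P Q s : F3_action P -> F3_action Q ->
  (forall s, (forall x, P s x = x) <-> (forall x, Q s x = x)) ->
  slope P s = -1 -> slope Q s = -1.
Proof.
move=> hP hQ same sP; have [sQ|//] := slopeP s hQ.
have : forall x, P (comp s s) x = x.
  apply/(trivialP _ hP); rewrite slope_comp // shift_comp // sP mulrNN mulr1 mulN1r.
  by rewrite addNr.
move/same/(trivialP _ hQ); rewrite shift_comp // sQ mul1r => -[_ c0].
have Q0 : Q s 0 = 0 by apply/eqP; move: c0 => /eqP; have [->|->|->] := F3P (Q s 0).
by have /same/(trivialP _ hP)[] := (trivialP _ hQ).2 (conj sQ Q0); rewrite sP.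
Qed.

(** Two actions on three points with the same kernel are isomorphic. All
    permutations of 'F_3 are affine; the linear parts agree because the elements
    of order 2 are the same, and an affine change of coordinates matches the
    translations. *)
Lemma isomorphic_F3_actions P Q : F3_action P -> F3_action Q ->
  (forall s, (forall x, P s x = x) <-> (forall x, Q s x = x)) ->
  exists m n : 'F_3, m != 0 /\ forall s x, m * P s x + n = Q s (m * x + n).
Proof.
move=> hP hQ same; have same' s := iff_sym (same s).
have slE s : slope P s = slope Q s.
  have [p|p] := slopeP s hP; last by rewrite p (same_slope_half hP hQ same p).
  by have [q|q] := slopeP s hQ; [rewrite p q | rewrite (same_slope_half hQ hP same' q)].
have triv s : slope P s = 1 -> P s 0 = 0 -> Q s 0 = 0.
  by move=> e1 e0; have /same/(trivialP _ hQ)[] := (trivialP _ hP).2 (conj e1 e0).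
have triv' s : slope P s = 1 -> Q s 0 = 0 -> P s 0 = 0.
  by rewrite slE => e1 e0; have /same/(trivialP _ hP)[] := (trivialP _ hQ).2 (conj e1 e0).
have [m [m0 mE]] : exists m : 'F_3, m != 0 /\ forall u, slope P u = 1 -> Q u 0 = m * P u 0.
  have [[r [r1 r0]]|no] := EM (exists r, slope P r = 1 /\ P r 0 != 0); last first.
    exists 1; split=> // u u1; rewrite mul1r.
    have u0 : P u 0 = 0 by apply/eqP/negPn/negP => u0; apply: no; exists u.
    by rewrite u0 triv.
  exists (Q r 0 * P r 0).
  have q0 : Q r 0 != 0 by apply/eqP => /(triv' r r1)/eqP; rewrite (negPf r0).
  split; first by rewrite mulf_neq0.
  move=> u u1; have pu := triv u u1.
  have c1 : P r 0 + P u 0 = 0 -> Q r 0 + Q u 0 = 0.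
    move=> h; have := triv (comp u r); rewrite (slope_comp _ _ hP).
    by rewrite (shift_comp _ _ hP) (shift_comp _ _ hQ) -slE u1 r1 !mul1r; apply.
  have c2 : P r 0 + P r 0 + P u 0 = 0 -> Q r 0 + Q r 0 + Q u 0 = 0.
    move=> h; have := triv (comp u (comp r r)); rewrite !(slope_comp _ _ hP).
    by rewrite !(shift_comp _ _ hP) !(shift_comp _ _ hQ) -!slE u1 r1 !mul1r; apply.
  have rr : P r 0 * P r 0 = 1.
    by apply/eqP; move: r0; have [->|->|->] := F3P (P r 0).
  have t0 (y : 'F_3) : y + y + y = 0 by apply/eqP; have [->|->|->] := F3P y.
  have [u0|u0] := eqVneq (P u 0) 0; first by rewrite u0 mulr0 pu.
  have /orP[/eqP ur|/eqP ur] : (P u 0 == P r 0) || (P u 0 == - P r 0).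
    move: u0 r0.
    by have [->|->|->] := F3P (P u 0); have [->|->|->] := F3P (P r 0).
  - have {}c2 : Q r 0 + Q r 0 + Q u 0 = 0 by apply: c2; rewrite ur t0.
    by rewrite ur -mulrA rr mulr1; apply: (addrI (Q r 0 + Q r 0)); rewrite c2 t0.
  have {}c1 : Q r 0 + Q u 0 = 0 by apply: c1; rewrite ur subrr.
  by rewrite ur mulrN -mulrA rr mulr1; apply: (addrI (Q r 0)); rewrite c1 subrr.
have [[t tN]|no] := EM (exists t, slope P t = -1); last first.
  exists m, 0; split=> // s x; rewrite !addr0.
  have s1 : slope P s = 1 by case: (slopeP s hP) => // sN; case: no; exists s.
  rewrite (action_affine s x hP) (action_affine s (m * x) hQ) -slE s1 !mul1r mE //.
  by rewrite mulrDr.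
exists m, (m * P t 0 - Q t 0); split=> // s x.
rewrite (action_affine s x hP) (action_affine s (m * x + _) hQ) -slE.
have [s1|sN] := slopeP s hP.
  by rewrite (mE s s1) s1 !mul1r mulrDr addrAC.
have e : Q s 0 = m * (P s 0 - P t 0) + Q t 0.
  have := mE (comp s t); rewrite (slope_comp _ _ hP) sN tN mulrNN mulr1 => /(_ erefl).
  rewrite (shift_comp _ _ hP) (shift_comp _ _ hQ) -slE sN !mulN1r [- P t 0 + _]addrC => <-.
  by rewrite addrAC addNr add0r.
rewrite e sN; set y := P t 0; set q := Q t 0; set z := P s 0; apply/eqP.
by have [->|->|->] := F3P x; have [->|->|->] := F3P m; have [->|->|->] := F3P y;
  have [->|->|->] := F3P q; have [->|->|->] := F3P z.
Qed.

End F3Actions.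

(** * Roots of the cubic resolvent *)

Section ResolventValues.

Variable K : fieldType.
Implicit Types u v k l : option K.

(** The point paired with infinity, if any, and 0 if there is none. *)
Definition pole_partner u v : K :=
  match u, v with None, Some b => b | Some a, None => a | _, _ => 0 end.

(** The root of the cubic resolvent attached to the splitting {u, v}, {k, l} of
    four branch points; when one of them is at infinity, it is the point paired
    with infinity. *)
Definition resolvent_value u v k l : K :=
  if [&& u != None, v != None, k != None & l != None] then
    odflt 0 u * odflt 0 v + odflt 0 k * odflt 0 l
  else pole_partner u v + pole_partner k l.

Lemma resolvent_valueC u v k l : resolvent_value u v k l = resolvent_value v u k l.
Proof.
by rewrite /resolvent_value; case: u v k l => [a|] [b|] [c|] [d|] //=; rewrite [b * a]mulrC.
Qed.

Lemma resolvent_value_swap u v k l : resolvent_value u v k l = resolvent_value k l u v.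
Proof.
by rewrite /resolvent_value; case: u v k l => [a|] [b|] [c|] [d|] //=; rewrite addrC.
Qed.

Lemma resolvent_value_map (s : {rmorphism K -> K}) u v k l :
  s (resolvent_value u v k l) =
  resolvent_value (omap s u) (omap s v) (omap s k) (omap s l).
Proof.
rewrite /resolvent_value; case: u v k l => [a|] [b|] [c|] [d|] //=;
  by rewrite ?rmorphD ?rmorphM ?rmorph0.
Qed.

(** For finite points the difference of the two values is (u - l) (v - k). *)
Lemma resolvent_value_neq u v k l : uniq [:: u; v; k; l] ->
  resolvent_value u v k l != resolvent_value u k v l.
Proof.
rewrite /= !in_cons !in_nil !orbF !negb_or andbT.
move=> /and3P[/and3P[uv uk ul] /andP[vk vl] kl]; move: uv uk ul vk vl kl.
have SS (x y : K) : (Some x == Some y) = (x == y) by apply: (inj_eq Some_inj).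
rewrite /resolvent_value; case: u v k l => [a|] [b|] [c|] [d|] //=;
  rewrite ?addr0 ?add0r ?SS //.
- move=> _ _ ad bc _ _.
  have -> : (a * b + c * d == a * c + b * d) = ((a - d) * (b - c) == 0).
    by rewrite -[LHS]subr_eq0; congr (_ == 0); ring.
  by rewrite mulf_eq0 !subr_eq0 negb_or ad bc.
- by move=> _ _ _ bc _ _; rewrite eq_sym.
by move=> _ _ ad _ _ _; rewrite eq_sym.
Qed.

Variables (w0 w1 w2 w3 : option K).

Definition resolvent_root := splitting w0 w1 w2 w3 resolvent_value.

Lemma resolvent_root_inj : uniq [:: w0; w1; w2; w3] -> injective resolvent_root.
Proof.
move=> uw; have perm s : perm_eq [:: w0; w1; w2; w3] s -> uniq s.
  by move=> p; rewrite -(perm_uniq p).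
have n01 : resolvent_root 0 != resolvent_root 1 by apply: resolvent_value_neq.
have rC u v k l : resolvent_value u v k l = resolvent_value u v l k.
  by rewrite resolvent_value_swap resolvent_valueC resolvent_value_swap.
have n0N : resolvent_root 0 != resolvent_root (-1).
  rewrite [resolvent_root 0]rC; apply: resolvent_value_neq.
  by apply: perm; rewrite !perm_cons; apply/permPl/(perm_catC [:: w2] [:: w3]).
have n1N : resolvent_root 1 != resolvent_root (-1).
  rewrite [resolvent_root 1]rC [resolvent_root (-1)]rC; apply: resolvent_value_neq.
  by apply: perm; rewrite perm_cons; apply/permPl/(perm_catC [:: w1] [:: w2; w3]).
move=> x y; have [->|->|->] := F3P x; have [->|->|->] := F3P y => // /eqP;
  by rewrite ?(negPf n01) ?(negPf n0N) ?(negPf n1N) // eq_sym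
    ?(negPf n01) ?(negPf n0N) ?(negPf n1N).
Qed.

End ResolventValues.

Section ResolventPoly.

Lemma map_cubic_resolvent (k K : fieldType) (iota : {rmorphism k -> K}) (p : {poly k}) :
  map_poly iota (cubic_resolvent p) = cubic_resolvent (map_poly iota p).
Proof.
rewrite /cubic_resolvent lead_coef_map -fmorphV -map_polyZ.
move: (_ *: p) => m; rewrite !coef_map !raddfD !raddfN /=.
rewrite !map_polyZ !map_polyC map_polyX !map_polyXn /=.
by rewrite (rmorphB iota) !(rmorphM iota) !(rmorph_nat iota).
Qed.

Lemma cubic_resolvent_roots (K : fieldType) (c a0 a1 a2 a3 : K) : c != 0 ->
  cubic_resolvent (c *: (\prod_(z <- [:: a0; a1; a2; a3]) ('X - z%:P))) =
  ('X - (a0 * a1 + a2 * a3)%:P) * ('X - (a0 * a2 + a1 * a3)%:P)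
    * ('X - (a0 * a3 + a1 * a2)%:P).
Proof.
move=> c0; rewrite /cubic_resolvent lead_coefZ (monicP (monic_prod_XsubC _ _ _)) mulr1.
rewrite scalerA mulVf // scale1r !big_cons big_nil mulr1.
set m := _ * _.
have mE : m = 'X^4 - (a0 + a1 + a2 + a3)%:P * 'X^3
   + (a0 * a1 + a0 * a2 + a0 * a3 + a1 * a2 + a1 * a3 + a2 * a3)%:P * 'X^2
   - (a0 * a1 * a2 + a0 * a1 * a3 + a0 * a2 * a3 + a1 * a2 * a3)%:P * 'X
   + (a0 * a1 * a2 * a3)%:P.
  rewrite /m !(polyCD, polyCM); ring.
have [m0 m1 m2 m3] : [/\ m`_0 = a0 * a1 * a2 * a3,
    m`_1 = - (a0 * a1 * a2 + a0 * a1 * a3 + a0 * a2 * a3 + a1 * a2 * a3),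
    m`_2 = a0 * a1 + a0 * a2 + a0 * a3 + a1 * a2 + a1 * a3 + a2 * a3
    & m`_3 = - (a0 + a1 + a2 + a3)].
  rewrite mE; split; rewrite !(coefD, coefN, coefCM, coefXn, coefX, coefC) /=; ring.
rewrite m0 m1 m2 m3 -!mul_polyC !(polyCD, polyCB, polyCN, polyCM, polyC_exp); ring.
Qed.

End ResolventPoly.

Section ResolventRoots.

Variables (k : fieldType) (K : closedFieldType) (iota : {rmorphism k -> K}).

(** For a quartic these are the classical expressions of the roots of the
    cubic resolvent. For a cubic the fourth branch point is at infinity, and
    the roots are those of the cubic itself. *)
Lemma resolvent_rootsP (p : {poly k}) : separable_poly p -> size p = 4%N \/ size p = 5%N ->
  exists w0 w1 w2 w3, [/\ branch (map_poly iota p) = [:: w0; w1; w2; w3],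
    injective (resolvent_root w0 w1 w2 w3), separable_poly (resolvent p) &
    forall z, root (map_poly iota (resolvent p)) z <->
      exists x, z = resolvent_root w0 w1 w2 w3 x].
Proof.
move=> p_sep sp; set P := map_poly iota p.
have P_sep : separable_poly P by rewrite separable_map.
have P0 := separable_poly_neq0 P_sep.
have szP : size P = size p by rewrite size_map_poly.
have bu := branch_uniq P_sep; have szr := size_root_seq P0.
have three (r : 'F_3 -> K) z : (exists x, z = r x) <-> (z \in [:: r 0; r 1; r (-1)]).
  split=> [[x ->]|].
    by rewrite !in_cons; have [->|->|->] := F3P x; rewrite eqxx ?orbT.
  by rewrite !in_cons in_nil orbF => /or3P[] /eqP ->; eexists.
case: sp => sp; rewrite /resolvent sp /=; move: bu; rewrite /branch szP sp /=.
  case E: (root_seq P) => [|a [|b [|c [|? ?]]]]; rewrite szP sp E // in szr => bu.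
  exists None, (Some a), (Some b), (Some c); split=> //; first exact: resolvent_root_inj.
  move=> z; rewrite three /resolvent_root /splitting /resolvent_value /= !addr0.
  by rewrite -mem_root_seq // E.
case E: (root_seq P) => [|a [|b [|c [|d [|? ?]]]]]; rewrite szP sp E // in szr => bu.
exists (Some a), (Some b), (Some c), (Some d).
have rI := resolvent_root_inj bu.
have rE : map_poly iota (cubic_resolvent p) = \prod_(z <-
    [:: resolvent_root (Some a) (Some b) (Some c) (Some d) 0;
        resolvent_root (Some a) (Some b) (Some c) (Some d) 1;
        resolvent_root (Some a) (Some b) (Some c) (Some d) (-1)]) ('X - z%:P).
  rewrite map_cubic_resolvent -/P (root_seqE P) E cubic_resolvent_roots ?lead_coef_eq0 //.
  by rewrite !big_cons big_nil mulr1 mulrA.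
split=> //; last by move=> z; rewrite rE root_prod_XsubC three.
rewrite -(separable_map iota) rE separable_prod_XsubC /= !in_cons !in_nil !orbF.
by rewrite !(inj_eq rI).
Qed.

End ResolventRoots.

(** * Quadratic factors and stable pairs of branch points *)

Section GaloisAdditivity.

Variables (K : closedFieldType) (F : fieldType) (c : {rmorphism K -> F}).
Variables (s s' : {rmorphism K -> K}) (t t' : {rmorphism F -> F}).
Hypotheses (tK : cancel t t') (t'K : cancel t' t).
Hypothesis tc : forall a, t (c a) = c (s a).
Hypothesis t'c : forall a, t' (c a) = c (s' a).

Lemma transport_PicB (a b : Pic c) :
  transport_Pic tK t'K t'c (a - b) = transport_Pic tK t'K t'c a - transport_Pic tK t'K t'c b.
Proof.
have cls_repr (z : Pic c) : z = divisor_class (repr z) by rewrite /divisor_class reprK.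
rewrite [a]cls_repr [b]cls_repr -clsB !(transport_cls tK t'K tc t'c).
by rewrite (transport_divB tK t'K tc t'c) clsB.
Qed.

End GaloisAdditivity.

Section GaloisGroup.

Variables (k : fieldType) (K : closedFieldType) (iota : {rmorphism k -> K}).

Lemma gal_PicB (q : {poly k}) (s : galois_aut iota) (a b : JacPic iota q) :
  separable_poly q -> (1 < size q)%N -> gal_Pic s (a - b) = gal_Pic s a - gal_Pic s b.
Proof.
move=> q_sep q_gt1; have p_sep : separable_poly (map_poly iota q) by rewrite separable_map.
have p_gt1 : (1 < size (map_poly iota q))%N by rewrite size_map_poly.
pose F := ff p_sep p_gt1.
pose t : {rmorphism F -> F} := funfield_rmorph (gal_poly s q).
pose t' : {rmorphism F -> F} := funfield_rmorph (gal_inv_poly s q).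
pose tK : cancel t t' := funfield_mapK (gal_inv_poly s q) (Defs.galK s) (gal_invK s).
pose t'K : cancel t' t := funfield_mapK (gal_poly s q) (gal_invK s) (Defs.galK s).
pose c : {rmorphism K -> F} := const_funfield (map_poly iota q).
have tc z : t (c z) = c (s z) := funfield_map_const (gal_poly s q) z.
pose t'c : forall z, t' (c z) = c (Defs.gal_inv s z) :=
  funfield_map_const (gal_inv_poly s q).
exact: (@transport_PicB K F c s (Defs.gal_inv s) t t' tK t'K tc t'c a b).
Qed.

Lemma gal_comp_subproof (s t : galois_aut iota) :
  cancel (s \o t) (Defs.gal_inv t \o Defs.gal_inv s).
Proof. by move=> a /=; rewrite !Defs.galK. Qed.

Lemma gal_comp_invK (s t : galois_aut iota) :
  cancel (Defs.gal_inv t \o Defs.gal_inv s) (s \o t).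
Proof. by move=> a /=; rewrite !gal_invK. Qed.

Lemma gal_comp_fix (s t : galois_aut iota) a : (s \o t) (iota a) = iota a.
Proof. by rewrite /= !gal_fix. Qed.

Definition gal_comp (s t : galois_aut iota) : galois_aut iota :=
  GaloisAut (gal_comp_subproof s t) (gal_comp_invK s t) (gal_comp_fix s t).

Lemma omap_gal_inj (s : galois_aut iota) : injective (omap s).
Proof. by move=> [x|] [y|] //= [/(fmorph_inj s) ->]. Qed.

End GaloisGroup.

Section QuadraticFactors.

Variables (k : fieldType) (K : closedFieldType) (iota : {rmorphism k -> K}).
Hypothesis alg : forall a : K, algebraicOver iota a.
Variable p : {poly k}.
Hypotheses (p_sep : separable_poly p) (p_size : size p = 6%N \/ size p = 7%N).

(** The two branch points cut out by a quadratic factor, or by a linear factor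
    together with the point at infinity. *)
Definition factor_points (q : {poly k}) : seq (option K) :=
  (if size q == 2 then [:: None] else [::]) ++ map Some (root_seq (map_poly iota q)).

Lemma quadratic_factor_size (q : {poly k}) : quadratic_factor q p ->
  [/\ separable_poly q, separable_poly (p %/ q), coprimep q (p %/ q),
      p = q * (p %/ q) & (size q, size (p %/ q)) \in [:: (3%N, 4%N); (3%N, 5%N); (2%N, 5%N)] /\
      (size p).+1 = (size q + size (p %/ q)%R)%N].
Proof.
move=> [qp sq]; have pE : p = q * (p %/ q) by rewrite mulrC divpK.
have := p_sep; rewrite {1}pE separable_mul => /and3P[s1 s2 s3].
move: (separable_poly_neq0 s1) (separable_poly_neq0 s2) => q0 r0.
split=> //; have szp : size p = (size q + size (p %/ q)%R).-1 by rewrite {1}pE size_mul.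
have := size_poly_gt0 q; rewrite q0 => qgt0.
have szp' : (size p).+1 = (size q + size (p %/ q)%R)%N.
  by rewrite szp prednK // addn_gt0 qgt0.
split=> //; move: szp'; rewrite !in_cons in_nil !xpair_eqE.
by case: sq => [->|[-> ->]]; [case: p_size => ->|];
  case: (size (p %/ q)) => [|[|[|[|[|[|[|]]]]]]].
Qed.

Lemma mem_factor_points (q : {poly k}) b : map_poly iota q != 0 ->
  (b \in factor_points q) =
    if b is Some z then root (map_poly iota q) z else size q == 2.
Proof.
move=> q0; rewrite mem_cat; case: b => [z|]; last first.
  have -> : (None \in [seq Some i | i <- root_seq (map_poly iota q)]) = false.
    by apply/negP => /mapP[].
  by case: eqP.
rewrite (mem_map Some_inj) mem_root_seq //.
by case: eqP; rewrite ?in_nil // in_cons in_nil.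
Qed.

(** The point at infinity lies in the pair when q is linear, and among the
    other four points when q has degree 2 and p has degree 5. *)
Lemma branch_factor (q : {poly k}) : quadratic_factor q p ->
  perm_eq (branch (map_poly iota p))
    (factor_points q ++ branch (map_poly iota (p %/ q))) /\ size (factor_points q) = 2%N.
Proof.
move=> /quadratic_factor_size[q_sep r_sep qr pE [sz sp]].
have q0 : map_poly iota q != 0 by rewrite map_poly_eq0 separable_poly_neq0.
have r0 : map_poly iota (p %/ q) != 0 by rewrite map_poly_eq0 separable_poly_neq0.
have p0 : map_poly iota p != 0 by rewrite map_poly_eq0 separable_poly_neq0.
have szq := size_root_seq q0; rewrite size_map_poly in szq.
split; last first.
  rewrite size_cat size_map; move: sz szq; rewrite !inE !xpair_eqE.
  by case/or3P => /andP[/eqP -> _] /= [<-].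
have mem_fp b := mem_factor_points b q0.
apply: uniq_perm; first by rewrite branch_uniq ?separable_map.
  rewrite cat_uniq branch_uniq ?separable_map // andbT; apply/andP; split.
    rewrite cat_uniq (map_inj_uniq Some_inj) root_seq_uniq ?separable_map // andbT.
    apply/andP; split; first by case: eqP.
    by apply/hasPn => b /mapP[z _ ->]; case: eqP; rewrite ?in_nil // in_cons in_nil.
  apply/hasPn => b; rewrite mem_branch // mem_fp; case: b => [z|] rz.
    apply/negP => qz; have : coprimep (map_poly iota q) (map_poly iota (p %/ q)).
      by rewrite coprimep_map.
    by move/coprimep_root/(_ qz); rewrite (eqP rz) eqxx.
  move: rz; rewrite size_map_poly; move: sz; rewrite !inE !xpair_eqE.
  by case/or3P => /andP[/eqP -> /eqP ->].
move=> b; rewrite [RHS]mem_cat mem_fp !mem_branch //; case: b => [z|].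
  by rewrite {1}pE rmorphM rootM.
rewrite !size_map_poly; move: sz sp; rewrite !inE !xpair_eqE.
by case/or3P => /andP[/eqP -> /eqP ->] [->].
Qed.

(** The monic polynomial with the finite points of the pair as roots is
    Galois invariant, so it is defined over k. A point at infinity in the
    pair forces p to have degree 5, where a linear factor is allowed. *)
Lemma stable_pair_factor i j : i \in branch (map_poly iota p) ->
  j \in branch (map_poly iota p) -> i != j ->
  (forall (s : galois_aut iota) b, b \in [:: i; j] -> omap s b \in [:: i; j]) ->
  exists q, quadratic_factor q p /\ perm_eq (factor_points q) [:: i; j].
Proof.
move=> ib jb ij stable; pose zs := pmap id [:: i; j].
have mem_zs z : (z \in zs) = (Some z \in [:: i; j]).
  by rewrite mem_pmap map_id.
have p0 : map_poly iota p != 0 by rewrite map_poly_eq0 separable_poly_neq0.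
have uij : uniq [:: i; j] by rewrite /= in_cons in_nil orbF ij.
have uzs : uniq zs.
  by rewrite /zs; case: (i) (j) ij => [x|] [y|] //= xy; rewrite in_cons in_nil orbF andbT.
have zs_root z : z \in zs -> root (map_poly iota p) z.
  rewrite mem_zs => zij; have : Some z \in branch (map_poly iota p).
    by move: zij; rewrite !in_cons in_nil orbF => /orP[] /eqP ->.
  by rewrite mem_branch.
have [|||q qE] := gal_invariant_dvd alg p_sep (q := \prod_(z <- zs) ('X - z%:P)).
- exact: monic_prod_XsubC.
- by apply: uniq_roots_dvdp; [apply/allP | rewrite uniq_rootsE].
- move=> s z; rewrite !root_prod_XsubC !mem_zs => zij; exact: (stable s (Some z)).
have q0 : map_poly iota q != 0 by rewrite -qE monic_neq0 ?monic_prod_XsubC.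
have szq : size q = (size zs).+1 by rewrite -(size_map_poly iota) -qE size_prod_XsubC.
have none : None \in [:: i; j] -> size p = 6%N.
  move=> nij; have : None \in branch (map_poly iota p).
    by move: nij; rewrite !in_cons in_nil orbF => /orP[] /eqP ->.
  by rewrite mem_branch // size_map_poly; case: p_size => ->.
have szs : size zs = 2%N \/ size zs = 1%N /\ None \in [:: i; j].
  by rewrite /zs; case: (i) (j) ij => [x|] [y|] //=; auto.
have none2 : (size q == 2) = (None \in [:: i; j]).
  rewrite szq eqSS; case: szs => [s2|[-> ->//]].
  by move: s2; rewrite /zs; case: (i) (j) ij => [x|] [y|].
have qf : quadratic_factor q p.
  split; last first.
    by rewrite szq; case: szs => [->|[-> /none ->]]; auto.
  by rewrite -(dvdp_map iota) -qE; apply: uniq_roots_dvdp; [apply/allP | rewrite uniq_rootsE].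
exists q; split=> //; have [pe _] := branch_factor qf.
have ufp : uniq (factor_points q).
  have : uniq (branch (map_poly iota p)) by rewrite branch_uniq ?separable_map.
  by rewrite (perm_uniq pe) cat_uniq => /and3P[].
apply: uniq_perm => // b; rewrite mem_factor_points //; case: b => [z|] //.
by rewrite -qE root_prod_XsubC mem_zs.
Qed.

End QuadraticFactors.

(** * The gluing criterion *)

(** If x and y are distinct, the relation kl_add would make a (- (x + y))
    trivial modulo v. *)
Lemma klein_inj (K : fieldType) (A : zmodType) (U : set A) (e : A -> A -> K) (v : A)
    (a : 'F_3 -> A) : klein U e v a -> (forall y, U y -> y + y = 0) ->
  forall x y, two_span v (a x - a y) -> x = y.
Proof.
move=> kA U2 x y sxy; apply/eqP/negPn/negP => xy.
have := kl_add kA xy; have aN : - a y = a y.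
  by apply/esym/eqP; rewrite -addr_eq0 (U2 _ (kl_in kA y)).
rewrite aN in sxy; case: sxy => -> /eqP.
  by rewrite add0r (negPf (kl_neqv kA _)).
by rewrite -[X in _ == X]addr0 (inj_eq (addrI v)) (negPf (kl_neq0 kA _)).
Qed.

Lemma klein_affine (K : fieldType) (A : zmodType) (U : set A) (e : A -> A -> K) (v : A)
    (a : 'F_3 -> A) (m n : 'F_3) : m != 0 -> klein U e v a ->
  klein U e v (fun x => a (m * x + n)).
Proof.
move=> m0 kA; have inj x y : x != y -> m * x + n != m * y + n.
  by move=> xy; rewrite (inj_eq (addIr n)) (inj_eq (mulfI m0)).
split.
- by move=> x; apply: kl_in kA _.
- exact: kl_v kA.
- move=> b /(kl_gen kA)[->|->|[x h]]; [by constructor 1|by constructor 2|].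
  constructor 3; exists (m^-1 * (x - n)).
  by rewrite mulrA mulfV // mul1r subrK.
- move=> x y /inj xy; rewrite -(kl_add kA xy); congr (_ + _); congr a.
  by apply/eqP; have [->|->|->] := F3P x; have [->|->|->] := F3P y;
    have [->|->|->] := F3P m; have [->|->|->] := F3P n.
- by move=> x; apply: kl_neq0 kA _.
- by move=> x; apply: kl_neqv kA _.
by move=> x y /inj xy; apply: kl_pair kA _ _ xy.
Qed.

Section RootActions.

Variables (k : fieldType) (K : closedFieldType) (iota : {rmorphism k -> K}).
Variable rho : 'F_3 -> K.
Hypothesis rhoI : injective rho.

Lemma root_action : (forall (s : galois_aut iota) x, exists y, s (rho x) = rho y) ->
  exists P, F3_action (@gal_comp k K iota) P /\
    forall (s : galois_aut iota) x, s (rho x) = rho (P s x).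
Proof.
move=> h; pose P s x := projT1 (cid (h s x)).
have PE (s : galois_aut iota) x : s (rho x) = rho (P s x) by rewrite /P; case: cid.
exists P; split=> //; split=> [s x y e|s t x].
  by apply/rhoI/(fmorph_inj s); rewrite !PE e.
by apply: rhoI; rewrite -!PE.
Qed.

Variables (A : zmodType) (U : set A) (e : A -> A -> K) (v : A) (a : 'F_3 -> A).
Hypothesis kA : klein U e v a.
Hypothesis U2 : forall y, U y -> y + y = 0.
Variables (s : galois_aut iota) (gA : A -> A).
Hypothesis link : forall x, exists y, s (rho x) = rho y /\
  (gA (a x) = a y \/ gA (a x) = a y + v).

Let link_span x : exists y, s (rho x) = rho y /\ two_span v (gA (a x) - a y).
Proof.
have [y [sy h]] := link x; exists y; split=> //.
by case: h => ->; [left; rewrite subrr | right; rewrite addrAC subrr add0r].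
Qed.

Lemma link_at x y : s (rho x) = rho y -> two_span v (gA (a x) - a y).
Proof. by move=> sx; have [y' [sy' h]] := link_span x; rewrite (rhoI (etrans (esym sx) sy')). Qed.

(** Both actions are induced by the same permutations of the indices. *)
Lemma link_trivial : (forall x, s (rho x) = rho x) <->
  (forall x, two_span v (gA (a x) - a x)).
Proof.
split=> [h x|h x]; first exact: link_at.
have [y [sy h']] := link_span x; rewrite sy; congr rho.
apply/esym/(klein_inj kA U2).
have v2 : v + v = 0 := U2 (kl_v kA).
have vN : - v = v by apply/esym/eqP; rewrite -addr_eq0 v2.
have -> : a x - a y = (gA (a x) - a y) - (gA (a x) - a x).
  by rewrite opprD opprK addrACA subrr add0r addrC.
case: h' (h x) => -> [] ->; rewrite ?subr0 ?sub0r ?subrr.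
- by left.
- by right.
- by right.
by left.
Qed.

End RootActions.

Section Gluings.

Variables (k : fieldType) (K : closedFieldType) (iota : {rmorphism k -> K}).
Variables (pX pY : {poly k}).
Hypothesis two_neq0 : 2%:R != 0 :> K.
Hypothesis alg : forall a : K, algebraicOver iota a.
Hypotheses (X_sep : separable_poly pX) (X_size : size pX = 4%N \/ size pX = 5%N).
Hypotheses (Y_sep : separable_poly pY) (Y_size : size pY = 6%N \/ size pY = 7%N).

Variables (A B : zmodType) (VA : set A) (eA : A -> A -> K) (VB : set B) (eB : B -> B -> K).
Local Notation bX := (branch (map_poly iota pX)).
Local Notation bY := (branch (map_poly iota pY)).
Variables (dX : option K -> option K -> A) (dY : option K -> option K -> B).
Hypothesis X : two_torsion VA eA bX dX.
Hypothesis Y : two_torsion VB eB bY dY.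
Variables (gA : galois_aut iota -> A -> A) (gB : galois_aut iota -> B -> B).
Hypothesis galX : forall s i j, i \in bX -> j \in bX ->
  gA s (dX i j) = dX (omap s i) (omap s j).
Hypothesis galY : forall s i j, i \in bY -> j \in bY ->
  gB s (dY i j) = dY (omap s i) (omap s j).
Hypothesis gAB : forall s, {morph gA s : x y / x - y}.
Hypothesis gBB : forall s, {morph gB s : x y / x - y}.

Let gA0 s : gA s 0 = 0. Proof. by have := gAB s 0 0; rewrite !subrr. Qed.
Let gB0 s : gB s 0 = 0. Proof. by have := gBB s 0 0; rewrite !subrr. Qed.

Lemma fixes_resolvent (r : {poly k}) (rho : 'F_3 -> K) (s : galois_aut iota) :
  (forall z, root (map_poly iota (resolvent r)) z <-> exists x, z = rho x) ->
  fixes_roots (resolvent r) s <-> forall x, s (rho x) = rho x.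
Proof.
move=> rE; split=> [h x|h z /rE[x ->]]; last exact: h.
by apply: h; apply/rE; exists x.
Qed.

(** The nonzero elements of the 2-torsion of X correspond to the splittings
    of the four branch points, and the Galois group acts on them as on the
    roots of the resolvent. *)
Let genus1 : exists rho a,
  [/\ klein VA eA 0 a, injective rho, separable_poly (resolvent pX),
      forall z, root (map_poly iota (resolvent pX)) z <-> exists x, z = rho x
    & forall (s : galois_aut iota) x, exists y, s (rho x) = rho y /\
        (gA s (a x) = a y \/ gA s (a x) = a y + 0)].
Proof.
have [w0 [w1 [w2 [w3 [bE rI r_sep rE]]]]] := resolvent_rootsP iota X_sep X_size.
have pm : perm_eq (branch (map_poly iota pX)) [:: w0; w1; w2; w3] by rewrite bE.
exists (resolvent_root w0 w1 w2 w3), (splitting w0 w1 w2 w3 (fun u v _ _ => dX u v)).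
have P0 : separable_poly (map_poly iota pX) by rewrite separable_map.
split=> //; first exact: (genus1_klein X two_neq0 pm).
move=> s; apply: (splitting_action X _ _ (genus1_dv X pm)).
- by rewrite -bE branch_uniq.
- by move=> w; rewrite bE.
- exact: resolvent_valueC.
- exact: resolvent_value_swap.
- exact: (@omap_gal_inj k K iota s).
- by move=> w; rewrite -bE => wb; apply: omap_gal_branch.
- by move=> i j; rewrite -bE => ib jb; apply: galX.
exact: resolvent_value_map.
Qed.

(** The element v = d i j is Galois invariant although i and j may be
    exchanged: it is the sum d w0 w1 + d w2 w3 over any splitting of the
    remaining points. *)
Lemma genus2_factor (qY : {poly k}) i j : quadratic_factor qY pY ->
  perm_eq (factor_points iota qY) [:: i; j] -> exists rho b,
  [/\ klein [set y | VB y /\ eB y (dY i j) = 1]%classic eB (dY i j) b,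
      injective rho /\ separable_poly (resolvent (pY %/ qY)),
      forall z, root (map_poly iota (resolvent (pY %/ qY))) z <-> exists x, z = rho x,
      forall (s : galois_aut iota) x, exists y, s (rho x) = rho y /\
        (gB s (b x) = b y \/ gB s (b x) = b y + dY i j)
    & forall s, gB s (dY i j) = dY i j].
Proof.
move=> qf fij; have [q_sep r_sep _ pE [sz _]] := quadratic_factor_size Y_sep Y_size qf.
have r_size : size (pY %/ qY) = 4%N \/ size (pY %/ qY) = 5%N.
  move: sz; rewrite !in_cons in_nil !xpair_eqE orbF.
  by case/or3P => /andP[_ /eqP ->]; auto.
have [w0 [w1 [w2 [w3 [bE rI res_sep rE]]]]] := resolvent_rootsP iota r_sep r_size.
have [pm _] := branch_factor iota Y_sep Y_size qf.
have bw : perm_eq bY (i :: j :: [:: w0; w1; w2; w3]).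
  by apply: perm_trans pm _; rewrite bE (perm_cat2r _ (factor_points iota qY) [:: i; j]).
have dv := genus2_dv Y bw.
have wb x : x \in [:: w0; w1; w2; w3] -> x \in bY.
  by rewrite (perm_mem bw) => xw; rewrite in_cons (in_cons j) xw !orbT.
have uw : uniq [:: w0; w1; w2; w3] by rewrite -bE branch_uniq ?separable_map.
have ws (s : galois_aut iota) w : w \in [:: w0; w1; w2; w3] ->
    omap s w \in [:: w0; w1; w2; w3].
  by rewrite -bE => wb'; apply: omap_gal_branch.
exists (resolvent_root w0 w1 w2 w3), (splitting w0 w1 w2 w3 (fun u v _ _ => dY u v)).
split=> //.
- exact: (genus2_klein Y two_neq0 bw).
- move=> s; apply: (splitting_action Y _ wb dv) => //.
  + exact: resolvent_valueC.
  + exact: resolvent_value_swap.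
  + exact: (@omap_gal_inj k K iota s).
  + exact: ws.
  + by move=> i' j' iw jw; apply: galY; apply: wb.
  exact: resolvent_value_map.
move=> s; have m0 : w0 \in [:: w0; w1; w2; w3] by rewrite mem_head.
have m1 : w1 \in [:: w0; w1; w2; w3] by rewrite !in_cons eqxx orbT.
have m2 : w2 \in [:: w0; w1; w2; w3] by rewrite !in_cons eqxx !orbT.
have m3 : w3 \in [:: w0; w1; w2; w3] by rewrite !in_cons eqxx !orbT.
have vE := dv _ _ _ _ m0 m1 m2 m3 uw.
have u' : uniq (map (omap s) [:: w0; w1; w2; w3]).
  by rewrite map_inj_uniq //; apply: (@omap_gal_inj k K iota s).
rewrite -{1}vE -(dv _ _ _ _ (ws s _ m0) (ws s _ m1) (ws s _ m2) (ws s _ m3) u').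
have Vd x y : x \in bY -> y \in bY -> VB (dY x y) by apply: (tt_d Y).
rewrite -{1}[dY w2 w3](tt_N Y); last exact: Vd (wb _ m2) (wb _ m3).
rewrite gBB !galY ?wb // (tt_N Y) //.
by apply: Vd; apply: wb; apply: ws.
Qed.

(** Given a stable G, an automorphism acts trivially on A exactly when it
    acts trivially on v^perp / v, because G is the graph of an isomorphism
    between the two. Conversely, actions with the same kernel are isomorphic
    by an affine change of index, and the graph of that isomorphism is
    stable. *)
Lemma gluing_iff :
  (exists G : set (A * B),
    [/\ maximal_isotropic (VA `*` VB)%classic (pair_prod eA eB) G,
        ~ exists GX GY, [/\ maximal_isotropic VA eA GX, maximal_isotropic VB eB GY
            & G = (GX `*` GY)%classic]
      & forall (s : galois_aut iota) u, G u -> G (gA s u.1, gB s u.2)])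
  <->
  (exists qY : {poly k}, quadratic_factor qY pY /\
    isomorphic_splitting_fields (resolvent pX) (resolvent (pY %/ qY))).
Proof.
have [rhoX [a [kA rXI rX_sep rXE linkX]]] := genus1.
have PX_sep : separable_poly (map_poly iota pX) by rewrite separable_map.
have P_sep : separable_poly (map_poly iota pY) by rewrite separable_map.
have size_bX : (3 < size bX)%N.
  by rewrite size_branch ?separable_poly_neq0 // size_map_poly; case: X_size => ->.
have sY : size bY = 6%N.
  by rewrite size_branch ?separable_poly_neq0 // size_map_poly; case: Y_size => ->.
have sY3 : (3 < size bY)%N by rewrite sY.
have tX := @tt_2 _ _ _ _ _ _ _ X; have tY := @tt_2 _ _ _ _ _ _ _ Y.
split=> [[G [Gmax Gindec Gstab]]|[q [qf iso]]]; last first.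
  have [i [j fE]] : exists i j, factor_points iota q = [:: i; j].
    have [_] := branch_factor iota Y_sep Y_size qf.
    by case: (factor_points iota q) => [|i [|j [|]]] // _; exists i, j.
  have [|rhoY [b [kB [rYI rY_sep] rYE linkY stabv]]] := genus2_factor qf (i := i) (j := j).
    by rewrite fE.
  have [pm _] := branch_factor iota Y_sep Y_size qf.
  have [ib jb ij] : [/\ i \in bY, j \in bY & i != j].
    have := branch_uniq P_sep; rewrite (perm_uniq pm) fE /= !in_cons negb_or => /andP[/andP[ij _] _].
    by rewrite !(perm_mem pm) fE !mem_cat !in_cons !eqxx !orbT.
  set v := dY i j in kB linkY stabv.
  have Vv : VB v by apply: (tt_d Y).
  have v0 : v != 0 by apply: (tt_dneq0 Y).
  have [PX [actX PXE]] : exists P, F3_action (@gal_comp k K iota) P /\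
      forall (s : galois_aut iota) x, s (rhoX x) = rhoX (P s x).
    by apply: root_action => // s x; have [y [? _]] := linkX s x; exists y.
  have [PY [actY PYE]] : exists P, F3_action (@gal_comp k K iota) P /\
      forall (s : galois_aut iota) x, s (rhoY x) = rhoY (P s x).
    by apply: root_action => // s x; have [y [? _]] := linkY s x; exists y.
  have triv (rho : 'F_3 -> K) P : injective rho ->
      (forall (s : galois_aut iota) x, s (rho x) = rho (P s x)) ->
      forall s : galois_aut iota, (forall x, s (rho x) = rho x) <-> (forall x, P s x = x).
    by move=> rI PE s; split=> h x; [apply: rI; rewrite -PE | rewrite PE h].
  have same s : (forall x, PX s x = x) <-> (forall x, PY s x = x).
    rewrite -(triv _ _ rXI PXE) -(triv _ _ rYI PYE) -!(fixes_resolvent s (rho := _)) //.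
    exact: (isomorphic_splittingP alg rX_sep rY_sep).1 iso s.
  have [m [n [m0 mnE]]] := isomorphic_F3_actions actX actY same.
  have kB' := klein_affine n m0 kB.
  exists (glue v a (fun x => b (m * x + n))); split.
  - exact: (glue_maximal X Y two_neq0 size_bX Vv kA kB').
  - exact: (glue_indecomposable Y kA kB').
  have Sgal s y : two_span v y -> two_span v (gB s y).
    by case=> ->; [left; rewrite gB0 | right; rewrite stabv].
  have v2 : v + v = 0 := tY _ Vv.
  move=> s [x y] [[/= -> Sy]|[z [/= -> Sy]]].
    by left; rewrite /= gA0; split=> //; apply: Sgal.
  right; exists (PX s z); split=> /=.
    by have := link_at rXI (linkX s) (PXE s z) => -[] /eqP; rewrite subr_eq0 => /eqP.
  have h1 := Sgal s _ Sy; rewrite gBB in h1.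
  have h2 : two_span v (gB s (b (m * z + n)) - b (m * PX s z + n)).
    by apply: (link_at rYI (linkY s)); rewrite mnE PYE.
  have -> : gB s y - b (m * PX s z + n) = (gB s y - gB s (b (m * z + n))) +
      (gB s (b (m * z + n)) - b (m * PX s z + n)) by rewrite addrA subrK.
  by case: h1 h2 => -> [] ->; rewrite ?addr0 ?add0r ?v2; [left|right|right|left].
have [v [v0 Gv]] := glue_kerB_nontrivial X Y two_neq0 sY kA Gmax.
have GB u w : G u -> G w -> G (u - w) by case: Gmax => [[[_ h] _ _] _]; apply: h.
have GV u : G u -> (VA `*` VB)%classic u.
  by case: Gmax => [[_ h _] _]; apply: h.
have [_ /= Vv] := GV _ Gv.
have [v0'|[i [j [ib jb ij vE]]]] := tt_gen Y Vv; first by rewrite v0' eqxx in v0.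
have kerA := glue_kerA X Y two_neq0 size_bX kA Gmax Gindec.
have projA := glue_projA X Y two_neq0 size_bX kA Gmax Gindec.
have ijn (s : galois_aut iota) : omap s i != omap s j.
  by rewrite (inj_eq (@omap_gal_inj k K iota s)).
have stable (s : galois_aut iota) c : c \in [:: i; j] -> omap s c \in [:: i; j].
  have [w0 [w1 [w2 [w3 bw]]]] := perm_pair Y sY ib jb ij.
  have kB := genus2_klein Y two_neq0 bw; rewrite -vE in kB.
  have kerB := glue_kerB X Y two_neq0 size_bX kA Gmax Gindec v0 Gv kB.
  have sib := omap_gal_branch Y_sep s ib; have sjb := omap_gal_branch Y_sep s jb.
  have sv : dY i j = dY (omap s i) (omap s j).
    rewrite -galY // -vE; have := Gstab s _ Gv; rewrite /= gA0 => /kerB[] // /eqP.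
    by rewrite vE galY // (negPf (tt_dneq0 Y two_neq0 sY3 sib sjb (ijn s))).
  rewrite !in_cons in_nil orbF => /orP[] /eqP ->.
    exact: (tt_d_inj Y two_neq0 sY ib jb sib sjb ij (ijn s) sv).
  apply: (tt_d_inj Y two_neq0 sY ib jb sjb sib ij _); first by rewrite eq_sym.
  by rewrite sv (tt_dC Y).
have [q [qf fij]] := stable_pair_factor alg Y_sep Y_size ib jb ij stable.
have [rhoY [b [kB [rYI rY_sep] rYE linkY stabv]]] := genus2_factor qf fij.
rewrite -vE in kB linkY stabv.
have kerB := glue_kerB X Y two_neq0 size_bX kA Gmax Gindec v0 Gv kB.
have projB := glue_projB X Y two_neq0 size_bX kA Gmax Gindec v0 Gv kB.
exists q; split=> //; apply/(isomorphic_splittingP alg rX_sep rY_sep) => s.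
rewrite (fixes_resolvent s rXE) (fixes_resolvent s rYE).
have perp2 y : VB y /\ eB y v = 1 -> y + y = 0 by case=> /tY.
rewrite (link_trivial rXI kA tX (linkX s)) (link_trivial rYI kB perp2 (linkY s)).
split=> h x.
  have [Vb bv] := kl_in kB x; have [c Gc] := projB _ Vb bv; have [/= Vc _] := GV _ Gc.
  have sc : gA s c = c.
    case: (kl_gen kA Vc) => [->|->|[z zE]]; rewrite ?gA0 //.
    have -> : c = a z by case: zE => ->; rewrite ?addr0.
    by case: (h z) => /eqP; rewrite subr_eq0 => /eqP.
  apply: kerB; have := GB _ _ (Gstab s _ Gc) Gc; rewrite /= sc.
  by congr G; congr (_, _); rewrite subrr.
left; apply: kerA; have [y Gy] := projA _ (kl_in kA x); have [_ /= Vy] := GV _ Gy.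
have GS t : two_span v t -> G (0, t).
  by case=> -> //; rewrite -[(0, 0)](subrr (0, v)); apply: GB.
have St : two_span v (gB s y - y).
  have yv : eB y v = 1.
    have [_ iso] : is_subgroup G /\ isotropic (pair_prod eA eB) G by case: Gmax => [[]].
    have := iso _ _ Gy Gv; rewrite /pair_prod /= (tt_e0r X) ?mul1r //.
    exact: (kl_in kA).
  have v2 := tY _ Vv; have vN : - v = v by apply: (tt_N Y).
  have Sgal t : two_span v t -> two_span v (gB s t).
    by case=> ->; [left; rewrite gB0 | right; rewrite stabv].
  have SD t u : two_span v t -> two_span v u -> two_span v (t + u).
    by case=> -> [] ->; rewrite ?addr0 ?add0r ?v2; [left|right|right|left].
  have SN t : two_span v t -> two_span v (- t).
    by case=> ->; [left; rewrite oppr0 | right].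
  have [Sy|[z Sz]] := kl_class kB (conj Vy yv).
    by apply: SD; [apply: Sgal | apply: SN].
  have := SD _ _ (SD _ _ (Sgal _ Sz) (SN _ Sz)) (h z); rewrite gBB; congr two_span.
  by rewrite addrAC addrA subrK opprB addrA subrK.
have := GB _ _ (GB _ _ (Gstab s _ Gy) Gy) (GS _ St).
by congr G; congr (_, _); rewrite ?subr0 //= subrr.
Qed.

End Gluings.

Theorem mainTheorem2 (k : fieldType) (kbar : closedFieldType)
    (iota : {rmorphism k -> kbar}) (pX pY : {poly k}) :
  2%N \notin [pchar k] ->
  (forall a : kbar, algebraicOver iota a) ->
  separable_poly pX -> (size pX = 4%N \/ size pX = 5%N) ->
  separable_poly pY -> (size pY = 6%N \/ size pY = 7%N) ->
  (exists G : set (JacPic iota pX * JacPic iota pY),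
    [/\ maximal_isotropic_prod G, indecomposable G & defined_over_base G])
  <->
  (exists qY : {poly k},
    quadratic_factor qY pY /\
    isomorphic_splitting_fields (resolvent pX) (resolvent (pY %/ qY))).
Proof.
move=> k2 alg X_sep X_size Y_sep Y_size.
have two_neq0 : 2%:R != 0 :> kbar.
  by apply: contra k2; rewrite -(rmorph_nat iota) fmorph_eq0 inE.
have [|dX [X galX]] := curve_torsion iota two_neq0 X_sep.
  by case: X_size => ->.
have [|dY [Y galY]] := curve_torsion iota two_neq0 Y_sep.
  by case: Y_size => ->.
have gAB s : {morph @gal_Pic k kbar iota s pX : x y / x - y}.
  by move=> x y; apply: gal_PicB => //; case: X_size => ->.
have gBB s : {morph @gal_Pic k kbar iota s pY : x y / x - y}.
  by move=> x y; apply: gal_PicB => //; case: Y_size => ->.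
exact: (gluing_iff two_neq0 alg X_sep X_size Y_sep Y_size X Y galX galY gAB gBB).
Qed.
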